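(* Let $r\in\mathbb R\setminus\{0\}$. Given an initial condition $u_0\in\mathfrak g_{-\infty}$, the unique solution to the $r$-Hunter--Saxton equation $$\left(u_x|u_x|^{r-2}\right)_{xt}+\left(u_x|u_x|^{r-2}\right)_xu_x+\left((u_x|u_x|^{r-2})_xu\right)_x=0$$ (respectively, to the generalized Proudman--Johnson equation $u_{txx}+(1+2\lambda)u_xu_{xx}+uu_{xxx}=0$ with $\lambda=r^{-1}$) is given by $u(t,x)=\varphi_t(t,\varphi^{-1}(t,x))$, where $$\varphi(t,x)=x+\int_{-\infty}^x\left(\left(\frac{t\,u_0'(y)}{r}+1\right)^r-1\right)dy .$$
   Context: $W^{\infty,1}(\mathbb R)=\bigcap_{k\ge 0}W^{k,1}(\mathbb R)$; $\mathrm{Diff}_{-\infty}(\mathbb R)=\{\varphi=\mathrm{id}+f: f'\in W^{\infty,1}(\mathbb R),\ f'>-1,\ \lim_{x\to-\infty}f(x)=0\}$, with Lie algebra $\mathfrak g_{-\infty}=\{u: u'\in W^{\infty,1}(\mathbb R),\ \lim_{x\to-\infty}u(x)=0\}$. Solutions $u$ satisfy $u(0,\cdot)=u_0$ and $u(t,\cdot)\in\mathfrak g_{-\infty}$, for as long as the flow $\varphi(t,\cdot)$ (with $\varphi_t=u\circ\varphi$, $\varphi(0)=\mathrm{id}$) remains in $\mathrm{Diff}_{-\infty}(\mathbb R)$; $\varphi^{-1}(t,\cdot)$ is the inverse of $\varphi(t,\cdot)$, and subscripts denote partial derivatives. In Lagrangian coordinates the generalized Proudman--Johnson equation with parameter $\lambda\in\mathbb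 R$ reads $$\frac{d}{dt}\left(\frac{\varphi_{xt}}{\varphi_x}\right)+\lambda\left(\frac{\varphi_{xt}}{\varphi_x}\right)^2=0 .$$ The $r$-Hunter--Saxton equation is, in Lagrangian coordinates, $r\frac{d}{dt}\left(\frac{\varphi_{tx}}{\varphi_x}\left|\frac{\varphi_{tx}}{\varphi_x}\right|^{r-2}\right)+(r-1)\left|\frac{\varphi_{tx}}{\varphi_x}\right|^r=0$. For $r\neq 0,1$ it is (formally, i.e. without regard to integrability or differentiability of the terms involving $|u_x|^{r-2}$) equivalent to the former with $\lambda=r^{-1}$, and the $r$-Hunter--Saxton equation is understood through this equivalence. *)

(* Defs.v *)
From HB Require Import structures.
From mathcomp Require Import all_boot all_order all_algebra.
From mathcomp Require Import all_classical all_reals all_analysis.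
Set Implicit Arguments.
Unset Strict Implicit.
Unset Printing Implicit Defensive.
Import Order.TTheory GRing.Theory Num.Theory.
Import numFieldNormedType.Exports.
Local Open Scope classical_set_scope.
Local Open Scope ring_scope.

Definition test_function (R : realType) (psi : R -> R) : Prop :=
  (forall n x, derivable (derive1n n psi) x 1) /\
  (exists M : R, forall x, M < `|x| -> psi x = 0).

Definition weak_derivative (R : realType) (j : nat) (f g : R -> R) : Prop :=
  forall psi : R -> R, test_function psi ->
    (\int[lebesgue_measure]_(x in setT) (f x * derive1n j psi x) =
     (-1) ^+ j * \int[lebesgue_measure]_(x in setT) (g x * psi x)).

(* W^{k,1}(R); membership only depends on f up to a null set. *)
Definition sobolev1 (R : realType) (k : nat) (f : R -> R) : Prop :=
  lebesgue_measure.-integrable setT (EFin \o f) /\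
  forall j, (j <= k)%N -> exists g : R -> R,
    lebesgue_measure.-integrable setT (EFin \o g) /\ weak_derivative j f g.

(* W^{oo,1}(R), the intersection of all W^{k,1}(R).  Its elements are classes
   of functions up to null sets; the continuity requirement selects the
   continuous representative, so that pointwise conditions on f make sense. *)
Definition sobolev1_oo (R : realType) (f : R -> R) : Prop :=
  continuous f /\ forall k, sobolev1 k f.

Definition Diff_minfty (R : realType) (p : R -> R) : Prop :=
  let f := fun x => p x - x in
  [/\ forall x, derivable f x 1,
      sobolev1_oo (derive1 f),
      forall x, -1 < derive1 f x
    & f x @[x --> -oo] --> (0 : R)].

Definition g_minfty (R : realType) (u : R -> R) : Prop :=
  [/\ forall x, derivable u x 1,
      sobolev1_oo (derive1 u)
    & u x @[x --> -oo] --> (0 : R)].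

(* l is the derivative of f at t relative to [0, +oo[: the usual derivative
   when t > 0, the right derivative when t = 0. *)
Definition is_tderive (R : realType) (f : R -> R) (t l : R) : Prop :=
  (fun h => h^-1 * (f (t + h) - f t)) @ within [set h | 0 <= t + h] 0^' --> l.

(* The time interval [0, T[, where T may be +oo. *)
Definition before (R : realType) (T : \bar R) (t : R) : Prop :=
  0 <= t /\ (t%:E < T)%E.

Definition continuous_before (R : realType) (T : \bar R) (F : R -> R -> R) :
    Prop :=
  {within [set p : R * R | before T p.1], continuous (fun p => F p.1 p.2)}.

Definition flow_in_Diff (R : realType) (T : \bar R) (u p : R -> R -> R) : Prop :=
  [/\ forall x, p 0 x = x,
      forall t, before T t -> Diff_minfty (p t)
    & forall t x, before T t -> is_tderive (fun s => p s x) t (u t (p t x))].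

(* Here ut stands for u_t; the derivatives u_tx and u_txx are taken from it.
   The x-derivatives of u t exist because u t lies in g_minfty. *)
Definition PJ_solution (R : realType) (lam : R) (u0 : R -> R) (T : \bar R)
    (u : R -> R -> R) : Prop :=
  [/\ forall x, u 0 x = u0 x,
      forall t, before T t -> g_minfty (u t),
      exists p, flow_in_Diff T u p,
      forall k, (k <= 3)%N ->
        continuous_before T (fun t => derive1n k (u t))
    & exists ut : R -> R -> R,
      [/\ forall t x, before T t -> is_tderive (fun s => u s x) t (ut t x),
          forall k t x, (k < 2)%N -> before T t ->
            derivable (derive1n k (ut t)) x 1,
          forall k, (k <= 2)%N ->
            continuous_before T (fun t => derive1n k (ut t))
        & forall t x, before T t ->
            derive1n 2 (ut t) x + (1 + 2 * lam) * derive1 (u t) x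
              * derive1n 2 (u t) x
              + u t x * derive1n 3 (u t) x = 0]].

(* Solutions in Lagrangian coordinates: p is the flow of u, pxt is the time
   derivative of p_x, and q is p_xt / p_x. *)
Definition PJ_Lagrangian_solution (R : realType) (lam : R) (u0 : R -> R)
    (T : \bar R) (u : R -> R -> R) : Prop :=
  [/\ forall x, u 0 x = u0 x,
      forall t, before T t -> g_minfty (u t)
    & exists p pxt : R -> R -> R,
      [/\ flow_in_Diff T u p,
          forall t x, before T t ->
            is_tderive (fun s => derive1 (p s) x) t (pxt t x),
          continuous_before T pxt
        & let q t x := pxt t x / derive1 (p t) x in
          forall t x, before T t -> exists2 qt,
            is_tderive (fun s => q s x) t qt & qt + lam * q t x ^+ 2 = 0]].

(* The equation
     (u_x |u_x|^(r-2))_xt + (u_x |u_x|^(r-2))_x u_x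
       + ((u_x |u_x|^(r-2))_x u)_x = 0
   is understood through its formal equivalence with the Lagrangian
   Proudman--Johnson equation with lam = 1/r: taken literally, |u_x|^(r-2) need
   be neither differentiable nor even defined where u_x vanishes. *)
Definition HS_solution (R : realType) (r : R) (u0 : R -> R) (T : \bar R)
    (u : R -> R -> R) : Prop :=
  PJ_Lagrangian_solution r^-1 u0 T u.

(* sol T u reads: u is a solution on the time interval [0, T[. *)
Definition unique_maximal_solution (R : realType)
    (sol : \bar R -> (R -> R -> R) -> Prop) (T : \bar R) (u : R -> R -> R) :
    Prop :=
  sol T u /\
  forall (T' : \bar R) (v : R -> R -> R), (0%:E < T')%E -> sol T' v ->
    (T' <= T)%E /\ forall t x, before T' t -> v t x = u t x.

(* The power is the real power of a positive base as long as explicit_flow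
   remains in Diff_minfty. *)
Definition explicit_flow (R : realType) (r : R) (u0 : R -> R) (t x : R) : R :=
  x + (\int[lebesgue_measure]_(y in `]-oo, x])
         ((t * derive1 u0 y / r + 1) `^ r - 1)).

Definition explicit_solution (R : realType) (r : R) (u0 : R -> R) (t x : R) :
    R :=
  derive1 (fun s => explicit_flow r u0 s (pinv setT (explicit_flow r u0 t) x)) t.

(* Main.v *)
Require Import Defs.
From mathcomp Require Import all_boot all_order all_algebra.
From mathcomp Require Import all_classical all_reals all_analysis.
From mathcomp Require Import measurable_realfun ring lra.
Import Order.TTheory GRing.Theory Num.Theory.
Import numFieldNormedType.Exports.
Local Open Scope classical_set_scope.
Local Open Scope ring_scope.
Set Implicit Arguments.
Unset Strict Implicit.
Unset Printing Implicit Defensive.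

(* Along the flow p of a solution, q = p_xt / p_x = u_x o p solves the Riccati
   equation q' = - q ^ 2 / r with q(0) = w := u0', so q = w / (1 + t w / r), and
   p_x = (1 + t w / r) ^ r.  The solution therefore lives exactly as long as
   1 + t w / r stays positive: w vanishes at both ends, so the bound is attained
   at a first zero y0 of 1 + T w / r, and as x increases to y0 the derivative
   (1 + T w(x) / r) ^ r of the flow tends to 0 or to +oo.

   An Eulerian solution satisfies u_tx + u_x ^ 2 / r + u u_xx = c(t), hence
   q' = c - q ^ 2 / r along the flow, and the decay of q at -oo forces c = 0.

   Membership in W^{oo,1} is handled by a du Bois-Reymond argument: testing
   against differences of mollified step functions gives h(b) - h(a) = int_a^b g
   at Lebesgue points of h whenever g is the weak derivative of h.  So a
   continuous function in W^{oo,1} is smooth with all its derivatives integrable,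
   bounded, and vanishing at both ends. *)

(** * Derivatives in one variable *)

(** Positivity of 1 + t w / r is obtained pointwise in x, whereas the explicit formulas (powers of
    either sign, domination, changes of variable) need a lower bound uniform in x. Attainment of the
    extremum bridges the two, which is why uniqueness has two stages: positivity on the lifetime of
    a solution, then equality with the explicit velocity under the uniform bound.

    The flow p of an Eulerian solution comes without a time derivative of p_x, so p_x cannot be read
    off from p_xt = q p_x; it is recovered from space increments of p. Likewise q decays at -oo at
    each time separately, with no uniformity in time, so c = 0 does not follow by letting x tend to
    -oo in the Riccati equation; one needs that a small q stays small for a time independent of x.

    The time axis is closed at 0, where derivatives are one-sided. For existence this is harmless,
    since the explicit formulas make sense for slightly negative times; for uniqueness the mean
    value theorem needs only continuity at 0. *)

Section derivatives.
Context {R : realType}.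
Implicit Types (f g : R -> R) (x a b c : R).

Lemma is_derive1D f g x a b : is_derive x 1 f a -> is_derive x 1 g b ->
  is_derive x 1 (fun y => f y + g y) (a + b).
Proof. by move=> *; exact: is_deriveD. Qed.

Lemma is_derive1B f g x a b : is_derive x 1 f a -> is_derive x 1 g b ->
  is_derive x 1 (fun y => f y - g y) (a - b).
Proof. by move=> *; exact: is_deriveB. Qed.

Lemma is_derive1N f x a : is_derive x 1 f a ->
  is_derive x 1 (fun y => - f y) (- a).
Proof. by move=> *; exact: is_deriveN. Qed.

Lemma is_derive1Zl f x c a : is_derive x 1 f a ->
  is_derive x 1 (fun y => c * f y) (c * a).
Proof. by move=> *; exact: is_deriveZ. Qed.

Lemma is_derive1M f g x a b : is_derive x 1 f a -> is_derive x 1 g b ->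
  is_derive x 1 (fun y => f y * g y) (a * g x + f x * b).
Proof.
move=> fa gb; apply: (is_derive_eq (is_deriveM fa gb)).
by rewrite addrC [X in X + _]mulrC.
Qed.

Lemma is_derive1_cst c x : is_derive x 1 (fun=> c : R) 0.
Proof. exact: is_derive_cst. Qed.

Lemma is_derive1_id x : is_derive x 1 (fun y => y : R) 1.
Proof. exact: is_derive_id. Qed.

Lemma is_derive1_chain f g x a b : is_derive (g x) 1 f a ->
  is_derive x 1 g b -> is_derive x 1 (fun y => f (g y)) (b * a).
Proof.
move=> fa gb; apply: (is_derive_eq (@is_derive1_comp _ f g x a b fa gb)).
by rewrite mulrC.
Qed.

Lemma is_derive1_inv f x a : f x != 0 -> is_derive x 1 f a ->
  is_derive x 1 (fun y => (f y)^-1) (- a / f x ^+ 2).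
Proof.
move=> f0 fa; apply: (is_derive_eq (is_deriveV f0 fa)).
by rewrite /GRing.scale/= mulNr mulrC mulNr -exprVn.
Qed.

Lemma is_derive1_powR_comp f s x a : 0 < f x -> is_derive x 1 f a ->
  is_derive x 1 (fun y => f y `^ s) (a * (s * f x `^ (s - 1))).
Proof.
move=> f0 fa; have := @is_derive1_chain (fun y => y `^ s) f x _ a _ fa.
by apply; exact: is_derive1_powR.
Qed.

Lemma derive1_of f f' : (forall x, is_derive x 1 f (f' x)) -> derive1 f = f'.
Proof. by move=> df; apply/funext => x; rewrite derive1E; exact: derive_val. Qed.

Lemma derivable_is_derive1 f x : derivable f x 1 -> is_derive x 1 f (derive1 f x).
Proof. by move=> df; rewrite derive1E; exact: derivableP. Qed.

Lemma is_derive1_unique f x a b : is_derive x 1 f a -> is_derive x 1 f b -> a = b.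
Proof. by move=> fa fb; rewrite -(@derive_val _ _ _ _ _ _ _ fa) derive_val. Qed.

Lemma is_derive1_continuous f x a : is_derive x 1 f a -> {for x, continuous f}.
Proof.
by move=> fa; apply/differentiable_continuous/derivable1_diffP; case: fa.
Qed.

Lemma is_derive1_near f g x a : (\forall y \near x, f y = g y) ->
  is_derive x 1 f a -> is_derive x 1 g a.
Proof.
move=> fg fa; apply: near_eq_is_derive fa => //; exact: oner_neq0.
Qed.

Lemma is_derive1P f x a : is_derive x 1 f a <->
  (fun h => h^-1 * (f (x + h) - f x)) @ 0^' --> a.
Proof.
split=> [fa|fa].
- have := @ex_derive _ _ _ _ _ _ _ fa; rewrite /derivable => /cvg_ex[l /= fl].
  have := fa; move=> [_]; rewrite /derive => <-.
  rewrite (cvg_lim _ fl)//.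
  apply: cvg_trans fl; apply: near_eq_cvg; near=> h.
  by rewrite /GRing.scale/= mulr1 [h + x]addrC.
- have H : (fun h => h^-1 *: ((f \o shift x) (h *: 1) - f x)) @ 0^' --> a.
    apply: cvg_trans fa; apply: near_eq_cvg; near=> h.
    by rewrite /GRing.scale/= mulr1 [h + x]addrC.
  by split; [apply/cvg_ex; exists a | rewrite /derive (cvg_lim _ H)].
Unshelve. all: by end_near. Qed.

Lemma is_derive1_MVT f f' a b : a < b ->
  (forall x, a <= x <= b -> is_derive x 1 f (f' x)) ->
  exists2 c, a < c < b & f b - f a = f' c * (b - a).
Proof.
move=> ab df; have [||c] := @MVT R f f' a b ab.
- by move=> x; rewrite in_itv/= => /andP[ax xb]; apply: df; rewrite !ltW.
- apply/continuous_within_itvP => //; split.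
  + by move=> x; rewrite in_itv/= => /andP[ax xb]; apply: is_derive1_continuous;
     apply: df; rewrite !ltW.
  + by apply: cvg_at_right_filter; apply: is_derive1_continuous;
     apply: df; rewrite lexx ltW.
  + by apply: cvg_at_left_filter; apply: is_derive1_continuous;
     apply: df; rewrite lexx ltW.
by rewrite in_itv/=; exists c.
Qed.

Lemma is_derive1_lipschitz f f' M a b :
  (forall x, Num.min a b <= x <= Num.max a b -> is_derive x 1 f (f' x)) ->
  (forall x, Num.min a b <= x <= Num.max a b -> `|f' x| <= M) ->
  `|f b - f a| <= M * `|b - a|.
Proof.
wlog ab : a b / a < b.
  move=> H df f'M; have [ab|ba|->] := ltgtP a b.
  - exact: H.
  - by rewrite distrC (distrC b); apply: H => // x; rewrite minC maxC;
      [exact: df|exact: f'M].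
  - by rewrite !subrr !normr0 mulr0.
rewrite (min_l (ltW ab)) (max_r (ltW ab)) => df f'M.
have [c /andP[ac cb] ->] := is_derive1_MVT ab df.
by rewrite normrM ler_wpM2r// f'M// !ltW.
Qed.

End derivatives.

(** * Functions all of whose derivatives lie in a given class *)

Section iterated_derivatives.
Context {R : realType}.
Implicit Types (f g : R -> R) (P Q : (R -> R) -> Prop).

(** [P] is imposed on every derivative up to order [n]: with continuity this is C^n, with
    [integrable_bounded] the scheme describes W^{oo,1}. Derivatives are existential so that each
    closure proof may supply its own formula for them. *)
Fixpoint diffn P n f : Prop :=
  P f /\ if n is m.+1 then
    exists2 g : R -> R, forall x : R, is_derive x 1 f (g x) & diffn P m g
  else True.

Definition smooth P f := forall n, diffn P n f.

Lemma diffn_base P n f : diffn P n f -> P f.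
Proof. by case: n => [|n] []. Qed.

Lemma smooth_base P f : smooth P f -> P f.
Proof. by move=> /(_ 0%N)[]. Qed.

Lemma diffnW P n f : diffn P n.+1 f -> diffn P n f.
Proof.
elim: n f => [|n IH] f [Pf [g fg gn]]; first by [].
by split => //; exists g => //; exact: IH.
Qed.

Lemma diffn_sub P Q n f : (forall f, P f -> Q f) -> diffn P n f -> diffn Q n f.
Proof.
move=> PQ; elim: n f => [|n IH] f /=; first by move=> [/PQ].
by move=> [/PQ Qf [g fg gn]]; split => //; exists g => //; exact: IH.
Qed.

Lemma smooth_is_derive P f (x : R) : smooth P f -> is_derive x 1 f (derive1 f x).
Proof.
by move=> /(_ 1%N)[_ [g fg _]]; apply: derivable_is_derive1; case: (fg x).
Qed.

Lemma smooth_derive1 P f : smooth P f -> smooth P (derive1 f).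
Proof. by move=> sf n; have [_ [g /derive1_of ->]] := sf n.+1. Qed.

Lemma smooth_derive1n P f n : smooth P f -> smooth P (derive1n n f).
Proof. by move=> sf; elim: n => //= n; exact: smooth_derive1. Qed.

(** A coinduction principle, applied with [Q] the class W^{oo,1} itself, which turns out to be
    closed under differentiation. *)
Lemma smooth_coind P Q f : Q f ->
  (forall g, Q g -> P g /\ exists2 h : R -> R, forall x : R, is_derive x 1 g (h x) & Q h) ->
  smooth P f.
Proof.
move=> Qf PQ n; elim: n f Qf => [|n IH] f /PQ[Pf [g fg Qg]]; first by split.
by split => //; exists g => //; exact: IH.
Qed.

Lemma diffnD P n f g : (forall f g, P f -> P g -> P (fun x => f x + g x)) ->
  diffn P n f -> diffn P n g -> diffn P n (fun x => f x + g x).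
Proof.
move=> PD; elim: n f g => [|n IH] f g /=; first by move=> [? _] [? _]; split=> //; exact: PD.
move=> [Pf [f' ff' nf']] [Pg [g' gg' ng']]; split; first exact: PD.
by exists (fun x => f' x + g' x); [move=> x; exact: is_derive1D | exact: IH].
Qed.

(** Two classes are kept apart because the main use is integrable times bounded; the product rule
    preserves this since [P] is stable under multiplication by [Q]. *)
Lemma diffnM P Q n f g : (forall f g, P f -> P g -> P (fun x => f x + g x)) ->
  (forall f g, P f -> Q g -> P (fun x => f x * g x)) ->
  diffn P n f -> diffn Q n g -> diffn P n (fun x => f x * g x).
Proof.
move=> PD PQ; elim: n f g => [|n IH] f g.
  by move=> [? _] [? _]; split=> //; exact: PQ.
move=> /[dup] /diffnW nf [Pf [f' ff' nf']] /[dup] /diffnW ng [Qg [g' gg' ng']].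
split; first exact: PQ.
exists (fun x => f' x * g x + f x * g' x); first by move=> x; exact: is_derive1M.
by apply: diffnD => //; exact: IH.
Qed.

Lemma smoothD P f g : (forall f g, P f -> P g -> P (fun x => f x + g x)) ->
  smooth P f -> smooth P g -> smooth P (fun x => f x + g x).
Proof. by move=> PD sf sg n; exact: diffnD. Qed.

Lemma smoothM P Q f g : (forall f g, P f -> P g -> P (fun x => f x + g x)) ->
  (forall f g, P f -> Q g -> P (fun x => f x * g x)) ->
  smooth P f -> smooth Q g -> smooth P (fun x => f x * g x).
Proof. by move=> PD PQ sf sg n; exact: (@diffnM P Q). Qed.

Lemma smooth_cst P c : (forall c, P (fun=> c)) -> smooth P (fun=> c).
Proof.
move=> Pc n; elim: n c => [|n IH] c; split=> //.
by exists (fun=> 0) => // x; exact: is_derive1_cst.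
Qed.

End iterated_derivatives.

(** * A smooth step function *)

Section smooth_step.
Context {R : realType}.
Implicit Types (f g : R -> R) (x y : R).
Local Notation Cont := (fun f : R -> R => continuous f).

Lemma continuous_addf f g : continuous f -> continuous g ->
  continuous (fun x => f x + g x).
Proof. by move=> cf cg x; apply: cvgD; [exact: cf | exact: cg]. Qed.

Lemma continuous_mulf f g : continuous f -> continuous g ->
  continuous (fun x => f x * g x).
Proof. by move=> cf cg x; apply: cvgM; [exact: cf | exact: cg]. Qed.

Lemma diffn_affine (P : (R -> R) -> Prop) n f (a b : R) :
  (forall f g, P f -> P g -> P (fun x => f x * g x)) ->
  (forall f g, P f -> P g -> P (fun x => f x + g x)) ->
  (forall c, P (fun=> c)) ->
  (forall f, P f -> P (fun x => f (a * x + b))) ->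
  diffn P n f -> diffn P n (fun x => f (a * x + b)).
Proof.
move=> PM PD Pc Pa; elim: n f => [|n IH] f; first by move=> [/Pa].
move=> [/Pa Pf [f' ff' nf']]; split=> //.
exists (fun x => a * f' (a * x + b)).
  move=> x; apply: (@is_derive1_chain _ f (fun y => a * y + b)).
  have /is_derive_eq := is_derive1D (is_derive1Zl a (is_derive1_id x)) (is_derive1_cst b x).
  by apply; rewrite mulr1 addr0.
by apply: (@diffnM _ P P) => //; [exact: smooth_cst|exact: IH].
Qed.

(** The classical flat function exp(-1/x), with powers of 1/x included so that the family is closed
    under differentiation up to linear combinations. *)
Definition flat (k : nat) (x : R) : R :=
  if 0 < x then x ^- k * expR (- x^-1) else 0.

Lemma flat_ge0 k x : 0 <= flat k x.
Proof.
by rewrite /flat; case: ifPn => // x0; rewrite mulr_ge0 ?expR_ge0 ?invr_ge0 ?exprn_ge0// ltW.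
Qed.

Lemma flat0_gt0 x : 0 < x -> 0 < flat 0 x.
Proof. by move=> x0; rewrite /flat x0 expr0 invr1 mul1r expR_gt0. Qed.

Lemma flatE0 k x : x <= 0 -> flat k x = 0.
Proof. by rewrite /flat leNgt => /negbTE ->. Qed.

(** With y = 1/x, the term of order k+1 of the exponential series gives y^(k+1) / (k+1)! <= exp y;
    one power more than needed for boundedness leaves the factor x. *)
Lemma flat_le k x : flat k x <= (k.+1)`!%:R * `|x|.
Proof.
have [x0|x0] := leP x 0; first by rewrite flatE0// mulr_ge0.
rewrite /flat x0 gtr0_norm// expRN -exprVn.
set y := x^-1; have y0 : 0 < y by rewrite invr_gt0.
have -> : x = y^-1 by rewrite invrK.
have := @expR_ge1Dxn _ y k (ltW y0) => h.
have {}h : y ^+ k.+1 / (k.+1)`!%:R <= expR y by apply: le_trans h; rewrite lerDr.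
rewrite ler_pdivrMr ?expR_gt0// mulrAC ler_pdivlMr// -exprSr.
by rewrite mulrC -ler_pdivrMr// ltr0n fact_gt0.
Qed.

Lemma is_derive1_flat k x :
  is_derive x 1 (flat k) (- k%:R * flat k.+1 x + flat k.+2 x).
Proof.
have [x0|x0|->] := ltgtP x 0.
- rewrite !flatE0 ?ltW// mulr0 addr0.
  apply: (@is_derive1_near _ (fun=> 0)).
  by near=> y; rewrite flatE0// ltW//; near: y; exact: lt_nbhsl.
- have xN0 : x != 0 by rewrite gt_eqF.
  apply: (@is_derive1_near _ (fun x => (x^-1) ^+ k * expR (- x^-1))).
    near=> y; rewrite /flat exprVn ifT//; near: y; exact: lt_nbhsr.
  have dinv : is_derive x (1:R) (fun y : R => y^-1) (- (x^-1) ^+ 2).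
    by apply: (is_derive_eq (is_derive1_inv xN0 (is_derive1_id x))); rewrite mulN1r exprVn.
  have dk : is_derive x (1:R) (fun y : R => y^-1 ^+ k) (- (x^-1) ^+ 2 *+ k * (x^-1) ^+ k.-1).
    have /is_derive_eq := is_deriveX k dinv; rewrite /=.
    have -> : (fun y : R => y^-1) ^+ k = (fun y : R => y^-1 ^+ k).
      by apply/funext => y; elim: (k) => [|m IH]; rewrite ?expr0// !exprS -IH.
    apply; rewrite /GRing.scale/= -mulr_natl; ring.
  have de : is_derive x (1:R) (fun y : R => expR (- y^-1)) ((x^-1) ^+ 2 * expR (- x^-1)).
    apply: (is_derive_eq (is_derive1_chain (is_derive_expR _) (is_derive1N dinv))).
    by rewrite opprK.
  apply: (is_derive_eq (is_derive1M dk de)).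
  rewrite /flat x0 -!exprVn.
  case: k {dk} => [|k] /=; rewrite ?mulr0n ?mulNr ?mul0r ?oppr0 ?add0r ?expr0 ?mul1r//.
  by rewrite -[_ *+ _]mulr_natl !exprS; ring.
- rewrite !flatE0// mulr0 addr0; apply/is_derive1P.
  apply/cvgrPdist_le => e e0; near=> h.
  rewrite sub0r normrN add0r (flatE0 k (lexx 0)) subr0.
  (* At 0 the difference quotient is the next member of the family, and [flat_le] sends it to 0. *)
  have -> : h^-1 * flat k h = flat k.+1 h.
    rewrite /flat; case: ifPn => h0; last by rewrite mulr0.
    by rewrite exprS invfM mulrA.
  rewrite ger0_norm ?flat_ge0// (le_trans (flat_le _ _))//.
  rewrite -ler_pdivlMl ?ltr0n ?fact_gt0//.
  near: h; apply: dnbhs0_le.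
  by rewrite mulr_gt0 ?invr_gt0 ?ltr0n ?fact_gt0.
Unshelve. all: by end_near. Qed.

Lemma smooth_flat k : smooth Cont (flat k).
Proof.
move=> n; elim: n k => [|n IH] k.
  by split=> // x; exact: is_derive1_continuous (is_derive1_flat k x).
split; first by move=> x; exact: is_derive1_continuous (is_derive1_flat k x).
exists (fun x => - k%:R * flat k.+1 x + flat k.+2 x); first exact: is_derive1_flat.
apply: diffnD => //; first exact: continuous_addf.
apply: (@diffnM _ Cont Cont) => //.
- exact: continuous_addf.
- exact: continuous_mulf.
- by apply: smooth_cst => c; exact: cst_continuous.
Qed.

Lemma smooth_inv f : (forall x, f x != 0) -> smooth Cont f ->
  smooth Cont (fun x => (f x)^-1).
Proof.
move=> f0 sf n; elim: n f f0 sf => [|n IH] f f0 sf.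
  split=> // x; apply: is_derive1_continuous.
  by apply: is_derive1_inv => //; exact: smooth_is_derive sf.
split.
  move=> x; apply: is_derive1_continuous.
  by apply: is_derive1_inv => //; exact: smooth_is_derive sf.
exists (fun x => -1 * derive1 f x * ((f x)^-1 * (f x)^-1)).
  move=> x; have := is_derive1_inv (f0 x) (smooth_is_derive x sf).
  by move/is_derive_eq; apply; rewrite mulN1r -exprVn.
have cM := @continuous_mulf; have cD := @continuous_addf.
apply: (@diffnM _ Cont Cont) => //.
- apply: (@diffnM _ Cont Cont) => //.
    by apply: smooth_cst => c; exact: cst_continuous.
  exact: smooth_derive1.
- by apply: (@diffnM _ Cont Cont) => //; exact: IH.
Qed.

(** The smooth transition from 0 on ]-oo, 0] to 1 on [1, +oo[; the denominator is positive because x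
    or 1 - x is. *)
Definition step (x : R) := flat 0 x * (flat 0 x + flat 0 (1 - x))^-1.

Lemma step_den_gt0 x : 0 < flat 0 x + flat 0 (1 - x).
Proof.
have [x0|x0] := ltP 0 x.
  by rewrite ltr_pwDl ?flat_ge0// flat0_gt0.
by rewrite flatE0// add0r flat0_gt0// subr_gt0 (le_lt_trans x0).
Qed.

Lemma smooth_step : smooth Cont step.
Proof.
have cM := @continuous_mulf; have cD := @continuous_addf.
have cC : forall c : R, continuous ((fun=> c) : R -> R) by move=> c; exact: cst_continuous.
apply: (@smoothM _ Cont Cont) => //; first exact: smooth_flat.
apply: smooth_inv; first by move=> x; rewrite gt_eqF ?step_den_gt0.
apply: smoothD => //; first exact: smooth_flat.
rewrite (_ : (fun x => flat 0 (1 - x)) = (fun x => flat 0 (-1 * x + 1))); last first.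
  by apply/funext => x; rewrite mulN1r addrC.
move=> n; apply: diffn_affine => //; last exact: smooth_flat.
move=> f cf x; apply: (@continuous_comp _ _ _ (fun x : R => -1 * x + 1) f); last exact: cf.
by apply: cD => //; apply: cM => //; move=> y; exact: cvg_id.
Qed.

Lemma step_ge0 x : 0 <= step x.
Proof. by rewrite divr_ge0 ?flat_ge0// addr_ge0 ?flat_ge0. Qed.

Lemma step_le1 x : step x <= 1.
Proof. by rewrite ler_pdivrMr ?step_den_gt0// mul1r lerDl flat_ge0. Qed.

Lemma step0 x : x <= 0 -> step x = 0.
Proof. by move=> x0; rewrite /step flatE0// mul0r. Qed.

Lemma step1 x : 1 <= x -> step x = 1.
Proof.
move=> x1; rewrite /step (@flatE0 0 (1 - x)) ?subr_le0// addr0 divff//.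
by rewrite gt_eqF// flat0_gt0// (lt_le_trans _ x1).
Qed.

Lemma derive1_step_eq0 x : (x < 0) || (1 < x) -> derive1 step x = 0.
Proof.
move=> x01; rewrite derive1E.
suff [] : is_derive x (1 : R) step 0 by [].
case/orP: x01 => x01.
- apply: (@is_derive1_near _ (fun=> 0)).
  by near=> y; rewrite step0// ltW//; near: y; exact: lt_nbhsl.
- apply: (@is_derive1_near _ (fun=> 1)).
  by near=> y; rewrite step1// ltW//; near: y; exact: lt_nbhsr.
Unshelve. all: by end_near. Qed.

Lemma derive1_step_bounded : exists2 M : R, 0 < M & forall x, `|derive1 step x| <= M.
Proof.
have cs' : continuous (derive1 step) := smooth_base (smooth_derive1 smooth_step).
have [] := @EVT_max R (fun x => `|derive1 step x|) 0 1 ler01.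
  by apply: continuous_subspaceT => x; apply: continuous_comp; [exact: cs'|exact: norm_continuous].
move=> c c01 cmax; exists (`|derive1 step c| + 1); first by rewrite ltr_wpDl.
move=> x; have [x0|x0] := ltP x 0; first by rewrite derive1_step_eq0 ?x0// normr0 addr_ge0.
have [x1|x1] := ltP 1 x; first by rewrite derive1_step_eq0 ?x1 ?orbT// normr0 addr_ge0.
by rewrite (le_trans (cmax x _)) ?lerDl// in_itv/= x0 x1.
Qed.

End smooth_step.

(** * Weak derivatives and the characterization of W^{oo,1} *)

Section integration_toolkit.
Context {R : realType}.
Implicit Types (f g : R -> R) (x y a b : R) (A : set R).
Notation mu := (@lebesgue_measure R).
Local Notation Integrable f := (mu.-integrable setT (EFin \o f)).




Lemma integrableT_M f g M : Integrable f -> measurable_fun setT g ->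
  (forall x, `|g x| <= M) -> Integrable (fun x => f x * g x).
Proof.
move=> fi mg gM; apply: (eq_integrable measurableT) (integrableMl measurableT fi mg _) => //.
exists M; split; first exact: num_real.
by move=> N MN x _ /=; rewrite (le_trans (gM x))// ltW.
Qed.

Lemma integrableT_D f g : Integrable f -> Integrable g ->
  Integrable (fun x => f x + g x).
Proof.
by move=> fi gi; apply: (eq_integrable measurableT) (integrableD measurableT fi gi).
Qed.

Lemma integrableT_B f g : Integrable f -> Integrable g ->
  Integrable (fun x => f x - g x).
Proof.
by move=> fi gi; apply: (eq_integrable measurableT) (integrableB measurableT fi gi).
Qed.

Lemma integrableT_Zl f c : Integrable f -> Integrable (fun x => c * f x).
Proof.
by move=> fi; apply: (eq_integrable measurableT) (integrableZl measurableT c fi).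
Qed.

Lemma integrableT_le f g : Integrable f -> measurable_fun setT g ->
  (forall x, `|g x| <= `|f x|) -> Integrable g.
Proof.
move=> fi mg gf; apply: le_integrable fi => //; first exact/measurable_EFinP.
by move=> x _ /=; rewrite lee_fin.
Qed.

Lemma integrableT_restrict f A : measurable A -> Integrable f ->
  mu.-integrable A (EFin \o f).
Proof. by move=> mA fi; apply: integrableS fi. Qed.

Lemma continuous_FTC2_R G g a b : (forall x, is_derive x (1:R) G (g x)) ->
  continuous g -> a <= b -> \int[mu]_(x in `[a, b]) g x = G b - G a.
Proof.
move=> dG cg; rewrite le_eqVlt => /predU1P[->|ab].
  by rewrite set_itv1 Rintegral_set1 subrr.
have cG : continuous G by move=> x; exact: is_derive1_continuous (dG x).
rewrite /Rintegral (@continuous_FTC2 _ g G)//.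
- exact: continuous_subspaceT.
- split.
  + by move=> x _; case: (dG x).
  + exact/cvg_at_right_filter/cG.
  + exact/cvg_at_left_filter/cG.
- by move=> x _; rewrite (derive1_of dG).
Qed.

Lemma Rintegral_supp f a b : (forall x, x < a \/ b < x -> f x = 0) ->
  \int[mu]_(x in setT) f x = \int[mu]_(x in `[a, b]) f x.
Proof.
move=> f0; rewrite [RHS]Rintegral_mkcond; congr Rintegral; apply/funext => x.
rewrite patchE; case: ifPn => //; rewrite notin_setE/= in_itv/= => /negP.
by rewrite negb_and -!ltNge => /orP[xa|bx]; rewrite f0//; [left|right].
Qed.

Lemma integrableT_supp f a b : continuous f ->
  (forall x, x < a \/ b < x -> f x = 0) -> Integrable f.
Proof.
move=> cf f0; have : mu.-integrable `[a, b] (EFin \o f).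
  apply: continuous_compact_integrable; first exact: segment_compact.
  exact: continuous_subspaceT.
move=> /(@integrable_mkcond _ _ _ mu _ (EFin \o f) (measurable_itv `[a, b])).
apply: eq_integrable => // x _; rewrite patchE /=.
case: ifPn => //; rewrite notin_setE/= in_itv/= => /negP.
by rewrite negb_and -!ltNge => /orP[xa|bx]; rewrite f0//; [left|right].
Qed.

Lemma le_normr_RintegralT f : Integrable f ->
  `|\int[mu]_(x in setT) f x| <= \int[mu]_(x in setT) `|f x|.
Proof. by move=> fi; exact: le_normr_Rintegral. Qed.

Lemma integrableT_norm f : Integrable f -> Integrable (fun x => `|f x|).
Proof. by move=> fi; exact: (integrable_norm fi). Qed.

End integration_toolkit.

(** * Mollification at Lebesgue points *)

Section du_bois_reymond.
Context {R : realType}.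
Implicit Types (f g h : R -> R) (x y z a b r : R) (A : set R).
Notation mu := (@lebesgue_measure R).
Local Notation Cont := (fun f : R -> R => continuous f).
Local Notation Integrable f := (mu.-integrable setT (EFin \o f)).

Lemma derivable_derive1n_smooth (P : (R -> R) -> Prop) f n x :
  smooth P f -> derivable (derive1n n f) x 1.
Proof. by move=> /(smooth_derive1n n)/(smooth_is_derive x)[]. Qed.

(** A smooth step climbing from 0 at [a] to 1 at [a + r]; its derivative [mol] is a one-sided
    approximate identity at [a]. The argument is written in the affine form that [diffn_affine]
    expects. *)
Definition molstep r a z : R := step (r^-1 * z + - (a / r)).
Definition mol r a z : R := r^-1 * derive1 step (r^-1 * z + - (a / r)).

Lemma smooth_molstep r a : smooth Cont (molstep r a).
Proof.
move=> n; apply: diffn_affine => //; last exact: smooth_step.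
- exact: continuous_mulf.
- exact: continuous_addf.
- by move=> c; exact: cst_continuous.
- move=> f cf x; apply: (@continuous_comp _ _ _ (fun x : R => r^-1 * x + - (a / r)) f); last exact: cf.
  apply: continuous_addf; last by move=> ?; exact: cst_continuous.
  by apply: continuous_mulf; [move=> ?; exact: cst_continuous|move=> ?; exact: cvg_id].
Qed.

Lemma is_derive_molstep r a z : is_derive z 1 (molstep r a) (mol r a z).
Proof.
apply: (@is_derive1_chain _ step (fun z => r^-1 * z + - (a / r))).
  exact: smooth_is_derive smooth_step.
have /is_derive_eq := is_derive1D (is_derive1Zl r^-1 (is_derive1_id z)) (is_derive1_cst (- (a / r)) z).
by apply; rewrite mulr1 addr0.
Qed.

Lemma molargE r a z : r^-1 * z + - (a / r) = (z - a) / r.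
Proof. by ring. Qed.

Lemma molstep0 r a z : 0 < r -> z <= a -> molstep r a z = 0.
Proof. by move=> r0 za; rewrite /molstep molargE step0// pmulr_lle0 ?invr_gt0// subr_le0. Qed.

Lemma molstep1 r a z : 0 < r -> a + r <= z -> molstep r a z = 1.
Proof. by move=> r0 za; rewrite /molstep molargE step1// ler_pdivlMr// mul1r lerBrDl. Qed.

Lemma molstep01 r a z : 0 <= molstep r a z <= 1.
Proof. by rewrite step_ge0 step_le1. Qed.

Lemma mol_eq0 r a z : 0 < r -> (z < a) \/ (a + r < z) -> mol r a z = 0.
Proof.
move=> r0 zar; rewrite /mol molargE derive1_step_eq0 ?mulr0//.
rewrite ltr_pdivrMr// mul0r subr_lt0 ltr_pdivlMr// mul1r ltrBrDl.
by case: zar => ->; rewrite ?orbT.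
Qed.

Lemma continuous_mol r a : continuous (mol r a).
Proof.
rewrite -(derive1_of (is_derive_molstep r a)).
exact: smooth_base (smooth_derive1 (smooth_molstep r a)).
Qed.

Lemma integrable_mol r a : 0 < r -> Integrable (mol r a).
Proof.
move=> r0; apply: (@integrableT_supp _ _ a (a + r)); first exact: continuous_mol.
by move=> x; exact: mol_eq0.
Qed.

Lemma Rintegral_mol r a : 0 < r -> \int[mu]_(z in setT) mol r a z = 1.
Proof.
move=> r0; rewrite (@Rintegral_supp _ _ a (a + r)); last by move=> x; exact: mol_eq0.
rewrite (continuous_FTC2_R (is_derive_molstep r a)) ?lerDl ?ltW//.
  by rewrite molstep1 ?molstep0 ?subr0.
exact: continuous_mol.
Qed.

Lemma mol_bounded : exists2 M : R, 0 < M & forall r a z, 0 < r -> `|mol r a z| <= M / r.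
Proof.
have [M M0 HM] := @derive1_step_bounded R; exists M => // r a z r0.
by rewrite normrM ger0_norm ?invr_ge0 ?(ltW r0)// [leRHS]mulrC ler_pM2l ?invr_gt0.
Qed.

Lemma integrable_M_mol h r a : 0 < r -> Integrable h -> Integrable (fun z => h z * mol r a z).
Proof.
move=> r0 hi; have [M _ HM] := mol_bounded; apply: (@integrableT_M _ _ _ (M / r)) => //.
  by apply: continuous_measurable_fun; exact: continuous_mol.
by move=> x; exact: HM.
Qed.

(** Since [mol r a] has mass 1, is bounded by M / r and vanishes off the ball of radius 2r, the
    error is at most (M / r) times the integral of |h - h a| over a ball of measure 4r, that is 4M
    times the average that tends to 0 at a Lebesgue point. Radius 2r rather than r keeps the
    endpoint a + r inside the open ball. *)
Lemma mol_lebesgue_pt h a : Integrable h -> lebesgue_pt h a ->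
  (\int[mu]_(z in setT) (h z * mol r a z)) @[r --> 0^'+] --> h a.
Proof.
move=> hi ha; have [M M0 HM] := mol_bounded.
have mh : measurable_fun setT h by move/integrableP : hi => [/measurable_EFinP].
have key r : 0 < r ->
    (`|\int[mu]_(z in setT) (h z * mol r a z) - h a|%:E <= (4 * M)%:E * davg h a (2 * r))%E.
  move=> r0; have r20 : 0 < 2 * r by rewrite mulr_gt0.
  have mb : measurable (ball a (2 * r) : set (measurableTypeR R)) by exact: measurable_ball.
  have hai : mu.-integrable (ball a (2 * r)) (EFin \o (fun z => h z - h a)).
    have hb := integrableT_restrict mb hi.
    have hc : mu.-integrable (ball a (2 * r)) (EFin \o cst (h a)).
      apply: measurable_bounded_integrable => //.
        by apply: le_lt_trans (ltry (2 * r *+ 2)); rewrite -(lebesgue_measure_ball a (ltW r20)).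
      by exists `|h a|; split; [exact: num_real|move=> N hN x _ /=; exact: ltW].
    by apply: (eq_integrable mb) (integrableB mb hb hc).
  have -> : \int[mu]_(z in setT) (h z * mol r a z) - h a =
            \int[mu]_(z in setT) ((h z - h a) * mol r a z).
    rewrite -[X in _ - X]mulr1 -(Rintegral_mol a r0) -RintegralZl//; last exact: integrable_mol.
    rewrite -RintegralB//.
    - by apply: eq_Rintegral => z _; rewrite mulrBl.
    - exact: integrable_M_mol.
    - exact/integrableT_Zl/integrable_mol.
  have i1 : Integrable (fun z => (h z - h a) * mol r a z).
    have := integrableT_B (integrable_M_mol a r0 hi) (integrableT_Zl (h a) (integrable_mol a r0)).
    by apply: (eq_integrable measurableT) => z _ /=; rewrite mulrBl.
  apply: (@le_trans _ _ (\int[mu]_(z in ball a (2 * r)) (M / r * `|h z - h a|))%:E).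
    rewrite lee_fin (le_trans (le_normr_RintegralT i1))//.
    rewrite [leRHS]Rintegral_mkcond; apply: le_Rintegral => //.
    - exact: integrableT_norm.
    - rewrite -restrict_EFin; apply/(integrable_mkcond _ mb).1.
      have := integrableZl mb (M / r) (integrable_norm hai).
      exact: (eq_integrable mb).
    - move=> z _; rewrite patchE; case: ifPn => [_|].
        by rewrite normrM mulrC ler_wpM2r// HM.
      rewrite notin_setE/= => /negP; rewrite -leNgt => zb.
      suff -> : mol r a z = 0 by rewrite mulr0 normr0.
      apply: mol_eq0 => //; have := zb; rewrite ler_normr => /orP[zb'|zb'].
        by left; lra.
      by right; lra.
  rewrite RintegralZl//; last exact: integrable_norm.
  rewrite /davg /iavg lebesgue_measure_ball ?(ltW r20)//.
  have -> : (\int[mu]_(y in ball a (2 * r)) `|((center (h a) \o h) y)%:E|)%E =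
            (\int[mu]_(y in ball a (2 * r)) `|h y - h a|)%:E.
    have fin : (\int[mu]_(y in ball a (2 * r)) `|h y - h a|%:E)%E \is a fin_num.
      apply: integrable_fin_num => //; exact: (integrable_norm hai).
    by rewrite /Rintegral fineK//; apply: eq_integral => y _.
  rewrite inver mulrn_eq0/= gt_eqF// -?EFinM lee_fin.
  rewrite le_eqVlt; apply/orP; left; apply/eqP.
  by rewrite mulrA; congr (_ * _); field; rewrite gt_eqF.
apply/cvgrPdist_le => e e0.
have := ha; rewrite /lebesgue_pt => /fine_cvgP[dfin /cvgrPdist_lt/(_ (e / (4 * M)))].
have e4 : 0 < e / (4 * M) by rewrite divr_gt0// mulr_gt0.
move=> /(_ e4) dcvg.
have {}ha : \forall r \near 0^'+, (davg h a r < (e / (4 * M))%:E)%E.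
  near=> r; have fr : davg h a r \is a fin_num by near: r.
  rewrite -(fineK fr) lte_fin (le_lt_trans (ler_norm _))//.
  by rewrite -normrN -[- _]add0r; near: r.
have [d /= d0 dd] := ha; exists (d / 2) => /=; first by rewrite divr_gt0.
move=> r /=; rewrite sub0r normrN => rd r0.
rewrite distrC -lee_fin (le_trans (key r r0))//.
have : (davg h a (2 * r) < (e / (4 * M))%:E)%E.
  apply: dd; last by rewrite mulr_gt0.
  by rewrite /= sub0r normrN normrM (gtr0_norm (ltr0Sn _ 1)) mulrC -ltr_pdivlMr.
move=> /ltW/(@lee_wpmul2l _ (4 * M)%:E _ _ _)/le_trans; apply.
  by rewrite lee_fin mulr_ge0// ltW.
by rewrite -EFinM lee_fin mulrC divfK// gt_eqF// mulr_gt0.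
Unshelve. all: by end_near. Qed.

End du_bois_reymond.

(** * Weak derivatives and integrals from minus infinity *)

Section sobolev.
Context {R : realType}.
Implicit Types (f g h : R -> R) (x y z a b r : R) (A : set R).
Notation mu := (@lebesgue_measure R).
Local Notation Cont := (fun f : R -> R => continuous f).
Local Notation Integrable f := (mu.-integrable setT (EFin \o f)).

(** One step is not compactly supported; in the difference the two values 1 cancel far to the
    right. *)
Lemma test_function_molstep r a b : 0 < r ->
  test_function (fun z => molstep r a z - molstep r b z).
Proof.
move=> r0; split.
  move=> n x; apply: (@derivable_derive1n_smooth _ Cont).
  rewrite (_ : (fun z => _) = (fun z => molstep r a z + (-1) * molstep r b z)); last first.
    by apply/funext => z; rewrite mulN1r.
  apply: smoothD; [exact: continuous_addf|exact: smooth_molstep|].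
  apply: (@smoothM _ Cont Cont); [exact: continuous_addf|exact: continuous_mulf| |exact: smooth_molstep].
  by apply: smooth_cst => c; exact: cst_continuous.
exists (`|a| + `|b| + r) => x; rewrite lter_normr => /orP[xr|xr].
  rewrite !molstep1 ?subrr//.
    by have := ler_norm b; have := normr_ge0 a; lra.
  by have := ler_norm a; have := normr_ge0 b; lra.
rewrite !molstep0 ?subrr//.
  have := ler_norm (- b); rewrite normrN; have := normr_ge0 a; lra.
have := ler_norm (- a); rewrite normrN; have := normr_ge0 b; lra.
Qed.

Lemma cvg_invS_right0 : (fun n : nat => n.+1%:R^-1 : R) @ \oo --> (0 : R)^'+.
Proof.
move=> P [d /= d0 dP].
suff : \forall n \near \oo, P (n.+1%:R^-1) by [].
near=> n; apply: dP => /=; last by rewrite invr_gt0 ltr0n.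
rewrite sub0r normrN gtr0_norm ?invr_gt0 ?ltr0n//.
by near: n; exact: near_infty_natSinv_lt (PosNum d0).
Unshelve. all: by end_near. Qed.

Lemma molstep_cvg a z :
  molstep n.+1%:R^-1 a z @[n --> \oo] --> (if a < z then 1 else 0 : R).
Proof.
case: ifPn => [az|]; last first.
  rewrite -leNgt => za; apply: cvg_near_cst; apply: nearW => n.
  by rewrite /= molstep0 ?invr_gt0 ?ltr0n.
apply: cvg_near_cst; near=> n; rewrite molstep1 ?invr_gt0 ?ltr0n//.
rewrite -lerBrDl ltW//; near: n.
have az0 : 0 < z - a by rewrite subr_gt0.
exact: near_infty_natSinv_lt (PosNum az0).
Unshelve. all: by end_near. Qed.

Lemma Rintegral_molstep_cvg g a b : a < b -> Integrable g ->
  (\int[mu]_(z in setT) (g z * (molstep n.+1%:R^-1 a z - molstep n.+1%:R^-1 b z)))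
    @[n --> \oo] --> \int[mu]_(z in `[a, b]) g z.
Proof.
move=> ab gi; have mg : measurable_fun setT g by move/integrableP : gi => [/measurable_EFinP].
have cm (r c : R) : continuous (molstep r c) by exact: smooth_base (smooth_molstep r c).
have cB n : continuous (fun z => molstep n.+1%:R^-1 a z - molstep n.+1%:R^-1 b z).
  by move=> z; apply: cvgB; exact: cm.
have bB n z : `|molstep n.+1%:R^-1 a z - molstep n.+1%:R^-1 b z| <= 1.
  have := molstep01 n.+1%:R^-1 a z; have := molstep01 n.+1%:R^-1 b z.
  by rewrite ler_norml; lra.
(* The pointwise limit of the test functions is the indicator of ]a, b], open at [a] because a step
   started at [a] vanishes there. *)
have -> : \int[mu]_(z in `[a, b]) g z = \int[mu]_(z in `]a, b]) g z.
  rewrite -(@Rintegral_itv_obnd_cbnd _ a (BRight b))//.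
  by apply: integrableS gi.
rewrite Rintegral_mkcond.
have int_n n : Integrable (fun z => g z * (molstep n.+1%:R^-1 a z - molstep n.+1%:R^-1 b z)).
  by apply: (integrableT_M gi _ (bB n)); exact: continuous_measurable_fun.
have int_l : Integrable (g \_ `]a, b]).
  have mI : measurable (`]a, b]%classic : set (measurableTypeR R)) by exact: measurable_itv.
  rewrite -restrict_EFin; apply/(integrable_mkcond _ mI).1.
  by apply: integrableS gi.
suff : (\int[mu]_(z in setT) (g z * (molstep n.+1%:R^-1 a z - molstep n.+1%:R^-1 b z))%:E)%E
    @[n --> \oo] --> (\int[mu]_(z in setT) ((g \_ `]a, b]) z)%:E)%E.
  have fl := integrable_fin_num measurableT int_l.
  by rewrite -[X in _ --> X](fineK fl) => /fine_cvgP[_].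
apply: (@dominated_cvg _ _ _ mu setT measurableT _ _ (EFin \o (fun z => `|g z|))) => //.
- by move=> n; exact: measurable_int (int_n n).
- move=> z _; apply: cvg_EFin; first by apply: nearW.
  have -> : (g \_ `]a, b]) z = g z * ((if a < z then 1 else 0) - (if b < z then 1 else 0)).
    rewrite patchE mem_setE in_itv/=; have [az|za] := ltP a z; have [bz|zb] := ltP b z.
    + by rewrite subrr mulr0.
    + by rewrite subr0 mulr1.
    + by have := lt_trans ab bz; rewrite ltNge za.
    + by rewrite subr0 mulr0.
  by apply: cvgM; [exact: cvg_cst|apply: cvgB; exact: molstep_cvg].
- exact: (integrable_norm gi).
- move=> n z _ /=; rewrite lee_fin normrM -[leRHS]mulr1.
  by rewrite ler_wpM2l.
Qed.

Lemma weak_derivative_FTC h g a b : Integrable h -> Integrable g ->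
  weak_derivative 1 h g -> lebesgue_pt h a -> lebesgue_pt h b -> a < b ->
  \int[mu]_(z in `[a, b]) g z = h b - h a.
Proof.
move=> hi gi hg ha hb ab.
have r0 (n : nat) : 0 < n.+1%:R^-1 :> R by rewrite invr_gt0 ltr0n.
have lim1 : (\int[mu]_(z in setT) (h z * mol n.+1%:R^-1 b z) -
    \int[mu]_(z in setT) (h z * mol n.+1%:R^-1 a z)) @[n --> \oo] --> h b - h a.
  apply: cvgB.
  - exact: cvg_comp cvg_invS_right0 (mol_lebesgue_pt hi hb).
  - exact: cvg_comp cvg_invS_right0 (mol_lebesgue_pt hi ha).
have := Rintegral_molstep_cvg ab gi.
move/cvg_unique; apply => //.
apply: cvg_trans lim1; apply: near_eq_cvg; apply: nearW => n /=.
have := hg _ (test_function_molstep a b (r0 n)); rewrite expr1 mulN1r /derive1n/=.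
have -> : derive1 (fun z => molstep n.+1%:R^-1 a z - molstep n.+1%:R^-1 b z) =
   (fun z => mol n.+1%:R^-1 a z - mol n.+1%:R^-1 b z).
  by apply: derive1_of => z; apply: is_derive1B; exact: is_derive_molstep.
move/(congr1 (@GRing.opp R)); rewrite opprK => <-.
under [in RHS]eq_Rintegral do rewrite /= mulrBr.
by rewrite RintegralB// ?opprB//; exact: integrable_M_mol.
Qed.

Lemma continuous_lebesgue_ptT f x : continuous f -> lebesgue_pt f x.
Proof.
move=> cf; apply: (@continuous_lebesgue_pt _ f x setT) => //.
- by split; [exact: openT|].
- exact: continuous_measurable_fun.
- exact: cf.
Qed.

Lemma integrable_lebesgue_pt f : Integrable f -> {ae mu, forall x, lebesgue_pt f x}.
Proof. by move=> fi; apply: lebesgue_differentiation; exact: open_integrable_locally openT fi. Qed.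

(** Integration from -oo selects the antiderivative with limit 0 there, the normalization built into
    [g_minfty] and [Diff_minfty]. *)
Definition prim f x : R := \int[mu]_(y in `]-oo, x]) f y.

Lemma is_derive_prim f x : Integrable f -> {for x, continuous f} ->
  is_derive x 1 (prim f) (f x).
Proof.
move=> fi cf; have xx1 : x < x + 1 by rewrite ltrDl.
have fI : mu.-integrable [set` Interval -oo%O (BRight (x + 1))] (EFin \o f).
  by apply: integrableS fi.
have Nyx : ((-oo)%O < BRight x)%E by exact: ltNyr.
have [dF dFE] := continuous_FTC1 xx1 fI Nyx cf.
by split; [exact: dF|rewrite -derive1E; exact: dFE].
Qed.

Lemma Rintegral_set_cvg f (A_ : nat -> set (measurableTypeR R)) (A : set (measurableTypeR R)) :
  Integrable f -> (forall n, measurable (A_ n)) -> measurable A ->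
  (forall z, \forall n \near \oo, (z \in A_ n) = (z \in A)) ->
  (\int[mu]_(z in A_ n) f z) @[n --> \oo] --> \int[mu]_(z in A) f z.
Proof.
move=> fi mA_ mA AA.
under eq_cvg do rewrite Rintegral_mkcond; rewrite Rintegral_mkcond.
have int_A (B : set (measurableTypeR R)) : measurable B -> Integrable (f \_ B).
  move=> mB; rewrite -restrict_EFin; apply/(integrable_mkcond _ mB).1.
  by apply: integrableS fi.
suff : (\int[mu]_(z in setT) ((f \_ (A_ n)) z)%:E)%E
    @[n --> \oo] --> (\int[mu]_(z in setT) ((f \_ A) z)%:E)%E.
  have fl := integrable_fin_num measurableT (int_A _ mA).
  by rewrite -[X in _ --> X](fineK fl) => /fine_cvgP[_].
apply: (@dominated_cvg _ _ _ mu setT measurableT _ _ (EFin \o (fun z => `|f z|))) => //.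
- by move=> n; exact: measurable_int (int_A _ (mA_ n)).
- move=> z _; apply: cvg_near_cst; near=> n.
  by rewrite !patchE; have -> : (z \in A_ n) = (z \in A) by near: n.
- exact: (integrable_norm fi).
- move=> n z _ /=; rewrite lee_fin patchE; case: ifP => // _.
  by rewrite normr0.
Unshelve. all: by end_near. Qed.

Lemma prim_cvgNy f : Integrable f -> prim f x @[x --> -oo] --> (0 : R).
Proof.
move=> fi; apply/cvg_ninftyP => u uNy; rewrite -(Rintegral_set0 mu f).
apply: Rintegral_set_cvg => // z.
near=> n; rewrite in_set0; apply/negbTE; rewrite notin_setE/= in_itv/=; apply/negP; rewrite -ltNge.
by near: n; move/cvgrNyPlt : uNy; exact.
Unshelve. all: by end_near. Qed.

Lemma prim_cvgy f : Integrable f ->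
  prim f x @[x --> +oo] --> (\int[mu]_(x in setT) f x).
Proof.
move=> fi; apply/cvg_pinftyP => u uy.
apply: Rintegral_set_cvg => // z.
near=> n; rewrite in_setT mem_setE in_itv/=.
by near: n; move/cvgryPge : uy; exact.
Unshelve. all: by end_near. Qed.

Lemma prim_bounded f x : Integrable f -> `|prim f x| <= \int[mu]_(y in setT) `|f y|.
Proof.
move=> fi; have mI : measurable (`]-oo, x]%classic : set (measurableTypeR R)) by exact: measurable_itv.
have fI : mu.-integrable `]-oo, x] (EFin \o f) by apply: integrableS fi.
rewrite (le_trans (le_normr_Rintegral _ _))// Rintegral_mkcond; apply: le_Rintegral => //.
- rewrite -restrict_EFin; apply/(integrable_mkcond _ mI).1; exact: (integrable_norm fI).
- exact: integrableT_norm.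
- by move=> y _; rewrite patchE; case: ifPn => _; [exact: lexx|exact: (normr_ge0 (f y))].
Qed.

Lemma primB f a b : Integrable f -> a <= b ->
  prim f b - prim f a = \int[mu]_(y in `[a, b]) f y.
Proof.
move=> fi ab; rewrite /prim Rintegral_itvB ?bnd_simp//.
  by rewrite Rintegral_itv_obnd_cbnd//; apply: integrableS fi.
by apply: integrableS fi.
Qed.

(** [f] is merely integrable: this is applied to a second weak derivative, about which nothing more
    is known at that point. *)
Lemma prim_continuous f : Integrable f -> continuous (prim f).
Proof.
move=> fi x.
have x11 : x - 1 <= x + 1 by lra.
have fI : mu.-integrable `[x - 1, x + 1] (EFin \o f) by apply: integrableS fi.
have /continuous_within_itvP := parameterized_integral_continuous x11 fI.
have x11' : x - 1 < x + 1 by lra.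
move=> /(_ x11')[/(_ x) cx _ _].
have {}cx : (prim f (x - 1) + parameterized_integral mu (x - 1) y f) @[y --> x] -->
    (prim f (x - 1) + parameterized_integral mu (x - 1) x f).
  by apply: cvgD; [exact: cvg_cst|apply: cx; rewrite in_itv/=; lra].
have E y : x - 1 <= y -> prim f (x - 1) + parameterized_integral mu (x - 1) y f = prim f y.
  by move=> xy; rewrite /parameterized_integral -primB//; ring.
rewrite E in cx; last by lra.
apply: cvg_trans cx; apply: near_eq_cvg; near=> y; rewrite E//.
by rewrite ltW//; near: y; apply: lt_nbhsr; lra.
Unshelve. all: by end_near. Qed.

End sobolev.

(** * Elements of W^{oo,1} are the smooth functions with integrable bounded derivatives *)

Section sobolev_smooth.
Context {R : realType}.
Implicit Types (f g h k : R -> R) (x y z a b r : R).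
Notation mu := (@lebesgue_measure R).
Local Notation Integrable f := (mu.-integrable setT (EFin \o f)).

Lemma integrable_measurable f : Integrable f -> measurable_fun setT f.
Proof. by move/integrableP => [/measurable_EFinP]. Qed.

Lemma derive1_eq0_supp f (M : R) : (forall x, M < `|x| -> f x = 0) ->
  forall x, M < `|x| -> derive1 f x = 0.
Proof.
move=> f0 x Mx; rewrite derive1E.
suff [] : is_derive x (1 : R) f 0 by [].
apply: (@is_derive1_near _ (fun=> 0)).
near=> y; rewrite f0//.
have xy : `|x - y| < `|x| - M.
  near: y; apply: (@cvgr_dist_lt _ _ _ _ _ id x) => //; by rewrite subr_gt0.
have := lerB_dist x (x - y); rewrite subKr; lra.
Unshelve. all: by end_near. Qed.

Lemma test_function_derive1 psi :
  test_function psi -> test_function (derive1 psi : R -> R).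
Proof.
move=> [dpsi [M psi0]]; split; first by move=> n x; rewrite -derive1Sn.
by exists M; exact: derive1_eq0_supp.
Qed.

Lemma test_function_derive1n psi n :
  test_function psi -> test_function (derive1n n psi : R -> R).
Proof. by move=> tpsi; elim: n => //= n; exact: test_function_derive1. Qed.

Lemma test_function_continuous psi : test_function psi -> continuous (psi : R -> R).
Proof.
by move=> [/(_ 0%N) d _] x; apply: is_derive1_continuous (derivable_is_derive1 (d x)).
Qed.

Lemma Rintegral_derive_supp G g (M : R) : (forall x, is_derive x (1 : R) G (g x)) ->
  continuous g -> (forall x, M < `|x| -> G x = 0) -> \int[mu]_(x in setT) g x = 0.
Proof.
move=> dG cg G0; have g0 := derive1_eq0_supp G0; rewrite (derive1_of dG) in g0.
pose N := `|M| + 1.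
have N0 : 0 < N by rewrite ltr_wpDl.
have MN : M < N by rewrite (le_lt_trans (ler_norm _))// ltrDl.
rewrite (@Rintegral_supp _ _ (- N) N).
  rewrite (continuous_FTC2_R dG)//; last by lra.
  by rewrite !G0 ?subrr ?normrN// (gtr0_norm N0).
by move=> x xN; apply: g0; rewrite lter_normr; apply/orP; case: xN => ?; [right|left]; lra.
Qed.

Lemma ae_exists (P : R -> Prop) : {ae mu, forall x, P x} -> exists x, P x.
Proof.
move=> [B [mB B0 PB]]; apply: contrapT => /forallNP nP.
have : B = setT by apply/seteqP; split => // x _; apply: PB; exact: nP.
move=> BT; move: B0; rewrite BT => h.
have := @lebesgue_measure_itv R `[0, 1]; rewrite /= lte_fin ltr01 => h1.
have : (mu `[0%R, 1%R]%classic <= mu setT)%E by apply: le_measure; rewrite ?inE.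
by rewrite h h1 -EFinB subr0 lee_fin ler10.
Qed.

Lemma ae_integrable f g : Integrable f -> measurable_fun setT g ->
  {ae mu, forall x, f x = g x} -> Integrable g.
Proof.
move=> fi mg fg; apply/integrableP; split; first exact/measurable_EFinP.
have mf := integrable_measurable fi.
move/integrableP : fi => [_]; congr (_ < _)%E; apply: ae_eq_integral => //.
- by apply: measurableT_comp => //; exact/measurable_EFinP.
- by apply: measurableT_comp => //; exact/measurable_EFinP.
- by apply: (@filterS _ _ (ae_filter_ringOfSetsType mu) _ _ _ fg) => x /= -> _.
Qed.

Lemma ae_eq_Rintegral f g (D : set (measurableTypeR R)) : measurable D ->
  measurable_fun setT f -> measurable_fun setT g ->
  {ae mu, forall x, f x = g x} -> \int[mu]_(x in D) f x = \int[mu]_(x in D) g x.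
Proof.
move=> mD mf mg fg; congr fine; apply: ae_eq_integral => //.
- by apply/measurable_EFinP; exact: measurable_funS mf.
- by apply/measurable_EFinP; exact: measurable_funS mg.
- by apply: (@filterS _ _ (ae_filter_ringOfSetsType mu) _ _ _ fg) => x /= -> _.
Qed.

(** Used to exclude nonzero limits at both ends: |f| >= e on an interval of length n costs e n,
    which exceeds the integral of |f| once n is large. *)
Lemma integrable_not_large f (e : R) : Integrable f -> 0 < e ->
  ~ (forall n : nat, exists a, forall x, a <= x <= a + n%:R -> e <= `|f x|).
Proof.
move=> fi e0 H; set I := \int[mu]_(x in setT) `|f x|.
have [n nI] : exists n : nat, I / e < n%:R.
  exists (Num.truncn (I / e)).+1; exact: truncnS_gt.
have [a Ha] := H n.
have mI : measurable (`[a, a + n%:R]%classic : set (measurableTypeR R)) by exact: measurable_itv.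
have fI : mu.-integrable `[a, a + n%:R] (EFin \o (fun x => `|f x|)).
  by apply: integrableS (integrableT_norm fi).
have : e * n%:R <= I.
  apply: (@le_trans _ _ (\int[mu]_(x in `[a, a + n%:R]) `|f x|)); last first.
    rewrite Rintegral_mkcond; apply: le_Rintegral => //.
    - by rewrite -restrict_EFin; exact/(integrable_mkcond _ mI).1.
    - exact: integrableT_norm.
    - by move=> y _; rewrite patchE; case: ifPn => _; [exact: lexx|exact: (normr_ge0 (f y))].
  have hm : lebesgue_measure `[a, a + n%:R]%classic = (n%:R : R)%:E.
    rewrite lebesgue_measure_itv/= lte_fin ltrDl.
    by case: ifPn => [_|]; [rewrite -EFinB; congr EFin; ring
      |rewrite lt_neqAle ler0n andbT negbK => /eqP <-].
  have <- : \int[mu]_(x in `[a, a + n%:R]) e = e * n%:R.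
    by rewrite (Rintegral_cst mu mI e) [X in fine X]hm.
  apply: le_Rintegral => //.
    apply: measurable_bounded_integrable => //.
      by apply: le_lt_trans (ltry (n%:R : R)); rewrite -hm.
    by exists `|e|; split; [exact: num_real|move=> N hN x _ /=; exact: ltW].
by rewrite mulrC -ler_pdivlMr// leNgt nI.
Qed.

Lemma integrable_cvgNy0 f (c : R) : Integrable f -> f x @[x --> -oo] --> c -> c = 0.
Proof.
move=> fi /cvgrPdist_lt fc; apply/eqP; apply: contrapT => /negP c0.
have c20 : 0 < `|c| / 2 by rewrite divr_gt0// normr_gt0.
have [A [_ HA]] := fc _ c20.
apply: (integrable_not_large fi c20) => n; exists (A - 1 - n%:R) => x /andP[_ xA].
have /HA /= : x < A by lra.
by have := lerB_dist c (c - f x); rewrite subKr; lra.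
Qed.

Lemma integrable_cvgy0 f (c : R) : Integrable f -> f x @[x --> +oo] --> c -> c = 0.
Proof.
move=> fi /cvgrPdist_lt fc; apply/eqP; apply: contrapT => /negP c0.
have c20 : 0 < `|c| / 2 by rewrite divr_gt0// normr_gt0.
have [A [_ HA]] := fc _ c20.
apply: (integrable_not_large fi c20) => n; exists (A + 1) => x /andP[xA _].
have /HA /= : A < x by lra.
by have := lerB_dist c (c - f x); rewrite subKr; lra.
Qed.

(** The second weak derivative [g2] of [f] is a weak derivative of the first one [g1]. Hence [g1]
    agrees almost everywhere with a continuous [k], and [f], being an antiderivative of [k], is
    differentiable in the classical sense. *)
Lemma sobolev1_oo_derive f : sobolev1_oo f ->
  exists2 k, forall x, is_derive x (1 : R) f (k x) & sobolev1_oo k.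
Proof.
move=> [cf sf]; have [fi] := sf 2%N.
move=> /[dup] /(_ 1%N isT) [g1 [g1i wd1]] /(_ 2%N isT) [g2 [g2i wd2]].
have wd12 : weak_derivative 1 g1 g2.
  move=> psi tpsi; have := wd1 _ (test_function_derive1 tpsi).
  have := wd2 _ tpsi; rewrite /derive1n/= => ->.
  rewrite expr2 expr1 !mulN1r opprK mul1r => ->.
  by rewrite opprK.
have lg1 := integrable_lebesgue_pt g1i.
have [a0 la0] := ae_exists lg1.
(* Any Lebesgue point [a0] of [g1] fixes the constant of integration; [k] then equals [g1] at every
   Lebesgue point. *)
pose k x := g1 a0 - prim g2 a0 + prim g2 x.
have ck : continuous k.
  by move=> x; apply: cvgD; [exact: cvg_cst|exact: prim_continuous].
have g1k : {ae mu, forall x, g1 x = k x}.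
  apply: (@filterS _ _ (ae_filter_ringOfSetsType mu) _ _ _ lg1) => x lx; rewrite /k.
  have [xa|ax|->] := ltgtP x a0; last by ring.
  - have := weak_derivative_FTC g1i g2i wd12 lx la0 xa.
    by rewrite -primB ?(ltW xa)//; lra.
  - have := weak_derivative_FTC g1i g2i wd12 la0 lx ax.
    by rewrite -primB ?(ltW ax)//; lra.
have mk := continuous_measurable_fun ck.
have mg1 := integrable_measurable g1i.
have ki : Integrable k := ae_integrable g1i mk g1k.
have fk a b : a <= b -> f b - f a = prim k b - prim k a.
  rewrite le_eqVlt => /predU1P[->|ab]; first by rewrite !subrr.
  rewrite primB ?(ltW ab)// -(ae_eq_Rintegral _ mg1 mk g1k)//.
  by rewrite (weak_derivative_FTC fi g1i wd1)//; exact: continuous_lebesgue_ptT.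
exists k.
  move=> x; have -> : f = (fun y => (f 0 - prim k 0) + prim k y).
    apply/funext => y; have [y0|y0] := leP 0 y; first by have := fk _ _ y0; lra.
    by have := fk _ _ (ltW y0); lra.
  by apply: (is_derive_eq (is_derive1D (is_derive1_cst _ x) (is_derive_prim ki (ck x)))); rewrite add0r.
split=> // n; split=> // j jn; have [_] := sf n.+1.
(* The weak derivative of order j of [k] is the one of order j + 1 of [f]: the definition for [g1]
   is tested against the j-th derivative of [psi], and one sign cancels. *)
move=> /(_ j.+1 jn)[g [gi wdg]]; exists g; split=> // psi tpsi.
have tj := test_function_derive1n j tpsi.
have mj := continuous_measurable_fun (test_function_continuous tj).
have := wdg _ tpsi; have := wd1 _ tj; rewrite -[derive1n 1 _]/(derive1n j.+1 psi) => ->.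
rewrite expr1 exprS -mulrA => /(mulfI _) => <-; last by rewrite oppr_eq0 oner_neq0.
apply: ae_eq_Rintegral => //; [exact: measurable_funM|exact: measurable_funM|].
by apply: (@filterS _ _ (ae_filter_ringOfSetsType mu) _ _ _ g1k) => x /= ->.
Qed.

(** [f - prim k] is a constant, equal to the limit of [f] at -oo, and an integrable function admits
    no limit but 0. The same remark settles the limit at +oo, which exists because [prim k]
    converges there. *)
Lemma sobolev1_oo_prim f k : sobolev1_oo f ->
  (forall x, is_derive x (1 : R) f (k x)) -> sobolev1_oo k ->
  f = prim k /\ f x @[x --> +oo] --> (0 : R).
Proof.
move=> [cf /(_ 0%N)[fi _]] dk [ck /(_ 0%N)[ki _]].
have cE x : f x = f 0 - prim k 0 + prim k x.
  have h y : is_derive y (1 : R) (fun y => f y - prim k y) 0.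
    by apply: (is_derive_eq (is_derive1B (dk y) (is_derive_prim ki (ck y)))); rewrite subrr.
  by have := is_derive_0_is_cst x 0 h; lra.
have c0 : f 0 - prim k 0 = 0.
  apply: (integrable_cvgNy0 fi).
  rewrite [X in X x @[x --> _]](_ : f = (fun x => f 0 - prim k 0 + prim k x)); last exact/funext.
  by rewrite -[X in _ --> X]addr0; apply: cvgD; [exact: cvg_cst|exact: prim_cvgNy].
have fk : f = prim k by apply/funext => x; rewrite cE c0 add0r.
split=> //; have := prim_cvgy ki; rewrite -fk => fc.
by rewrite -[X in _ --> X](integrable_cvgy0 fi fc).
Qed.

Definition bounded_continuous f := continuous f /\ exists M : R, forall x, `|f x| <= M.

(** Boundedness is a consequence of membership in W^{oo,1}; carrying it along makes the class stable
    under products. *)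
Definition integrable_bounded f := bounded_continuous f /\ Integrable f.

Lemma sobolev1_oo_smooth f : sobolev1_oo f -> smooth integrable_bounded f.
Proof.
move=> sf; apply: (@smooth_coind _ _ (@sobolev1_oo R)) => // g sg.
have [k dk sk] := sobolev1_oo_derive sg; split; last by exists k.
have [gk _] := sobolev1_oo_prim sg dk sk.
have [cg /(_ 0%N)[gi _]] := sg; have [ck /(_ 0%N)[ki _]] := sk.
by split=> //; split=> //; exists (\int[mu]_(y in setT) `|k y|) => x; rewrite gk; exact: prim_bounded.
Qed.

Lemma smooth_sobolev1_oo f : smooth integrable_bounded f -> sobolev1_oo f.
Proof.
move=> sf; split; first by have [[]] := smooth_base sf.
move=> n; split; first by have [] := smooth_base sf.
move=> j _; exists (derive1n j f); split.
  by have [] := smooth_base (smooth_derive1n j sf).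
elim: j f sf => [|j IH] f sf psi tpsi; first by rewrite expr0 mul1r.
rewrite [derive1n j.+1 f]derive1Sn exprS -mulrA -IH//; last exact: smooth_derive1.
have tj := test_function_derive1n j tpsi; have tj1 := test_function_derive1n j.+1 tpsi.
have [[cf _] fi] := smooth_base sf.
have [[cf' _] f'i] := smooth_base (smooth_derive1 sf).
have cj := test_function_continuous tj; have cj1 := test_function_continuous tj1.
have [dj [M Mj]] := tj; have [_ [M1 Mj1]] := tj1.
have isupp h p (N : R) : continuous h -> continuous p -> (forall x, N < `|x| -> p x = 0) ->
    Integrable (fun x => h x * p x).
  move=> ch cp p0; apply: (@integrableT_supp _ _ (- `|N|) `|N|).
    exact: continuous_mulf.
  move=> x xN; rewrite p0 ?mulr0//; apply: (le_lt_trans (ler_norm N)).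
  by rewrite lter_normr; apply/orP; case: xN => ?; [right|left]; lra.
(* Integration by parts: the integrand is the derivative of [f] times the j-th derivative of [psi],
   a compactly supported function. *)
have : \int[mu]_(x in setT) (derive1 f x * derive1n j psi x + f x * derive1n j.+1 psi x) = 0.
  apply: (@Rintegral_derive_supp (fun x => f x * derive1n j psi x) _ M).
  - move=> x; apply: is_derive1M; first exact: smooth_is_derive sf.
    exact: derivable_is_derive1 (dj 0%N x).
  - by apply: continuous_addf; exact: continuous_mulf.
  - by move=> x Mx; rewrite Mj// mulr0.
rewrite RintegralD//; [|exact: isupp Mj|exact: isupp Mj1].
by lra.
Qed.

End sobolev_smooth.

(** * Function classes and changes of variable *)

Section classes.
Context {R : realType}.
Implicit Types (f g h : R -> R) (x y z a b c : R).
Notation mu := (@lebesgue_measure R).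
Local Notation Integrable f := (mu.-integrable setT (EFin \o f)).
Local Notation Pb := (@bounded_continuous R).
Local Notation Pi := (@integrable_bounded R).

Lemma bounded_continuousD f g : Pb f -> Pb g -> Pb (fun x => f x + g x).
Proof.
move=> [cf [M fM]] [cg [N gN]]; split; first exact: continuous_addf.
by exists (M + N) => x; rewrite (le_trans (ler_normD _ _))// lerD.
Qed.

Lemma bounded_continuousM f g : Pb f -> Pb g -> Pb (fun x => f x * g x).
Proof.
move=> [cf [M fM]] [cg [N gN]]; split; first exact: continuous_mulf.
by exists (M * N) => x; rewrite normrM ler_pM.
Qed.

Lemma bounded_continuous_cst c : Pb (fun=> c).
Proof. by split; [exact: cst_continuous|exists `|c|]. Qed.

Lemma integrable_boundedD f g : Pi f -> Pi g -> Pi (fun x => f x + g x).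
Proof.
by move=> [bf fi] [bg gi]; split; [exact: bounded_continuousD|exact: integrableT_D].
Qed.

Lemma integrable_boundedM f g : Pi f -> Pb g -> Pi (fun x => f x * g x).
Proof.
move=> [bf fi] bg; split; first exact: bounded_continuousM.
by case: bg => cg [M gM]; apply: (integrableT_M fi _ gM); exact: continuous_measurable_fun.
Qed.

Lemma smooth_boundedM f g : smooth Pb f -> smooth Pb g -> smooth Pb (fun x => f x * g x).
Proof. by apply: smoothM; [exact: bounded_continuousD|exact: bounded_continuousM]. Qed.

Lemma smooth_integrableM f g : smooth Pi f -> smooth Pb g -> smooth Pi (fun x => f x * g x).
Proof. by apply: smoothM; [exact: integrable_boundedD|exact: integrable_boundedM]. Qed.

Lemma smooth_bounded_cst c : smooth Pb (fun=> c).
Proof. by apply: smooth_cst; exact: bounded_continuous_cst. Qed.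

Lemma smooth_integrable_bounded f : smooth Pi f -> smooth Pb f.
Proof. by move=> sf n; apply: diffn_sub (sf n) => g []. Qed.

(** The power is monotone, in a direction that depends on the sign of [p]; the sum of both endpoint
    values bounds it in either case. *)
Lemma powR_bound a c C p : 0 < c -> c <= a <= C -> a `^ p <= c `^ p + C `^ p.
Proof.
move=> c0 /andP[ca aC]; have a0 := lt_le_trans c0 ca; have C0 := lt_le_trans a0 aC.
have [p0|p0] := leP 0 p.
  by rewrite (@le_trans _ _ (C `^ p)) ?lerDr ?powR_ge0// ge0_ler_powR// nnegrE ltW.
rewrite (@le_trans _ _ (c `^ p)) ?lerDl ?powR_ge0//.
rewrite -(opprK p) !(@powRN _ _ (- p)) lef_pV2 ?posrE ?powR_gt0//.
have np : 0 <= - p by lra.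
by apply: ge0_ler_powR => //; rewrite nnegrE ltW.
Qed.

(** Each derivative lowers the exponent by 1, so the induction on the order treats all [p] at once;
    the lower bound [c] keeps negative powers bounded. *)
Lemma smooth_powR f c p : 0 < c -> (forall x, c <= f x) -> smooth Pb f ->
  smooth Pb (fun x => f x `^ p).
Proof.
move=> c0 cf sf; have f0 x : 0 < f x by exact: lt_le_trans (cf x).
have Pp q : Pb (fun x => f x `^ q).
  split.
    move=> x; apply: is_derive1_continuous.
    by apply: is_derive1_powR_comp => //; exact: smooth_is_derive sf.
  have [_ [M fM]] := smooth_base sf; exists (c `^ q + M `^ q) => x.
  rewrite ger0_norm ?powR_ge0//; apply: powR_bound => //.
  by rewrite cf (le_trans (ler_norm _)).
move=> n; elim: n p => [|n IH] p; first by split.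
split=> //; exists (fun x => derive1 f x * (p * f x `^ (p - 1))).
  by move=> x; apply: is_derive1_powR_comp => //; exact: smooth_is_derive sf.
apply: (@diffnM _ Pb Pb); [exact: bounded_continuousD|exact: bounded_continuousM| |].
  exact: smooth_derive1.
apply: (@diffnM _ Pb Pb); [exact: bounded_continuousD|exact: bounded_continuousM| |exact: IH].
exact: smooth_bounded_cst.
Qed.

Lemma smooth_integrable_cvg f : smooth Pi f ->
  f x @[x --> -oo] --> (0 : R) /\ f x @[x --> +oo] --> (0 : R).
Proof.
move=> sf; have s1 := smooth_sobolev1_oo sf.
have s2 := smooth_sobolev1_oo (smooth_derive1 sf).
have [fE fy] := sobolev1_oo_prim s1 (fun x => smooth_is_derive x sf) s2.
by split=> //; rewrite fE; apply: prim_cvgNy; have [] := smooth_base (smooth_derive1 sf).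
Qed.

End classes.

(** * Diffeomorphisms of the line with derivative bounded above and away from 0 *)

Section increasing_diffeo.
Context {R : realType}.
Implicit Types (f g h : R -> R) (x y z a b : R).
Notation mu := (@lebesgue_measure R).
Local Notation Integrable f := (mu.-integrable setT (EFin \o f)).
Local Notation Pb := (@bounded_continuous R).
Local Notation Pi := (@integrable_bounded R).
Variables (p e : R -> R) (c C : R).
Hypothesis dp : forall x, is_derive x (1 : R) p (e x).
Hypothesis c0 : 0 < c.
Hypothesis ce : forall x, c <= e x <= C.

Let e0 x : 0 < e x. Proof. by have /andP[/(lt_le_trans c0)] := ce x. Qed.

Lemma diffeo_expand a b : a <= b -> c * (b - a) <= p b - p a.
Proof.
rewrite le_eqVlt => /predU1P[->|ab]; first by rewrite !subrr mulr0.
have [x _ ->] := is_derive1_MVT ab (fun x _ => dp x).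
by rewrite ler_pM2r ?subr_gt0//; case/andP: (ce x).
Qed.

Lemma diffeo_lt a b : a < b -> p a < p b.
Proof.
by move=> ab; rewrite -subr_gt0 (lt_le_trans _ (diffeo_expand (ltW ab)))// mulr_gt0// subr_gt0.
Qed.

Lemma diffeo_inj : injective p.
Proof.
move=> a b pab; have [/diffeo_lt|/diffeo_lt|//] := ltgtP a b; by rewrite pab ltxx.
Qed.

Let cp : continuous p. Proof. by move=> x; exact: is_derive1_continuous (dp x). Qed.

Lemma diffeo_dist a b : c * `|b - a| <= `|p b - p a|.
Proof.
wlog ab : a b / a <= b.
  by move=> H; have [/H//|/ltW/H] := leP a b; rewrite distrC (distrC (p _)).
rewrite !ger0_norm ?subr_ge0//; first exact: diffeo_expand.
by rewrite -subr_ge0 (le_trans _ (diffeo_expand ab))// mulr_ge0 ?subr_ge0// ltW.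
Qed.

Lemma diffeo_cvgy : p x @[x --> +oo] --> +oo.
Proof.
apply/cvgryPge => A; near=> x.
have x0 : 0 <= x by near: x; exact: nbhs_pinfty_ge (num_real _).
have := diffeo_expand x0; rewrite subr0.
have : (A - p 0) / c <= x by near: x; exact: nbhs_pinfty_ge (num_real _).
by rewrite ler_pdivrMr// mulrC; lra.
Unshelve. all: by end_near. Qed.

Lemma diffeo_cvgNy : p x @[x --> -oo] --> -oo.
Proof.
apply/cvgrNyPle => A; near=> x.
have x0 : x <= 0 by near: x; exact: nbhs_ninfty_le (num_real _).
have := diffeo_expand x0; rewrite sub0r.
have : x <= (A - p 0) / c by near: x; exact: nbhs_ninfty_le (num_real _).
by rewrite ler_pdivlMr// mulrC; lra.
Unshelve. all: by end_near. Qed.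

Lemma diffeo_surj y : exists x, p x = y.
Proof.
have [a ay] : exists a, p a <= y.
  move/cvgrNyPle : diffeo_cvgNy => /(_ y)[M [_ HM]].
  by exists (M - 1); apply: HM => /=; lra.
have [b yb] : exists b, y <= p b.
  move/cvgryPge : diffeo_cvgy => /(_ y)[M [_ HM]].
  by exists (M + 1); apply: HM => /=; lra.
have ab : a <= b.
  by rewrite leNgt; apply/negP => /diffeo_lt; lra.
have yab : Num.min (p a) (p b) <= y <= Num.max (p a) (p b).
  by rewrite ge_min ay le_max yb orbT.
by have [x _ <-] := IVT ab (continuous_subspaceT cp) yab; exists x.
Qed.

Notation psi := (pinv setT p).

Lemma diffeoK x : psi (p x) = x.
Proof. by apply: pinvKV; rewrite ?in_setT// => ? ? _ _; exact: diffeo_inj. Qed.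

Lemma diffeoKV y : p (psi y) = y.
Proof. by have [x <-] := diffeo_surj y; rewrite diffeoK. Qed.

Lemma is_derive_psi y : is_derive y (1 : R) psi (e (psi y))^-1.
Proof.
rewrite -{1}(diffeoKV y); apply: (@is_derive_inverse _ p psi).
- by near=> x; exact: diffeoK.
- by near=> x; exact: cp.
- by rewrite gt_eqF.
Unshelve. all: by end_near. Qed.

Lemma diffeo_psi_cvgNy : psi y @[y --> -oo] --> -oo.
Proof.
apply/cvgrNyPle => A; near=> y.
have yA : y <= p A by near: y; exact: nbhs_ninfty_le (num_real _).
rewrite leNgt; apply/negP => /diffeo_lt; rewrite diffeoKV; lra.
Unshelve. all: by end_near. Qed.

Hypothesis ec : continuous e.
Hypothesis eNy : cvg (e x @[x --> -oo]).
Hypothesis ey : cvg (e x @[x --> +oo]).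

(** Substituting y = p x turns the integral of |h o psi| into that of |h| e, at most C times the
    integral of |h|. The limits of [e] at both ends are assumed for the substitution theorem on the
    whole line. *)
Lemma diffeo_integrable h : Pi h -> Integrable (fun y => h (psi y)).
Proof.
move=> [[ch _] hi].
have cpsi : continuous psi by move=> y; exact: is_derive1_continuous (is_derive_psi y).
have chp : continuous (fun y => h (psi y)).
  by move=> y; apply: continuous_comp; [exact: cpsi|exact: ch].
apply/integrableP; split; first by apply/measurable_EFinP; exact: continuous_measurable_fun.
have cG : continuous (fun y => `|h (psi y)|).
  by move=> y; apply: continuous_comp; [exact: chp|exact: norm_continuous].
have lt_p : {homo p : x y / x < y} by move=> x y; exact: diffeo_lt.
have pd x : derivable p x 1 by case: (dp x).
have := @increasing_ge0_integration_by_substitutionT R p (fun y => `|h (psi y)|) lt_p.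
rewrite (derive1_of dp) => /(_ ec eNy ey pd diffeo_cvgNy diffeo_cvgy cG) -> //.
have -> : ((fun y => `|h (psi y)|) \o p) * e = (fun x => `|h x * e x|).
  by apply/funext => x /=; rewrite /GRing.mul/= diffeoK normrM (gtr0_norm (e0 x)).
have : Integrable (fun x => h x * e x).
  apply: (@integrableT_M _ _ _ C) => //; first exact: continuous_measurable_fun.
  by move=> x; rewrite ger0_norm ?(ltW (e0 x))//; case/andP: (ce x).
by move/integrableP => [].
Qed.

(** The derivative of h o psi is (h' / e) o psi, again of the form treated, so the induction runs
    over all [h]. *)
Lemma diffeo_smooth h : smooth Pb (fun x => (e x)^-1) -> smooth Pi h ->
  smooth Pi (fun y => h (psi y)).
Proof.
move=> se sh n; elim: n h sh => [|n IH] h sh.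
  have [bh hi] := smooth_base sh; have [ch [M hM]] := bh.
  split=> //; split; last by apply: diffeo_integrable; split.
  split; last by exists M.
  move=> y; apply: continuous_comp; last exact: ch.
  exact: is_derive1_continuous (is_derive_psi y).
split; first exact: diffn_base (IH _ sh).
exists (fun y => (fun x => derive1 h x * (e x)^-1) (psi y)).
  move=> y; apply: (is_derive_eq (is_derive1_chain (smooth_is_derive _ sh) (is_derive_psi y))).
  by rewrite mulrC.
apply: (IH (fun x => derive1 h x * (e x)^-1)).
by apply: smooth_integrableM => //; exact: smooth_derive1.
Qed.

End increasing_diffeo.

(** * Derivatives in time *)

Section time_derivatives.
Context {R : realType}.
Implicit Types (f g : R -> R) (F G : R -> R -> R) (T : \bar R) (t s a b l : R).

Lemma before_near T t : before T t ->
  exists2 d : R, 0 < d & forall s, 0 <= s -> `|s - t| < d -> before T s.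
Proof.
case: T => [T| |] [t0]; rewrite /before ?lte_fin => tT.
- exists (T - t); first by rewrite subr_gt0.
  by move=> s s0 st; split=> //; rewrite lte_fin; have := ler_norm (s - t); lra.
- by exists 1 => // s s0 _; split=> //; exact: ltry.
- by [].
Qed.

Lemma before_le T s t : 0 <= s <= t -> before T t -> before T s.
Proof.
by move=> /andP[s0 st] [_ tT]; split=> //; apply: le_lt_trans tT; rewrite lee_fin.
Qed.

Lemma before0 T t : before T t -> before T 0.
Proof. by move=> /[dup] -[t0 _]; apply: before_le; rewrite lexx. Qed.

(** A quotient-free form in which s = t need not be excluded and one-sidedness at 0 is the single
    condition 0 <= s. *)
Lemma is_tderiveP f t l : is_tderive f t l <->
  forall e : R, 0 < e -> exists2 d : R, 0 < d & forall s, 0 <= s -> `|s - t| < d ->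
    `|f s - f t - l * (s - t)| <= e * `|s - t|.
Proof.
split=> [/cvgrPdist_lt fl e e0|H].
- have [d /= d0 Hd] := fl _ e0; exists d => // s s0 std.
  have [->|st] := eqVneq s t; first by rewrite !subrr mulr0 subr0 normr0 mulr0.
  have st0 : s - t != 0 by rewrite subr_eq0.
  have := Hd (s - t); rewrite /= sub0r normrN => /(_ std st0).
  rewrite addrC subrK => /(_ s0)/ltW.
  rewrite -(ler_pM2r (_ : 0 < `|s - t|)) ?normr_gt0// -normrM mulrBl.
  by rewrite mulrAC mulVf// mul1r distrC.
- apply/cvgrPdist_le => e e0; have [d d0 Hd] := H _ e0.
  exists d => //= h; rewrite /= sub0r normrN => hd h0 th0.
  have := Hd (t + h) th0; rewrite addrAC subrr add0r => /(_ hd).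
  rewrite -(ler_pM2r (_ : 0 < `|h|^-1)) ?invr_gt0 ?normr_gt0// mulfK ?normr_eq0//.
  rewrite -normfV -normrM mulrBl mulfK// distrC.
  by rewrite [h^-1 * _]mulrC.
Qed.

Lemma is_derive_tderive f t l : is_derive t (1 : R) f l -> is_tderive f t l.
Proof.
move/is_derive1P => fl; apply: cvg_trans fl; apply: cvg_app; exact: cvg_within.
Qed.

Lemma tderive_is_derive f t l : 0 < t -> is_tderive f t l -> is_derive t (1 : R) f l.
Proof.
move=> t0 /is_tderiveP H; apply/is_derive1P/cvgrPdist_le => e e0.
have [d d0 Hd] := H _ e0; near=> h.
have h0 : h != 0 by near: h; exact: nbhs_dnbhs_neq.
have hd : `|h| < d by near: h; exact: dnbhs0_lt.
have ht : `|h| < t by near: h; exact: dnbhs0_lt.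
have th0 : 0 <= t + h by have := ler_norm (- h); rewrite normrN; lra.
have := Hd (t + h) th0; rewrite addrAC subrr add0r => /(_ hd).
rewrite -(ler_pM2r (_ : 0 < `|h|^-1)) ?invr_gt0 ?normr_gt0// mulfK ?normr_eq0//.
rewrite -normfV -normrM mulrBl mulfK// distrC.
by rewrite [h^-1 * _]mulrC.
Unshelve. all: by end_near. Qed.

Lemma is_tderive_cvg f t l : is_tderive f t l ->
  forall e : R, 0 < e -> exists2 d : R, 0 < d & forall s, 0 <= s -> `|s - t| < d -> `|f s - f t| < e.
Proof.
move=> /is_tderiveP/(_ 1 ltr01)[d d0 Hd] e e0.
pose K := 1 + `|l|; have K0 : 0 < K by rewrite ltr_pwDl.
exists (Num.min d (e / K)); first by rewrite lt_min d0 divr_gt0.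
move=> s s0; rewrite lt_min ltr_pdivlMr// => /andP[sd se].
apply: le_lt_trans se; rewrite mulrC mulrDl.
have := Hd s s0 sd; have := ler_normD (f s - f t - l * (s - t)) (l * (s - t)).
by rewrite subrK normrM; lra.
Qed.

Lemma is_tderive_near f g t l (d : R) : 0 < d ->
  (forall s, 0 <= s -> `|s - t| < d -> f s = g s) -> 0 <= t ->
  is_tderive f t l -> is_tderive g t l.
Proof.
move=> d0 fg t0 /is_tderiveP H; apply/is_tderiveP => e e0.
have [d' d'0 Hd] := H _ e0; exists (Num.min d d'); first by rewrite lt_min d0.
move=> s s0; rewrite lt_min => /andP[sd sd'].
by rewrite -!fg// ?subrr ?normr0//; exact: Hd.
Qed.

Lemma is_tderive_unique f t l l' : 0 <= t -> is_tderive f t l -> is_tderive f t l' -> l = l'.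
Proof.
move=> t0 /is_tderiveP H /is_tderiveP H'; apply/eqP; rewrite -subr_eq0 -normr_le0.
apply/ler_addgt0Pl => e e0; rewrite addr0.
have e20 : 0 < e / 2 by rewrite divr_gt0.
have [d d0 Hd] := H _ e20; have [d' d'0 Hd'] := H' _ e20.
pose m := Num.min d d' / 2.
have m0 : 0 < m by rewrite divr_gt0// lt_min d0.
have md : m < d by rewrite /m ltr_pdivrMr//; have : Num.min d d' <= d by [rewrite ge_min lexx]; lra.
have md' : m < d' by rewrite /m ltr_pdivrMr//; have : Num.min d d' <= d' by [rewrite ge_min lexx orbT]; lra.
have tm : 0 <= t + m by lra.
have := Hd _ tm; have := Hd' _ tm; rewrite addrAC subrr add0r (gtr0_norm m0).
move=> /(_ md') h' /(_ md) h.
rewrite -(ler_pM2r m0) -{1}(gtr0_norm m0) -normrM.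
rewrite (_ : (l - l') * m = (f (t + m) - f t - l' * m) - (f (t + m) - f t - l * m)); last by ring.
by rewrite (le_trans (ler_normB _ _))//; lra.
Qed.

Lemma continuous_beforeP T F : continuous_before T F <->
  forall t x, before T t -> forall e : R, 0 < e -> exists2 d : R, 0 < d &
    forall s y, before T s -> `|s - t| < d -> `|y - x| < d -> `|F s y - F t x| < e.
Proof.
rewrite /continuous_before subspace_continuousP; split=> H.
- move=> t x tT e e0; have /cvgrPdist_lt/(_ e e0) := H (t, x) tT.
  move=> /nbhs_ballP[d /= d0 Hd]; exists d => // s y sT std yxd.
  by have := Hd (s, y); rewrite /= distrC; apply=> //; split; rewrite /ball/= distrC.
- move=> [t x] /= tT; apply/cvgrPdist_lt => e e0; have [d d0 Hd] := H t x tT e e0.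
  apply/nbhs_ballP; exists d => //= -[s y] [/= std yxd] sT.
  by rewrite distrC; apply: Hd => //; rewrite distrC.
Qed.

(** Exactly what the mean value theorem on [0, b] with b < T asks for: a two-sided derivative at
    positive times and mere right continuity at 0. The usual calculus rules then apply without
    one-sided variants. *)
Definition tder T f (f' : R -> R) :=
  (forall t, 0 < t -> (t%:E < T)%E -> is_derive t (1 : R) f (f' t)) /\
  f s @[s --> 0^'+] --> f 0.

Lemma is_tderive_tder T f (f' : R -> R) : (0%:E < T)%E ->
  (forall t, before T t -> is_tderive f t (f' t)) -> tder T f f'.
Proof.
move=> T0 df; split.
  by move=> t t0 tT; apply: tderive_is_derive => //; apply: df; split=> //; exact: ltW.
have H := is_tderive_cvg (df 0 (conj (lexx 0) T0)).
apply/cvgrPdist_lt => e e0; have [d d0 Hd] := H _ e0.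
exists d => //= s; rewrite /= sub0r normrN => sd s0; rewrite distrC; apply: Hd; first exact: ltW.
by rewrite subr0.
Qed.

Lemma tderM T f g (f' g' : R -> R) : tder T f f' -> tder T g g' ->
  tder T (fun t => f t * g t) (fun t => f' t * g t + f t * g' t).
Proof.
move=> [df f0] [dg g0]; split; last exact: cvgM.
by move=> t t0 tT; apply: is_derive1M; [exact: df|exact: dg].
Qed.

Lemma tderD T f g (f' g' : R -> R) : tder T f f' -> tder T g g' ->
  tder T (fun t => f t + g t) (fun t => f' t + g' t).
Proof.
move=> [df f0] [dg g0]; split; last exact: cvgD.
by move=> t t0 tT; apply: is_derive1D; [exact: df|exact: dg].
Qed.

Lemma tder_global T f (f' : R -> R) : (forall t, 0 <= t -> (t%:E < T)%E -> is_derive t (1 : R) f (f' t)) ->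
  (0%:E < T)%E -> tder T f f'.
Proof.
move=> df T0; split; first by move=> t t0 tT; apply: df => //; exact: ltW.
by apply/cvg_at_right_filter/is_derive1_continuous; exact: df.
Qed.

Lemma tder_MVT T f (f' : R -> R) a b : tder T f f' -> 0 <= a -> a < b -> (b%:E < T)%E ->
  exists2 c, a < c < b & f b - f a = f' c * (b - a).
Proof.
move=> [df f0] a0 ab bT.
have cf x : 0 < x -> x <= b -> {for x, continuous f}.
  move=> x0 xb; apply: is_derive1_continuous (df x x0 _).
  by apply: le_lt_trans bT; rewrite lee_fin.
have [||c] := @MVT R f f' a b ab.
- move=> x; rewrite in_itv/= => /andP[ax xb]; apply: df.
    exact: le_lt_trans ax.
  by apply: lt_trans bT; rewrite lte_fin.
- apply/continuous_within_itvP => //; split.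
  + by move=> x; rewrite in_itv/= => /andP[ax xb]; apply: cf; [exact: le_lt_trans ax|exact: ltW].
  + move: a0; rewrite le_eqVlt => /predU1P[<-//|a0].
    by apply: cvg_at_right_filter; apply: cf => //; exact: ltW.
  + by apply: cvg_at_left_filter; apply: cf => //; exact: le_lt_trans ab.
by rewrite in_itv/=; exists c.
Qed.

Lemma tder_cst T f a b : tder T f (fun=> 0) -> 0 <= a <= b -> (b%:E < T)%E -> f b = f a.
Proof.
move=> df /andP[a0]; rewrite le_eqVlt => /predU1P[->//|ab] bT.
by have [c _ /eqP] := tder_MVT df a0 ab bT; rewrite mul0r subr_eq0 => /eqP.
Qed.

Lemma tder_nincr T f (f' : R -> R) a b : tder T f f' -> 0 <= a -> a <= b ->
  (b%:E < T)%E -> (forall c, a < c < b -> f' c <= 0) -> f b <= f a.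
Proof.
move=> df a0; rewrite le_eqVlt => /predU1P[->//|ab] bT f'0.
have [c acb fE] := tder_MVT df a0 ab bT; rewrite -subr_le0 fE.
by rewrite mulr_le0_ge0 ?f'0// subr_ge0 ltW.
Qed.

Lemma tder_bounded T f (f' : R -> R) b : tder T f f' -> 0 < b -> (b%:E < T)%E ->
  exists M, forall t, 0 <= t <= b -> `|f t| <= M.
Proof.
move=> [df f0] b0 bT.
have [|c _ cmax] := @EVT_max R (fun t => `|f t|) 0 b (ltW b0).
  apply/continuous_within_itvP => //; split.
  - move=> x; rewrite in_itv/= => /andP[x0 xb]; apply: continuous_comp; last exact: norm_continuous.
    by apply: is_derive1_continuous (df x x0 _); apply: lt_trans bT; rewrite lte_fin.
  - exact: cvg_norm.
  - apply: cvg_norm; apply: cvg_at_left_filter; exact: is_derive1_continuous (df b b0 bT).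
by exists `|f c| => t tb; apply: cmax; rewrite in_itv.
Qed.

(* If |q| <= M then z ^ 2 exp (- 2 M t) is nonincreasing. *)
Lemma tder_linear_eq0 T z q (q' : R -> R) : tder T z (fun t => q t * z t) -> tder T q q' ->
  z 0 = 0 -> forall t, 0 <= t -> (t%:E < T)%E -> z t = 0.
Proof.
move=> dz dq z0 t; rewrite le_eqVlt => /predU1P[<-//|t0] tT.
have [M HM] := tder_bounded dq t0 tT.
have T0 : (0%:E < T)%E by apply: lt_trans tT; rewrite lte_fin.
have dexp : tder T (fun s => expR (- (2 * M) * s)) (fun s => - (2 * M) * expR (- (2 * M) * s)).
  apply: tder_global => // s _ _.
  have := is_derive1_chain (is_derive_expR _) (is_derive1Zl (- (2 * M)) (is_derive1_id s)).
  by move/is_derive_eq; apply; rewrite mulr1.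
have := tder_nincr (tderM (tderM dz dz) dexp) (lexx 0) (ltW t0) tT.
rewrite /= z0 !mul0r => H.
have {}H : z t * z t * expR (- (2 * M) * t) <= 0.
  apply: H => s /andP[s0 st].
  have := HM s; rewrite (ltW s0) (ltW st) ler_norml => /(_ isT)/andP[_ qM].
  rewrite (_ : _ + _ = 2 * (q s - M) * (z s ^+ 2 * expR (- (2 * M) * s))); last by ring.
  apply: mulr_le0_ge0; first by lra.
  by apply: mulr_ge0; [exact: sqr_ge0|exact: expR_ge0].
apply/eqP; rewrite -sqrf_eq0 -[_ == _]orbF expr2.
have : z t * z t <= 0 by rewrite -(ler_pM2r (expR_gt0 (- (2 * M) * t))) mul0r.
by move=> zz; rewrite orbF eq_le zz -expr2 sqr_ge0.
Qed.

End time_derivatives.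

(** * Exchange of time and space derivatives, and the chain rule along a moving point *)

Section mixed_derivatives.
Context {R : realType}.
Implicit Types (f g : R -> R) (F Fx Ft G : R -> R -> R) (T : \bar R) (t s a b l x y e d : R).

Lemma is_derive1_eps f x l : (forall e : R, 0 < e -> exists2 d : R, 0 < d &
    forall k, `|k| < d -> `|f (x + k) - f x - l * k| <= e * `|k|) ->
  is_derive x 1 f l.
Proof.
move=> H; apply/is_derive1P/cvgrPdist_le => e e0; have [d d0 Hd] := H _ e0.
near=> h.
have h0 : h != 0 by near: h; exact: nbhs_dnbhs_neq.
have hd : `|h| < d by near: h; exact: dnbhs0_lt.
rewrite -(ler_pM2r (_ : 0 < `|h|)) ?normr_gt0// -normrM mulrBl distrC mulrAC mulVf// mul1r.
exact: Hd.
Unshelve. all: by end_near. Qed.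

(** The limit in a bound on difference quotients. Only s >= 0 is tested, so at t = 0 an estimate on
    increments to the right suffices. *)
Lemma is_tderive_bound f t l c B d : 0 <= t -> is_tderive f t l -> 0 < d ->
  (forall s, 0 <= s -> `|s - t| < d -> `|f s - f t - c * (s - t)| <= B * `|s - t|) ->
  `|l - c| <= B.
Proof.
move=> t0 /is_tderiveP H d0 Hd; apply/ler_addgt0Pl => e e0.
have [d' d'0 Hd'] := H _ e0.
pose m := Num.min d d' / 2.
have m0 : 0 < m by rewrite divr_gt0// lt_min d0.
have md : m < d by rewrite /m ltr_pdivrMr//; have : Num.min d d' <= d by [rewrite ge_min lexx]; lra.
have md' : m < d' by rewrite /m ltr_pdivrMr//; have : Num.min d d' <= d' by [rewrite ge_min lexx orbT]; lra.
have tm : 0 <= t + m by lra.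
have := Hd _ tm; have := Hd' _ tm; rewrite addrAC subrr add0r (gtr0_norm m0).
move=> /(_ md') h' /(_ md) h.
rewrite -(ler_pM2r m0) -{1}(gtr0_norm m0) -normrM.
rewrite (_ : (l - c) * m = (f (t + m) - f t - c * m) - (f (t + m) - f t - l * m)); last by ring.
by rewrite (le_trans (ler_normB _ _))// mulrDl addrC lerD.
Qed.

Lemma is_derive_bound f x l c B d : is_derive x 1 f l -> 0 < d ->
  (forall k, `|k| < d -> `|f (x + k) - f x - c * k| <= B * `|k|) -> `|l - c| <= B.
Proof.
move=> fl d0 Hd.
have gl : is_derive 0 (1 : R) (fun k => f (x + k)) l.
  have := @is_derive1_chain _ f (fun k => x + k) 0 l 1.
  rewrite addr0 mul1r; apply=> //.
  by have /is_derive_eq := is_derive1D (is_derive1_cst x 0) (is_derive1_id (0 : R)); apply; rewrite add0r.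
apply: (@is_tderive_bound (fun k => f (x + k)) 0 l c B d) => //.
  exact: is_derive_tderive.
by move=> s _; rewrite subr0 addr0; exact: Hd.
Qed.

Lemma is_derive1_MVT_sym f (f' : R -> R) a b : (forall x, is_derive x (1 : R) f (f' x)) ->
  exists2 c, `|c - a| <= `|b - a| & f b - f a = f' c * (b - a).
Proof.
move=> df; have [ab|ba|->] := ltgtP a b.
- have [c /andP[ac cb] E] := is_derive1_MVT ab (fun x _ => df x).
  by exists c => //; rewrite !ger0_norm; lra.
- have [c /andP[ac cb] E] := is_derive1_MVT ba (fun x _ => df x).
  exists c; first by rewrite !ler0_norm; lra.
  by lra.
- by exists b; rewrite ?subrr ?mulr0.
Qed.

Lemma tder_MVT_sym T f (f' : R -> R) a b : tder T f f' -> before T a -> before T b ->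
  exists c, [/\ before T c, `|c - a| <= `|b - a| & f b - f a = f' c * (b - a)].
Proof.
move=> df aT bT; have [ab|ba|->] := ltgtP a b.
- have [c /andP[ac cb] E] := tder_MVT df aT.1 ab bT.2.
  exists c; split=> //; last by rewrite !ger0_norm; lra.
  by apply: before_le bT; rewrite (le_trans aT.1) ltW.
- have [c /andP[ac cb] E] := tder_MVT df bT.1 ba aT.2.
  exists c; split; last by lra.
    by apply: before_le aT; rewrite (le_trans bT.1) ltW.
  by rewrite !ler0_norm; lra.
- by exists b; rewrite ?subrr ?mulr0.
Qed.

Lemma is_tderiveB f g t l l' : is_tderive f t l -> is_tderive g t l' ->
  is_tderive (fun s => f s - g s) t (l - l').
Proof.
move=> /is_tderiveP H /is_tderiveP H'; apply/is_tderiveP => e e0.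
have e20 : 0 < e / 2 by rewrite divr_gt0.
have [d d0 Hd] := H _ e20; have [d' d'0 Hd'] := H' _ e20.
exists (Num.min d d'); first by rewrite lt_min d0.
move=> s s0; rewrite lt_min => /andP[sd sd'].
rewrite (_ : _ - _ - _ = (f s - f t - l * (s - t)) - (g s - g t - l' * (s - t))); last by ring.
by rewrite (le_trans (ler_normB _ _))//; have := Hd s s0 sd; have := Hd' s s0 sd'; lra.
Qed.

Variable T : \bar R.

(* Schwarz: all four increments of F over a small rectangle are compared with
   the mixed derivative by two applications of the mean value theorem. *)
Lemma schwarz_xt F Fx Ft (g : R -> R -> R) t x :
  (forall s x, before T s -> is_derive x (1 : R) (F s) (Fx s x)) ->
  (forall s x, before T s -> is_tderive (fun s => F s x) s (Ft s x)) ->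
  (forall s x, before T s -> is_derive x (1 : R) (Ft s) (g s x)) ->
  continuous_before T g -> before T t -> is_tderive (fun s => Fx s x) t (g t x).
Proof.
move=> dFx dFt dg cg tT; apply/is_tderiveP => e e0.
have T0 := (before0 tT).2.
have [d d0 Hd] := before_near tT.
have [d' d'0 Hd'] := (continuous_beforeP T g).1 cg t x tT e e0.
exists (Num.min d d'); first by rewrite lt_min d0.
move=> s s0; rewrite lt_min => /andP[sd sd']; have sT := Hd s s0 sd.
apply: (@is_derive_bound (fun y => F s y - F t y) x (Fx s x - Fx t x)
  (g t x * (s - t)) (e * `|s - t|) d') => //.
  by apply: is_derive1B; exact: dFx.
move=> k kd.
have tH : tder T (fun t => F t (x + k) - F t x) (fun t => Ft t (x + k) - Ft t x).
  by apply: is_tderive_tder => // u uT; apply: is_tderiveB; exact: dFt.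
have [u [uT ut Eu]] := tder_MVT_sym tH tT sT.
have [y yx Ey] := is_derive1_MVT_sym x (x + k) (fun y => dg u y uT).
rewrite (_ : _ - _ - _ = (g u y - g t x) * (s - t) * k); last first.
  by rewrite [LHS](_ : _ = (F s (x + k) - F s x - (F t (x + k) - F t x)) - g t x * (s - t) * k);
    [rewrite Eu Ey; ring|ring].
rewrite !normrM ler_wpM2r// ler_wpM2r// ltW//; apply: Hd' => //.
  exact: le_lt_trans sd'.
by apply: le_lt_trans yx _; rewrite addrAC subrr add0r.
Qed.

(** The rectangle argument of [schwarz_xt] with the axes exchanged. It serves to identify the
    initial value of p_xt with the space derivative of the initial velocity. *)
Lemma schwarz_tx F Fx Ft (g : R -> R -> R) t x :
  (forall s x, before T s -> is_derive x (1 : R) (F s) (Fx s x)) ->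
  (forall s x, before T s -> is_tderive (fun s => F s x) s (Ft s x)) ->
  (forall s x, before T s -> is_tderive (fun s => Fx s x) s (g s x)) ->
  continuous_before T g -> before T t -> is_derive x (1 : R) (Ft t) (g t x).
Proof.
move=> dFx dFt dg cg tT; apply: is_derive1_eps => e e0.
have T0 := (before0 tT).2.
have [d d0 Hd] := before_near tT.
have [d' d'0 Hd'] := (continuous_beforeP T g).1 cg t x tT e e0.
exists d' => // k kd.
apply: (@is_tderive_bound (fun s => F s (x + k) - F s x) t _ (g t x * k) (e * `|k|) (Num.min d d')).
- exact: tT.1.
- by apply: is_tderiveB; exact: dFt.
- by rewrite lt_min d0.
move=> s s0; rewrite lt_min => /andP[sd sd']; have sT := Hd s s0 sd.
have [y yx Ey] := is_derive1_MVT_sym x (x + k) (fun y => is_derive1B (dFx s y sT) (dFx t y tT)).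
have [u [uT ut Eu]] := tder_MVT_sym (is_tderive_tder T0 (fun u => dg u y)) tT sT.
rewrite (_ : _ - _ - _ = (g u y - g t x) * k * (s - t)); last first.
  by rewrite [LHS](_ : _ = (F s (x + k) - F t (x + k) - (F s x - F t x)) - g t x * k * (s - t));
    [rewrite Ey Eu; ring|ring].
rewrite !normrM ler_wpM2r// ler_wpM2r// ltW//; apply: Hd' => //.
  exact: le_lt_trans sd'.
by apply: le_lt_trans yx _; rewrite addrAC subrr add0r.
Qed.

(** The part of the chain rule due to the motion of [c]. No time derivative of [F] is assumed:
    adding or subtracting one converts between derivatives along the flow and derivatives at a fixed
    point, in either direction. *)
Lemma tderive_moving F Fx (c : R -> R) t c' :
  (forall s x, before T s -> is_derive x (1 : R) (F s) (Fx s x)) ->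
  continuous_before T Fx -> before T t -> is_tderive c t c' ->
  is_tderive (fun s => F s (c s) - F s (c t)) t (Fx t (c t) * c').
Proof.
move=> dF cFx tT dc; apply/is_tderiveP => e e0.
set A := Fx t (c t).
(* The error splits into the variation of [Fx] times |c s - c t|, and |A| times the linearization
   error of [c]; each gets e / 2. The cap 1 in the next bound yields |c s - c t| <= (|c'| + 1) |s -
   t|. *)
have e1 : 0 < e / (2 * (`|c'| + 1)) by rewrite divr_gt0// mulr_gt0// ltr_wpDl.
have e2 : 0 < Num.min 1 (e / (2 * (`|A| + 1))).
  by rewrite lt_min ltr01 divr_gt0// mulr_gt0// ltr_wpDl.
have [d1 d10 H1] := (continuous_beforeP T Fx).1 cFx t (c t) tT _ e1.
have [d2 d20 H2] := is_tderive_cvg dc d10.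
have [d3 d30 H3] := (is_tderiveP c t c').1 dc _ e2.
have [d4 d40 H4] := before_near tT.
exists (Num.min (Num.min d1 d2) (Num.min d3 d4)); first by rewrite !lt_min d10 d20 d30.
move=> s s0; rewrite !lt_min => /andP[/andP[sd1 sd2] /andP[sd3 sd4]].
have sT := H4 s s0 sd4; have {}H2 := H2 s s0 sd2; have {}H3 := H3 s s0 sd3.
have [y yc Ey] := is_derive1_MVT_sym (c t) (c s) (fun y => dF s y sT).
have {}H1 := H1 s y sT sd1 (le_lt_trans yc H2).
rewrite [F t (c t) - _]subrr subr0 Ey.
rewrite (_ : _ - _ = (Fx s y - A) * (c s - c t) + A * (c s - c t - c' * (s - t))); last by ring.
have h3 : `|c s - c t - c' * (s - t)| <= `|s - t|.
  by rewrite (le_trans H3)// ler_piMl// ge_min lexx.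
have h3' : `|c s - c t - c' * (s - t)| <= e / (2 * (`|A| + 1)) * `|s - t|.
  by rewrite (le_trans H3)// ler_wpM2r// ge_min lexx orbT.
have h4 : `|c s - c t| <= (`|c'| + 1) * `|s - t|.
  rewrite (_ : c s - c t = c s - c t - c' * (s - t) + c' * (s - t)); last by ring.
  by rewrite (le_trans (ler_normD _ _))// normrM; lra.
apply: le_trans (ler_normD _ _) _; rewrite !normrM.
have h5 : `|Fx s y - A| * `|c s - c t| <= e / 2 * `|s - t|.
  apply: le_trans (ler_pM _ _ (ltW H1) h4) _ => //.
  rewrite [leLHS](_ : _ = e / 2 * `|s - t|)//.
  by field; rewrite gt_eqF// ltr_wpDl.
have h6 : `|A| * `|c s - c t - c' * (s - t)| <= e / 2 * `|s - t|.
  apply: le_trans (ler_wpM2l _ h3') _ => //.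
  rewrite mulrA ler_wpM2r// [leLHS](_ : _ = e / 2 * (`|A| / (`|A| + 1))); last first.
    by field; rewrite gt_eqF// ltr_wpDl.
  by rewrite ler_piMr ?divr_ge0 ?(ltW e0)// ler_pdivrMr ?ltr_wpDl// mul1r lerDl.
lra.
Qed.

End mixed_derivatives.

(** * The explicit solution *)

Section explicit_family.
Context {R : realType}.
Implicit Types (f g h G : R -> R) (F A : R -> R -> R) (x y z s t c d p q : R) (k : nat).
Notation mu := (@lebesgue_measure R).
Local Notation Integrable f := (mu.-integrable setT (EFin \o f)).
Local Notation Pb := (@bounded_continuous R).
Local Notation Pi := (@integrable_bounded R).

(** Two-sided in time even at t = 0, which is possible because the explicit formulas remain valid at
    slightly negative times. *)
Definition jcont F t x := F q.1 q.2 @[q --> (t, x)] --> F t x.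

Lemma jcontP F t x : jcont F t x <-> forall e : R, 0 < e -> exists2 d : R, 0 < d &
  forall s y, `|s - t| < d -> `|y - x| < d -> `|F s y - F t x| < e.
Proof.
split=> [/cvgrPdist_lt H e e0|H].
- have /nbhs_ballP[d /= d0 Hd] := H e e0; exists d => // s y std yxd.
  by have := Hd (s, y); rewrite /= distrC; apply=> //; split; rewrite /ball/= distrC.
- apply/cvgrPdist_lt => e e0; have [d d0 Hd] := H e e0.
  suff : nbhs ((t, x) : R * R) [set q : R * R | `|F t x - F q.1 q.2| < e] by [].
  apply/nbhs_ballP; exists d => //= -[s y] [/= std yxd].
  by rewrite distrC; apply: Hd => //; rewrite distrC.
Qed.

Lemma jcontD F A t x : jcont F t x -> jcont A t x -> jcont (fun t x => F t x + A t x) t x.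
Proof. by move=> HF HA; exact: cvgD. Qed.

Lemma jcontM F A t x : jcont F t x -> jcont A t x -> jcont (fun t x => F t x * A t x) t x.
Proof. by move=> HF HA; exact: cvgM. Qed.

Lemma jcont_cst c t x : jcont (fun _ _ => c) t x.
Proof. exact: cvg_cst. Qed.

Lemma jcont_fst t x : jcont (fun t _ => t) t x.
Proof. exact: cvg_fst. Qed.

Lemma jcont_snd f t x : {for x, continuous f} -> jcont (fun _ x => f x) t x.
Proof. by move=> cf; apply: (cvg_comp _ _ (@cvg_snd _ _ (nbhs t) (nbhs x) _) cf). Qed.

Lemma jcont_comp1 f F t x : {for F t x, continuous f} -> jcont F t x ->
  jcont (fun t x => f (F t x)) t x.
Proof. by move=> cf HF; apply: (cvg_comp _ _ HF cf). Qed.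

Lemma jcont_comp F A t x : jcont F t (A t x) -> jcont A t x -> jcont (fun t x => F t (A t x)) t x.
Proof.
move=> /jcontP HF /jcontP HA; apply/jcontP => e e0; have [d d0 Hd] := HF e e0.
have [d' d'0 Hd'] := HA d d0; exists (Num.min d d'); first by rewrite lt_min d0.
by move=> s y; rewrite !lt_min => /andP[s1 s2] /andP[y1 y2]; apply: Hd => //; exact: Hd'.
Qed.

Lemma continuous_before_jc (T : \bar R) F :
  (forall t x, before T t -> jcont F t x) -> continuous_before T F.
Proof.
move=> H; apply/continuous_beforeP => t x tT e e0.
have [d d0 Hd] := (jcontP F t x).1 (H t x tT) e e0.
by exists d => // s y _; exact: Hd.
Qed.

Lemma jcont_near F A t x d : 0 < d -> (forall s y, `|s - t| < d -> F s y = A s y) ->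
  jcont F t x -> jcont A t x.
Proof.
move=> d0 FA /jcontP H; apply/jcontP => e e0; have [d' d'0 Hd] := H e e0.
exists (Num.min d d'); first by rewrite lt_min d0.
move=> s y; rewrite !lt_min => /andP[s1 s2] /andP[_ y2].
by rewrite -!FA ?subrr ?normr0//; exact: Hd.
Qed.

Lemma prim_lipschitz A (A' : R -> R -> R) G t s x :
  (forall u y, Num.min t s <= u <= Num.max t s -> is_derive u (1 : R) (A^~ y) (A' u y)) ->
  (forall u y, Num.min t s <= u <= Num.max t s -> `|A' u y| <= G y) ->
  Integrable (A s) -> Integrable (A t) -> Integrable G ->
  `|prim (A s) x - prim (A t) x| <= `|s - t| * \int[mu]_(y in setT) G y.
Proof.
move=> dA A'G Asi Ati Gi.
have Ati' : mu.-integrable `]-oo, x] (EFin \o A t) by apply: integrableS Ati.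
have Asi' : mu.-integrable `]-oo, x] (EFin \o A s) by apply: integrableS Asi.
rewrite /prim -RintegralB// -/(prim (fun y => A s y - A t y) x).
rewrite (le_trans (prim_bounded _ (integrableT_B Asi Ati)))// -RintegralZl//.
apply: le_Rintegral => //.
- by apply: integrableT_norm; exact: integrableT_B.
- exact: integrableT_Zl.
- move=> y _; rewrite mulrC.
  apply: (@is_derive1_lipschitz _ (A^~ y) (A'^~ y)) => u tsu; exact: A'G.
Qed.

(** A dominating function [G] common to all times near [t] gives differentiation under the integral.
    It also makes the integral Lipschitz in time uniformly in x, so joint continuity reduces to
    continuity in x at the fixed time [t]. *)
Lemma prim_family A (A' : R -> R -> R) G t d : 0 < d ->
  (forall s y, `|s - t| < d -> is_derive s (1 : R) (A^~ y) (A' s y)) ->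
  (forall s, `|s - t| < d -> Integrable (A s)) -> Integrable G ->
  (forall s y, `|s - t| < d -> `|A' s y| <= G y) ->
  (forall x, is_derive t (1 : R) (fun s => prim (A s) x) (prim (A' t) x)) /\
  (forall x, jcont (fun s x => prim (A s) x) t x).
Proof.
move=> d0 dA Ai Gi A'G.
have G0 y : 0 <= G y by apply: le_trans (A'G t y _); rewrite ?subrr ?normr0.
split=> x.
- have mI : measurable (`]-oo, x]%classic : set (measurableTypeR R)) by exact: measurable_itv.
  have It : (`](t - d), (t + d)[%classic : set R) t by rewrite /= in_itv/=; lra.
  have Id s : (`](t - d), (t + d)[%classic : set R) s -> `|s - t| < d.
    by rewrite /= in_itv/= ltr_norml; lra.
  have Ais s : (`](t - d), (t + d)[%classic : set R) s -> mu.-integrable `]-oo, x] (EFin \o A s).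
    by move=> /Id sd; apply: integrableS (Ai s sd).
  have dAs s y : (`](t - d), (t + d)[%classic : set R) s -> `]-oo, x]%classic y -> derivable (A^~ y) s 1.
    by move=> /Id sd _; case: (dA s y sd).
  have Gix : mu.-integrable `]-oo, x] (EFin \o G) by apply: integrableS Gi.
  have GA s y : (`](t - d), (t + d)[%classic : set R) s -> `]-oo, x]%classic y ->
      `|partial1of2 A s y| <= G y.
    move=> /Id sd _; rewrite /partial1of2 derive1E.
    have [_ ->] := dA s y sd; exact: A'G.
  have := cvg_differentiation_under_integral mI It Ais dAs G0 Gix GA.
  move=> H; apply/is_derive1P; have -> : prim (A' t) x = \int[mu]_(y in `]-oo, x]) partial1of2 A t y.
    apply: eq_Rintegral => y _; rewrite /partial1of2 derive1E.
    by have [|_ ->//] := dA t y _; rewrite subrr normr0.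
  apply: cvg_trans H; apply: near_eq_cvg; apply: nearW => h.
  by rewrite /GRing.scale/= [h + t]addrC.
- have tt : `|t - t| < d by rewrite subrr normr0.
  have Ait := Ai t tt.
  apply/jcontP => e e0; pose K := \int[mu]_(y in setT) G y + 1.
  have K0 : 0 < K by rewrite ltr_wpDl// Rintegral_ge0.
  have cp := @prim_continuous _ _ Ait x.
  have e20 : 0 < e / 2 by rewrite divr_gt0.
  have /cvgrPdist_lt/(_ _ e20)/nbhs_ballP[d' /= d'0 Hd'] := cp.
  exists (Num.min (Num.min d d') (e / 2 / K)); first by rewrite !lt_min d0 d'0 divr_gt0.
  move=> s y; rewrite !lt_min => /andP[/andP[sd sd'] sK] /andP[/andP[yd yd'] _].
  have yx : `|prim (A t) x - prim (A t) y| < e / 2 by apply: Hd'; rewrite /ball/= distrC.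
  rewrite (_ : _ - _ = prim (A s) y - prim (A t) y + (prim (A t) y - prim (A t) x)); last by ring.
  rewrite (le_lt_trans (ler_normD _ _))// [ltRHS](splitr e) ltr_leD//; last by rewrite distrC ltW.
  have near_t u : Num.min t s <= u <= Num.max t s -> `|u - t| < d.
    move=> /andP[]; have := sd; rewrite !ltr_norml => /andP[s1 s2].
    by case: (leP t s) => ts; rewrite ?(min_l ts) ?(max_r ts) ?(min_r (ltW ts)) ?(max_l (ltW ts)); lra.
  have := @prim_lipschitz A A' G t s y.
  move=> /(_ (fun u y tu => dA u y (near_t u tu)) (fun u y tu => A'G u y (near_t u tu)) (Ai s sd) Ait Gi).
  move=> /le_lt_trans; apply.
  move: sK; rewrite ltr_pdivlMr// => /(le_lt_trans _); apply.
  by rewrite ler_wpM2l// lerDl.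
Qed.

End explicit_family.

(** * The explicit flow and its time derivatives *)

Section explicit_flow_analysis.
Context {R : realType}.
Implicit Types (f g h G : R -> R) (x y z s t c d p q : R) (k : nat).
Notation mu := (@lebesgue_measure R).
Local Notation Integrable f := (mu.-integrable setT (EFin \o f)).
Local Notation Pb := (@bounded_continuous R).
Local Notation Pi := (@integrable_bounded R).
Variables (r : R) (w : R -> R).
Hypothesis r0 : r != 0.
Hypothesis sw : smooth Pi w.

Definition stretch t y : R := t * w y / r + 1.

(** Uniform rather than pointwise positivity: it is an open condition on [t] and bounds the powers
    of [stretch] of either sign. *)
Definition good t := exists2 c : R, 0 < c & forall y, c <= stretch t y.

(** A family closed under time differentiation, which maps (k, p) to p / r times (k + 1, p - 1). At
    least one factor [w] is present, hence integrability. The case (0, r - 1) is the mixed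
    derivative of the flow. *)
Definition sterm k p t y : R := w y ^+ k.+1 * stretch t y `^ p.

(** Convertible to [explicit_flow] when [w] is [derive1 u0]. *)
Definition lflow t x : R := x + prim (fun y => stretch t y `^ r - 1) x.

Lemma w_bounded : exists2 W : R, 0 < W & forall y, `|w y| <= W.
Proof.
have [[_ [M HM]] _] := smooth_base sw; exists (`|M| + 1); first by rewrite ltr_wpDl.
by move=> y; rewrite (le_trans (HM y))// (le_trans (ler_norm _))// lerDl.
Qed.

Lemma good_bounds t : good t -> exists d c C : R, [/\ 0 < d, 0 < c &
  forall s y, `|s - t| < d -> c <= stretch s y <= C].
Proof.
move=> [c c0 Hc]; have [W W0 HW] := w_bounded.
pose V := W / `|r|; have V0 : 0 < V by rewrite divr_gt0// normr_gt0.
have HV y : `|w y / r| <= V by rewrite normrM normfV ler_wpM2r// invr_ge0.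
(* [V] bounds |w / r|, so a time shift below c / (2V) changes [stretch] by at most c / 2; the cap 1
   gives |s| <= |t| + 1 for the upper bound. *)
exists (Num.min 1 (c / (2 * V))), (c / 2), ((`|t| + 1) * V + 1); split.
- by rewrite lt_min ltr01 divr_gt0//; exact: mulr_gt0.
- by rewrite divr_gt0.
move=> s y; have V20 : 0 < 2 * V by exact: mulr_gt0.
rewrite lt_min ltr_pdivlMr// => /andP[s1 s2].
have E : stretch s y = stretch t y + (s - t) * (w y / r) by rewrite /stretch; ring.
have st : `|(s - t) * (w y / r)| <= `|s - t| * V by rewrite normrM ler_wpM2l.
have sV : `|s * (w y / r)| <= (`|t| + 1) * V.
  rewrite normrM ler_pM// -[s](subrK t) (le_trans (ler_normD _ _))//; lra.
apply/andP; split.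
  rewrite E; have := Hc y; move: st; rewrite ler_norml => /andP[]; lra.
by rewrite /stretch -mulrA lerD2r (le_trans (ler_norm _)).
Qed.

Lemma good_near t : good t -> exists2 d : R, 0 < d & forall s, `|s - t| < d -> good s.
Proof.
move=> /good_bounds[d [c [C [d0 c0 H]]]]; exists d => // s sd; exists c => // y.
by case/andP: (H s y sd).
Qed.

Lemma good_gt0 t y : good t -> 0 < stretch t y.
Proof. by move=> [c c0 Hc]; exact: lt_le_trans (Hc y). Qed.

Lemma good0 : good 0.
Proof. by exists 1 => // y; rewrite /stretch !mul0r add0r. Qed.

Lemma is_derive_base_t s y : is_derive s (1 : R) (stretch^~ y) (w y / r).
Proof.
have -> : stretch^~ y = (fun s => (w y / r) * s + 1) by apply/funext => u; rewrite /stretch; ring.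
have := is_derive1D (is_derive1Zl (w y / r) (is_derive1_id s)) (is_derive1_cst 1 s).
by move/is_derive_eq; apply; rewrite addr0 mulr1.
Qed.

Lemma smooth_baset t : smooth Pb (stretch t).
Proof.
have -> : stretch t = (fun y => (w y * (t / r)) + 1) by apply/funext => u; rewrite /stretch; ring.
apply: smoothD; [exact: bounded_continuousD| |exact: smooth_bounded_cst].
apply: smooth_boundedM; first exact: smooth_integrable_bounded.
exact: smooth_bounded_cst.
Qed.

Lemma smooth_base_powR t p : good t -> smooth Pb (fun y => stretch t y `^ p).
Proof. by move=> [c c0 Hc]; exact: (smooth_powR p c0 Hc (smooth_baset t)). Qed.

Lemma smooth_term k p t : good t -> smooth Pi (sterm k p t).
Proof.
move=> gt; apply: smooth_integrableM; last exact: smooth_base_powR.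
elim: k => [|k IH]; first exact: sw.
have -> : (fun x => w x ^+ k.+2) = (fun x => w x ^+ k.+1 * w x).
  by apply/funext => x; rewrite exprSr.
by apply: smooth_integrableM => //; exact: smooth_integrable_bounded.
Qed.

Lemma is_derive_base_y t y : is_derive y (1 : R) (stretch t) (t / r * derive1 w y).
Proof.
have -> : stretch t = (fun y => (t / r * w y) + 1) by apply/funext => u; rewrite /stretch; ring.
have := is_derive1D (is_derive1Zl (t / r) (smooth_is_derive y sw)) (is_derive1_cst 1 y).
by move/is_derive_eq; apply; rewrite addr0.
Qed.

(** The mean value inequality between 1 and [a], hence the minimum and maximum with 1. It makes the
    flow integrand O(|w|), which is where its integrability comes from. *)
Lemma powR_sub1_bound a c C p : 0 < c -> c <= a <= C ->
  `|a `^ p - 1| <= `|p| * (Num.min c 1 `^ (p - 1) + Num.max C 1 `^ (p - 1)) * `|a - 1|.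
Proof.
move=> c0 /andP[ca aC]; set c1 := Num.min c 1; set C1 := Num.max C 1.
have c10 : 0 < c1 by rewrite lt_min c0 ltr01.
have := @is_derive1_lipschitz _ (fun a => a `^ p) (fun a => p * a `^ (p - 1))
  (`|p| * (c1 `^ (p - 1) + C1 `^ (p - 1))) 1 a.
rewrite powR1; apply=> b.
- by move=> /andP[hb _]; apply: is_derive1_powR; apply: lt_le_trans hb; rewrite lt_min ltr01 (lt_le_trans c0).
- move=> /andP[b1 b2]; rewrite normrM ler_wpM2l// ger0_norm ?powR_ge0//.
  apply: powR_bound => //; apply/andP; split.
    by apply: le_trans b1; rewrite le_min ge_min lexx orbT/= ge_min ca.
  by apply: (le_trans b2); rewrite ge_max le_max lexx orbT/= le_max aC.
Qed.

(** Stated for a general [f] because it also serves for a truncation of [stretch], at the time when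
    [stretch] reaches 0. *)
Lemma integrable_powR_sub1 (f : R -> R) c C p (K : R) : 0 < c ->
  (forall y, c <= f y <= C) -> Integrable w -> continuous (fun y => f y `^ p - 1) ->
  (forall y, `|f y - 1| <= K * `|w y|) -> Integrable (fun y => f y `^ p - 1).
Proof.
move=> c0 fcC iw cf fK.
pose L := `|p| * (Num.min c 1 `^ (p - 1) + Num.max C 1 `^ (p - 1)) * K.
apply: (integrableT_le (integrableT_Zl L (integrableT_norm iw))).
  exact: continuous_measurable_fun.
move=> y; apply: le_trans (powR_sub1_bound p c0 (fcC y)) _.
rewrite (le_trans _ (ler_norm _))// /L -[leRHS]mulrA ler_wpM2l//.
by rewrite mulr_ge0// addr_ge0 ?powR_ge0.
Qed.

Lemma smooth_flow_integrand t : good t -> smooth Pi (fun y => stretch t y `^ r - 1).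
Proof.
move=> gt; have sp : smooth Pb (fun y => stretch t y `^ r - 1).
  apply: smoothD; [exact: bounded_continuousD|exact: smooth_base_powR|exact: smooth_bounded_cst].
have ip : Integrable (fun y => stretch t y `^ r - 1).
  have [d [c [C [d0 c0 H]]]] := good_bounds gt.
  have [[_ iw] [csp _]] := (smooth_base sw, smooth_base sp).
  apply: (integrable_powR_sub1 (K := `|t / r|) (c := c) (C := C)) => // y.
    by apply: H; rewrite subrr normr0.
  by rewrite (_ : stretch t y - 1 = (t / r) * w y) ?normrM// /stretch; ring.
case=> [|n]; first by split=> //; split=> //; exact: smooth_base sp.
split; first by split=> //; exact: smooth_base sp.
exists (fun y => (t / r * derive1 w y) * (r * stretch t y `^ (r - 1))).
  move=> y; have := is_derive1B (is_derive1_powR_comp r (good_gt0 y gt) (is_derive_base_y t y))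
    (is_derive1_cst 1 y).
  by move/is_derive_eq; apply; rewrite subr0.
apply: smooth_integrableM.
  rewrite (_ : (fun x => _) = (fun x => derive1 w x * (t / r))); last by apply/funext => ?; rewrite mulrC.
  by apply: smooth_integrableM; [exact: smooth_derive1|exact: smooth_bounded_cst].
by apply: smooth_boundedM; [exact: smooth_bounded_cst|exact: smooth_base_powR].
Qed.

Lemma term_bound k p t : good t -> exists d K : R, 0 < d /\
  forall s y, `|s - t| < d -> `|sterm k p s y| <= K * `|w y|.
Proof.
move=> /good_bounds[d [c [C [d0 c0 H]]]]; have [W W0 HW] := w_bounded.
exists d, (W ^+ k * (c `^ p + C `^ p)); split=> // s y sd.
rewrite /sterm normrM normrX exprSr -[leLHS]mulrA [_ * `|stretch s y `^ p|]mulrC mulrA.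
rewrite ler_wpM2r//; apply: ler_pM => //.
  by rewrite lerXn2r ?nnegrE// ltW.
by rewrite ger0_norm ?powR_ge0//; apply: powR_bound => //; exact: H.
Qed.

Lemma term_family k p t : good t ->
  (forall x, is_derive t (1 : R) (fun s => prim (sterm k p s) x) (p / r * prim (sterm k.+1 (p - 1) t) x)) /\
  (forall x, jcont (fun s x => prim (sterm k p s) x) t x).
Proof.
move=> gt; have [d1 d10 Hd1] := good_near gt.
have [d2 [K [d20 HK]]] := term_bound k.+1 (p - 1) gt.
have [_ wi] := smooth_base sw.
have E x : p / r * prim (sterm k.+1 (p - 1) t) x = prim (fun y => p / r * sterm k.+1 (p - 1) t y) x.
  rewrite /prim RintegralZl//.
  by have [_ i] := smooth_base (smooth_term k.+1 (p - 1) gt); apply: integrableS i.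
have [|||||H1 H2] := @prim_family _ (sterm k p) (fun s y => p / r * sterm k.+1 (p - 1) s y)
    (fun y => `|p / r| * K * `|w y|) t (Num.min d1 d2).
- by rewrite lt_min d10.
- move=> s y; rewrite lt_min => /andP[/Hd1 gs _]; rewrite /sterm.
  have := is_derive1Zl (w y ^+ k.+1)
    (@is_derive1_powR_comp _ (stretch^~ y) p s _ (good_gt0 y gs) (is_derive_base_t s y)).
  by move/is_derive_eq; apply; rewrite [w y ^+ k.+2]exprSr; ring.
- by move=> s; rewrite lt_min => /andP[/Hd1 gs _]; have [] := smooth_base (smooth_term k p gs).
- by apply: integrableT_Zl; exact: integrableT_norm.
- by move=> s y; rewrite lt_min => /andP[_ sd]; rewrite normrM -mulrA ler_wpM2l// HK.
by split=> // x; rewrite E.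
Qed.

Lemma flow_family t : good t ->
  (forall x, is_derive t (1 : R) (lflow^~ x) (prim (sterm 0 (r - 1) t) x)) /\
  (forall x, jcont lflow t x).
Proof.
move=> gt; have [d1 d10 Hd1] := good_near gt.
have [d2 [K [d20 HK]]] := term_bound 0 (r - 1) gt.
have [_ wi] := smooth_base sw.
have [|||||H1 H2] := @prim_family _ (fun t y => stretch t y `^ r - 1) (sterm 0 (r - 1))
    (fun y => K * `|w y|) t (Num.min d1 d2).
- by rewrite lt_min d10.
- move=> s y; rewrite lt_min => /andP[/Hd1 gs _].
  have := is_derive1B
    (@is_derive1_powR_comp _ (stretch^~ y) r s _ (good_gt0 y gs) (is_derive_base_t s y))
    (is_derive1_cst 1 s).
  move/is_derive_eq; apply; rewrite subr0 /sterm expr1; field; exact: r0.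
- by move=> s; rewrite lt_min => /andP[/Hd1 gs _]; have [] := smooth_base (smooth_flow_integrand gs).
- by apply: integrableT_Zl; exact: integrableT_norm.
- by move=> s y; rewrite lt_min => /andP[_ sd]; rewrite HK.
split=> x.
  by have /is_derive_eq := is_derive1D (is_derive1_cst x t) (H1 x); apply; rewrite add0r.
by apply: jcontD; [apply: jcont_snd; exact: cvg_id|exact: H2].
Qed.

Lemma jcont_base_powR p t y : good t -> jcont (fun t y => stretch t y `^ p) t y.
Proof.
move=> gt; apply: (@jcont_comp1 _ (fun a => a `^ p)).
  by apply: is_derive1_continuous; apply: is_derive1_powR; exact: good_gt0.
have [[cw _] _] := smooth_base sw.
apply: jcontD; last exact: jcont_cst.
apply: jcontM; last exact: jcont_cst.
by apply: jcontM; [exact: jcont_fst|apply: jcont_snd; exact: cw].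
Qed.

Lemma is_derive_flow t x : good t -> is_derive x (1 : R) (lflow t) (stretch t x `^ r).
Proof.
move=> gt; have [[ci _] i] := smooth_base (smooth_flow_integrand gt).
have := is_derive1D (is_derive1_id x) (is_derive_prim i (ci x)).
by move/is_derive_eq; apply; rewrite addrC subrK.
Qed.

Lemma powR_lower a c C p : 0 < c -> c <= a <= C -> (c `^ (- p) + C `^ (- p))^-1 <= a `^ p.
Proof.
move=> c0 caC; have a0 : 0 < a by case/andP: caC => /(lt_le_trans c0).
have -> : a `^ p = (a `^ (- p))^-1 by rewrite powRN invrK.
rewrite lef_pV2 ?posrE ?powR_gt0//; last first.
  by rewrite ltr_wpDr ?powR_ge0// powR_gt0.
exact: powR_bound.
Qed.

Lemma flow_bounds t : good t -> exists d c C : R, [/\ 0 < d, 0 < c &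
  forall s y, `|s - t| < d -> c <= stretch s y `^ r <= C].
Proof.
move=> /good_bounds[d [c [C [d0 c0 H]]]].
exists d, (c `^ (- r) + C `^ (- r))^-1, (c `^ r + C `^ r); split=> //.
  by rewrite invr_gt0 ltr_wpDr ?powR_ge0// powR_gt0.
by move=> s y sd; rewrite powR_lower ?powR_bound ?H.
Qed.

End explicit_flow_analysis.

(** * The Eulerian velocity of the explicit flow *)

Section explicit_solution_analysis.
Context {R : realType}.
Implicit Types (f g h G : R -> R) (x y z s t c d p q : R) (k : nat).
Notation mu := (@lebesgue_measure R).
Local Notation Integrable f := (mu.-integrable setT (EFin \o f)).
Local Notation Pb := (@bounded_continuous R).
Local Notation Pi := (@integrable_bounded R).
Variables (r : R) (w : R -> R).
Hypothesis r0 : r != 0.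
Hypothesis sw : smooth Pi w.
Local Notation base := (stretch r w).
Local Notation good := (good r w).
Local Notation term := (sterm r w).
Local Notation flow := (lflow r w).

(** The Lagrangian label of the particle found at a given place at time [t]; composing the time
    derivative of the flow with it gives [velocity]. *)
Definition label t := pinv setT (flow t).
Definition velocity t x : R := prim (term 0 (r - 1) t) (label t x).

Lemma cvg_base_powR (F : set_system R) {FF : Filter F} t p : w x @[x --> F] --> (0 : R) ->
  base t x `^ p @[x --> F] --> (1 : R).
Proof.
move=> wF; suff : base t x `^ p @[x --> F] --> 1 `^ p by rewrite powR1.
have c1 : {for (1 : R), continuous (fun a : R => a `^ p)}.
  by apply: is_derive1_continuous; apply: is_derive1_powR.
apply: (@cvg_comp _ _ _ (base t) (fun a => a `^ p) _ _ _ _ c1).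
suff : base t x @[x --> F] --> t * 0 / r + 1 by rewrite mulr0 mul0r add0r.
by apply: cvgD; [apply: cvgM; [apply: cvgM; [exact: cvg_cst|]|exact: cvg_cst]|exact: cvg_cst].
Qed.

Section good_time.
Variable t : R.
Hypothesis gt : good t.

Let dflow x : is_derive x (1 : R) (flow t) (base t x `^ r).
Proof. exact: is_derive_flow. Qed.

Let bounds : exists c C : R, 0 < c /\ forall x, c <= base t x `^ r <= C.
Proof.
have [d [c [C [d0 c0 H]]]] := flow_bounds r0 sw gt.
by exists c, C; split=> // x; apply: H; rewrite subrr normr0.
Qed.

Lemma psiK x : label t (flow t x) = x.
Proof. by have [c [C [c0 H]]] := bounds; exact: (diffeoK dflow c0 H). Qed.

Lemma psiKV x : flow t (label t x) = x.
Proof. by have [c [C [c0 H]]] := bounds; exact: (diffeoKV dflow c0 H). Qed.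

Lemma is_derive_psi_flow x : is_derive x (1 : R) (label t) (base t (label t x) `^ (- r)).
Proof.
have [c [C [c0 H]]] := bounds.
by rewrite powRN; exact: (is_derive_psi dflow c0 H).
Qed.

Lemma psi_cvgNy : label t x @[x --> -oo] --> -oo.
Proof. by have [c [C [c0 H]]] := bounds; exact: (diffeo_psi_cvgNy dflow c0 H). Qed.

Lemma smooth_psi h : smooth Pi h -> smooth Pi (fun x => h (label t x)).
Proof.
move=> sh; have [c [C [c0 H]]] := bounds; have [wNy wy] := smooth_integrable_cvg sw.
apply: (diffeo_smooth dflow c0 H) => //.
- by have [] := smooth_base (smooth_base_powR sw r gt).
- by apply/cvg_ex; exists 1; exact: cvg_base_powR.
- by apply/cvg_ex; exists 1; exact: cvg_base_powR.
- rewrite (_ : (fun x => _) = (fun x => base t x `^ (- r))); last by apply/funext => x; rewrite powRN.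
  exact: smooth_base_powR.
Qed.

Lemma is_derive_comp_psi h (h' : R) x : is_derive (label t x) (1 : R) h h' ->
  is_derive x (1 : R) (fun x => h (label t x)) (h' * base t (label t x) `^ (- r)).
Proof.
move=> dh; apply: (is_derive_eq (is_derive1_chain dh (is_derive_psi_flow x))).
by rewrite mulrC.
Qed.

Lemma base_powRD p q y : base t y `^ (p + q) = base t y `^ p * base t y `^ q.
Proof. by rewrite powRD// (gt_eqF (good_gt0 y gt)) implybT. Qed.

Lemma base_powRS p y : base t y `^ (p + 1) = base t y `^ p * base t y.
Proof. by rewrite base_powRD powRr1// (ltW (good_gt0 y gt)). Qed.

(* u_x, u_xx and u_xxx in the Lagrangian coordinate y *)
Definition q1 t y : R := w y * base t y `^ (- 1).
Definition q2 t y : R := derive1 w y * base t y `^ (- 2 - r).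
Definition q3 t y : R := (derive1 (derive1 w) y * base t y `^ (- 2 - r)
  + derive1 w y * ((t / r * derive1 w y) * ((- 2 - r) * base t y `^ (- 2 - r - 1)))) * base t y `^ (- r).

Lemma is_derive_prim_term k p x :
  is_derive x (1 : R) (fun x => prim (term k p t) (label t x))
    (w (label t x) ^+ k.+1 * base t (label t x) `^ (p - r)).
Proof.
have [[c _] i] := smooth_base (smooth_term sw k p gt).
have := is_derive_comp_psi (is_derive_prim i (c (label t x))).
by move/is_derive_eq; apply; rewrite base_powRD mulrA.
Qed.

Lemma is_derive_vel x : is_derive x (1 : R) (velocity t) (q1 t (label t x)).
Proof.
have := is_derive_prim_term 0 (r - 1) x; move/is_derive_eq; apply.
by rewrite expr1 /q1; congr (_ * _ `^ _); ring.
Qed.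

Lemma is_derive_ux x : is_derive x (1 : R) (fun x => q1 t (label t x)) (q2 t (label t x)).
Proof.
set y := label t x.
have := is_derive1M (smooth_is_derive y sw)
  (is_derive1_powR_comp (- 1) (good_gt0 y gt) (is_derive_base_y r sw t y)).
move/is_derive_comp_psi/is_derive_eq; apply.
rewrite /q2 -/y [base t y `^ (- 2 - r)]base_powRD [RHS]mulrA; congr (_ * _).
(* With b the base, the y-derivative of w / b is w' b^(-2) (b - t w / r), and the last factor is
   1. *)
have -> : base t y `^ (- 1) = base t y `^ (- 2) * base t y.
  by rewrite -base_powRS; congr (_ `^ _); ring.
have -> : - 1 - 1 = - 2 :> R by ring.
set b := base t y `^ (- 2); rewrite /stretch.
by field.
Qed.

Lemma is_derive_uxx x : is_derive x (1 : R) (fun x => q2 t (label t x)) (q3 t (label t x)).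
Proof.
set y := label t x; have sw' := smooth_derive1 sw.
have := is_derive1M (smooth_is_derive y sw')
  (is_derive1_powR_comp (- 2 - r) (good_gt0 y gt) (is_derive_base_y r sw t y)).
by move/is_derive_comp_psi.
Qed.

Lemma derive1_vel : derive1 (velocity t) = (fun x => q1 t (label t x)).
Proof. exact: derive1_of is_derive_vel. Qed.

Lemma derive1n2_vel : derive1n 2 (velocity t) = (fun x => q2 t (label t x)).
Proof. by rewrite /derive1n/= derive1_vel; exact: derive1_of is_derive_ux. Qed.

Lemma derive1n3_vel : derive1n 3 (velocity t) = (fun x => q3 t (label t x)).
Proof. by rewrite derive1nS derive1n2_vel; exact: derive1_of is_derive_uxx. Qed.

Lemma vel_g_minfty : g_minfty (velocity t).
Proof.
split.
- by move=> x; case: (is_derive_vel x).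
- rewrite derive1_vel; apply: smooth_sobolev1_oo; apply: smooth_psi.
  have -> : q1 t = term 0 (- 1) t by apply/funext => y; rewrite /sterm expr1.
  exact: smooth_term.
- have [_ i] := smooth_base (smooth_term sw 0 (r - 1) gt).
  exact: (cvg_comp _ _ psi_cvgNy (prim_cvgNy i)).
Qed.

Lemma flow_Diff_minfty : Diff_minfty (flow t).
Proof.
have si := smooth_flow_integrand r0 sw gt; have [[ci _] i] := smooth_base si.
have E : (fun x => flow t x - x) = prim (fun y => base t y `^ r - 1).
  by apply/funext => x; rewrite /lflow addrC addKr.
have d x := is_derive_prim i (ci x).
rewrite /Diff_minfty /= E; split.
- by move=> x; case: (d x).
- by rewrite (derive1_of d); exact: smooth_sobolev1_oo.
- by move=> x; rewrite (derive1_of d) ltrDr powR_gt0//; exact: good_gt0.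
- exact: prim_cvgNy.
Qed.

(** With [c] a lower bound of the flow derivative common to all s near [t], c |label s y - label t
    x| <= |y - flow s (label t x)|; the right side tends to 0 by joint continuity of the flow. *)
Lemma jcont_psi x : jcont label t x.
Proof.
apply/jcontP => e e0.
have [d1 d10 Hd1] := good_near r0 sw gt.
have [d [c [C [d0 c0 H]]]] := flow_bounds r0 sw gt.
have ce0 : 0 < c * e / 2 by rewrite divr_gt0// mulr_gt0.
have [d2 d20 Hd2] := (jcontP flow t (label t x)).1 ((flow_family r0 sw gt).2 _) _ ce0.
exists (Num.min (Num.min d1 d) (Num.min d2 (c * e / 2))); first by rewrite !lt_min d10 d0 d20.
move=> s y; rewrite !lt_min => /andP[/andP[s1 s2] /andP[s3 _]] /andP[_ /andP[_ y4]].
have gs := Hd1 s s1.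
have := diffeo_dist (fun x => is_derive_flow r0 sw x gs) c0 (fun x => H s x s2) (label t x) (label s y).
have -> : flow s (label s y) = y.
  exact: (diffeoKV (fun x => is_derive_flow r0 sw x gs) c0 (fun x => H s x s2)).
have := Hd2 s (label t x) s3; rewrite subrr normr0 => /(_ d20).
rewrite psiKV => h1 h2.
rewrite -(ltr_pM2l c0); apply: le_lt_trans h2 _.
rewrite (_ : y - _ = (y - x) - (flow s (label t x) - x)); last by ring.
by rewrite (le_lt_trans (ler_normB _ _))//; lra.
Qed.

Lemma jcont_comp_psi (F : R -> R -> R) x : (forall y, jcont F t y) -> jcont (fun t x => F t (label t x)) t x.
Proof. by move=> HF; apply: jcont_comp; [exact: HF|exact: jcont_psi]. Qed.

Lemma jcont_vel x : jcont velocity t x.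
Proof.
apply: (@jcont_comp_psi (fun t => prim (term 0 (r - 1) t))) => y.
by have [_] := term_family r0 sw 0 (r - 1) gt; apply.
Qed.

Let jcont_smooth f y : smooth Pi f -> jcont (fun _ y => f y) t y.
Proof. by move=> sf; apply: jcont_snd; have [[cf _] _] := smooth_base sf; exact: cf. Qed.

Lemma jcont_q1 x : jcont (fun t x => q1 t (label t x)) t x.
Proof.
apply: jcont_comp_psi => y; apply: jcontM; [exact: jcont_smooth|exact: jcont_base_powR].
Qed.

Lemma jcont_q2 x : jcont (fun t x => q2 t (label t x)) t x.
Proof.
apply: jcont_comp_psi => y; apply: jcontM; last exact: jcont_base_powR.
by apply: jcont_smooth; exact: smooth_derive1.
Qed.

Lemma jcont_q3 x : jcont (fun t x => q3 t (label t x)) t x.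
Proof.
have sw' := smooth_derive1 sw; have sw'' := smooth_derive1 sw'.
apply: jcont_comp_psi => y; apply: jcontM; last exact: jcont_base_powR.
apply: jcontD; apply: jcontM; [exact: jcont_smooth|exact: jcont_base_powR|exact: jcont_smooth|].
apply: jcontM; last by apply: jcontM; [exact: jcont_cst|exact: jcont_base_powR].
by apply: jcontM; [apply: jcontM; [exact: jcont_fst|exact: jcont_cst]|exact: jcont_smooth].
Qed.

End good_time.

End explicit_solution_analysis.

(** * The explicit velocity solves both forms of the equation *)

Section existence.
Context {R : realType}.
Implicit Types (x y z s t c d p q : R) (T : \bar R).
Notation mu := (@lebesgue_measure R).
Local Notation Pb := (@bounded_continuous R).
Local Notation Pi := (@integrable_bounded R).

Lemma eq_of_is_derive_cvgNy (f g k : R -> R) :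
  (forall x, is_derive x (1 : R) f (k x)) -> (forall x, is_derive x (1 : R) g (k x)) ->
  f x @[x --> -oo] --> (0 : R) -> g x @[x --> -oo] --> (0 : R) -> f = g.
Proof.
move=> df dg f0 g0; apply/funext => x; apply/eqP; rewrite -subr_eq0; apply/eqP.
have dfg y : is_derive y (1 : R) (fun y => f y - g y) 0.
  by have /is_derive_eq := is_derive1B (df y) (dg y); apply; rewrite subrr.
have : (f y - g y) @[y --> -oo] --> (0 : R) by rewrite -[X in _ --> X](subrr 0); exact: cvgB.
have -> : (fun y => f y - g y) = (fun=> f x - g x).
  by apply/funext => y; exact: (is_derive_0_is_cst y x dfg).
by move/cvg_unique => /(_ (@norm_hausdorff _ _) (f x - g x)) <- //; exact: cvg_cst.
Qed.

Lemma g_minfty_smooth (u : R -> R) : g_minfty u ->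
  [/\ smooth Pi (derive1 u), forall x, is_derive x (1 : R) u (derive1 u x) & u = prim (derive1 u)].
Proof.
move=> [du su uNy]; have sm := sobolev1_oo_smooth su.
have d x : is_derive x (1 : R) u (derive1 u x) by exact: derivable_is_derive1.
split=> //; have [[cu _] iu] := smooth_base sm.
apply: (eq_of_is_derive_cvgNy d _ uNy (prim_cvgNy iu)) => x.
by apply: is_derive_prim => //; exact: cu.
Qed.

Variables (r : R) (u0 : R -> R).
Hypothesis r0 : r != 0.
Hypothesis hu0 : g_minfty u0.
Let w : R -> R := derive1 u0.
Let sw : smooth Pi w. Proof. by have [] := g_minfty_smooth hu0. Qed.
Let u0E : u0 = prim w. Proof. by have [] := g_minfty_smooth hu0. Qed.
Local Notation base := (stretch r w).
Local Notation good := (good r w).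
Local Notation flow := (lflow r w).
Local Notation vel := (velocity r w).
Local Notation psi := (label r w).

Lemma flow0 x : flow 0 x = x.
Proof.
rewrite /lflow (_ : (fun y => _) = (fun=> 0)); last first.
  by apply/funext => y; rewrite /stretch !mul0r add0r powR1 subrr.
by rewrite /prim /Rintegral integral0 addr0.
Qed.

Lemma vel0 x : vel 0 x = u0 x.
Proof.
have px : psi 0 x = x by rewrite -{1}(flow0 x); apply: psiK => //; exact: good0.
rewrite /velocity px u0E; congr (prim _ x); apply/funext => y.
by rewrite /sterm expr1 /stretch !mul0r add0r powR1 mulr1.
Qed.

Lemma explicit_solutionE t x : good t -> explicit_solution r u0 t x = vel t x.
Proof. by move=> gt; have [_] := (flow_family r0 sw gt).1 (psi t x); rewrite -derive1E. Qed.

Section horizon.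
Variable T : \bar R.
Hypothesis goodT : forall t, before T t -> good t.

Lemma flow_in_Diff_explicit : flow_in_Diff T vel flow.
Proof.
split; first exact: flow0.
  by move=> t /goodT gt; exact: flow_Diff_minfty.
move=> t x /goodT gt; apply: is_derive_tderive.
by have /is_derive_eq := (flow_family r0 sw gt).1 x; apply; rewrite /velocity psiK.
Qed.

Lemma PJ_Lagrangian_explicit : PJ_Lagrangian_solution r^-1 u0 T vel.
Proof.
split; first exact: vel0.
  by move=> t /goodT gt; exact: vel_g_minfty.
(* The time derivative of p_x = b^r, with b = 1 + t w / r, is w b^(r - 1), so that q = w / b. *)
exists flow, (sterm r w 0 (r - 1)).
have dflow t : good t -> derive1 (flow t) = (fun x => base t x `^ r).
  by move=> gt; apply: derive1_of => x; exact: is_derive_flow.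
have dpow p t x : good t ->
    is_derive t (1 : R) (fun s => base s x `^ p) (w x / r * (p * base t x `^ (p - 1))).
  by move=> gt; exact: (@is_derive1_powR_comp _ (base^~ x) p t _ (good_gt0 x gt) (is_derive_base_t r w t x)).
split.
- exact: flow_in_Diff_explicit.
- move=> t x tT; have gt := goodT tT; have [d d0 Hd] := good_near r0 sw gt.
  apply: (@is_tderive_near _ (fun s => base s x `^ r) _ _ _ d) => //; [|exact: tT.1|].
    by move=> s _ /Hd gs; rewrite dflow.
  apply: is_derive_tderive; have /is_derive_eq := dpow r t x gt; apply.
  by rewrite /sterm expr1; field.
- apply: continuous_before_jc => t x /goodT gt; rewrite /sterm.
  apply: jcontM; last exact: jcont_base_powR.
  by apply: (@jcont_snd _ (fun x => w x ^+ 1)); have [[cw _] _] := smooth_base sw; exact: cw.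
move=> q t x tT; have gt := goodT tT; have [d d0 Hd] := good_near r0 sw gt.
have qE s : good s -> q s x = w x * base s x `^ (- 1).
  move=> gs; rewrite /q dflow// /sterm expr1 -mulrA -powRN -base_powRD//.
  by congr (_ * _ `^ _); ring.
exists (w x * (w x / r * (- 1 * base t x `^ (- 1 - 1)))).
  apply: (@is_tderive_near _ (fun s => w x * base s x `^ (- 1)) _ _ _ d) => //; [|exact: tT.1|].
    by move=> s _ /Hd gs; rewrite qE.
  by apply: is_derive_tderive; exact: is_derive1Zl (dpow (- 1) t x gt).
rewrite qE// base_powRD//; ring.
Qed.

Lemma PJ_explicit : PJ_solution r^-1 u0 T vel.
Proof.
have goodd t : before T t -> exists2 d : R, 0 < d & forall s, `|s - t| < d -> good s.
  by move/goodT; exact: good_near.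
pose u1 t x : R := q1 r w t (psi t x).
pose u2 t x : R := q2 r w t (psi t x).
pose u3 t x : R := q3 r w t (psi t x).
(* [a] is the acceleration of the flow in Eulerian coordinates, whence u_t = a - u u_x. Its
   x-derivative is (1 - 1/r) u_x^2, so [utx] is the once integrated equation and [utxx] its
   derivative. *)
pose a t x : R := (r - 1) / r * prim (sterm r w 1 (r - 1 - 1) t) (psi t x).
pose ut t x : R := a t x - vel t x * u1 t x.
pose utx t x : R := - r^-1 * u1 t x ^+ 2 - vel t x * u2 t x.
pose utxx t x : R := - (2 * r^-1 + 1) * (u1 t x * u2 t x) - vel t x * u3 t x.
have du t x : good t -> is_derive x (1 : R) (vel t) (u1 t x) by move=> gt; exact: is_derive_vel.
have du1 t x : good t -> is_derive x (1 : R) (u1 t) (u2 t x) by move=> gt; exact: is_derive_ux.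
have du2 t x : good t -> is_derive x (1 : R) (u2 t) (u3 t x) by move=> gt; exact: is_derive_uxx.
have dut t x : good t -> is_derive x (1 : R) (ut t) (utx t x).
  move=> gt; have := is_derive1B
    (is_derive1Zl ((r - 1) / r) (is_derive_prim_term r0 sw gt 1 (r - 1 - 1) x))
    (is_derive1M (du t x gt) (du1 t x gt)).
  move/is_derive_eq; apply.
  rewrite /utx (_ : r - 1 - 1 - r = - 1 + - 1); last by ring.
  by rewrite base_powRD// /u1 /q1; field.
have dutx t x : good t -> is_derive x (1 : R) (utx t) (utxx t x).
  move=> gt; have := is_derive1B
    (is_derive1Zl (- r^-1) (is_derive1M (du1 t x gt) (du1 t x gt)))
    (is_derive1M (du t x gt) (du2 t x gt)).
  by move/is_derive_eq; apply; rewrite /utxx; ring.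
have ut1E t : good t -> derive1 (ut t) = utx t by move=> gt; apply: derive1_of => x; exact: dut.
have ut2E t : good t -> derive1n 2 (ut t) = utxx t.
  by move=> gt; rewrite /derive1n/= ut1E//; apply: derive1_of => x; exact: dutx.
have jv t x : good t -> jcont vel t x by move=> gt; exact: jcont_vel.
have j1 t x : good t -> jcont u1 t x by move=> gt; exact: jcont_q1.
have j2 t x : good t -> jcont u2 t x by move=> gt; exact: jcont_q2.
have j3 t x : good t -> jcont u3 t x by move=> gt; exact: jcont_q3.
have ja t x : good t -> jcont a t x.
  move=> gt; apply: jcontM; first exact: jcont_cst.
  apply: (@jcont_comp_psi _ _ _ r0 sw _ gt (fun t => prim (sterm r w 1 (r - 1 - 1) t))) => y.
  by have [_] := term_family r0 sw 1 (r - 1 - 1) gt; apply.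
have jN (F : R -> R -> R) t x : jcont F t x -> jcont (fun t x => - F t x) t x.
  by move=> jF; exact: cvgN.
have cb_jc (F G : R -> R -> R) : (forall t, good t -> F t = G t) ->
    (forall t x, good t -> jcont F t x) -> continuous_before T G.
  move=> FG jF; apply: continuous_before_jc => t x tT.
  have [d d0 Hd] := goodd t tT.
  apply: (jcont_near d0 _ (jF t x (goodT tT))) => s y /Hd gs.
  by rewrite FG.
split.
- exact: vel0.
- by move=> t /goodT gt; exact: vel_g_minfty.
- by exists flow; exact: flow_in_Diff_explicit.
- case=> [|[|[|[|//]]]] _.
  + exact: (cb_jc vel).
  + by apply: (cb_jc u1) => // t gt; rewrite [RHS]derive1_vel.
  + by apply: (cb_jc u2) => // t gt; rewrite derive1n2_vel.
  + by apply: (cb_jc u3) => // t gt; rewrite derive1n3_vel.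
exists ut; split.
- move=> t x tT; have gt := goodT tT; have [d d0 Hd] := goodd t tT.
  set y := psi t x.
  have dflow : is_tderive (fun s => flow s y) t (vel t x).
    by apply: is_derive_tderive; exact: (flow_family r0 sw gt).1.
  have cu1 : continuous_before T u1 by exact: (cb_jc u1).
  have mov := tderive_moving (fun s x sT => du s x (goodT sT)) cu1 tT dflow.
  have dPhi : is_tderive (fun s => prim (sterm r w 0 (r - 1) s) y) t (a t x).
    have H := (term_family r0 sw 0 (r - 1) gt).1 y.
    rewrite /a -/y; exact: (is_derive_tderive H).
  have fy : flow t y = x by exact: psiKV.
  rewrite fy in mov.
  have -> : ut t x = a t x - u1 t x * vel t x by rewrite /ut [vel t x * _]mulrC.
  (* At the fixed point x = flow t y, the velocity at time s is its value along the particle minus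
     vel s (flow s y) - vel s (flow t y), the increment handled by [tderive_moving]. *)
  refine (is_tderive_near d0 _ tT.1 (is_tderiveB dPhi mov)).
  move=> s _ /Hd gs; have -> : vel s (flow s y) = prim (sterm r w 0 (r - 1) s) y.
    by rewrite /velocity psiK.
  by rewrite opprB addrC subrK.
- case=> [|[|//]] t x _ /goodT gt; first by case: (dut t x gt).
  have -> : derive1n 1 (ut t) = utx t by exact: (ut1E t gt).
  by have [D _] := dutx t x gt; exact: D.
- have jut t x : good t -> jcont ut t x.
    move=> gt.
    have J := jcontM (jv t x gt) (j1 t x gt).
    have J2 := jN _ _ _ J.
    have J3 := jcontD (ja t x gt) J2.
    exact J3.
  case=> [|[|[|//]]] _.
  + exact: (cb_jc ut).
  + apply: (cb_jc utx) => [t gt|t x gt]; first by rewrite -ut1E.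
    have -> : utx = (fun t x => - r^-1 * (u1 t x * u1 t x) + - (vel t x * u2 t x)) by [].
    have J1 := jcontM (@jcont_cst _ (- r^-1) t x) (jcontM (j1 t x gt) (j1 t x gt)).
    have J2 := jN _ _ _ (jcontM (jv t x gt) (j2 t x gt)).
    exact (jcontD J1 J2).
  + apply: (cb_jc utxx) => [t gt|t x gt]; first by rewrite -ut2E.
    have -> : utxx = (fun t x => - (2 * r^-1 + 1) * (u1 t x * u2 t x) + - (vel t x * u3 t x)) by [].
    have J1 := jcontM (@jcont_cst _ (- (2 * r^-1 + 1)) t x) (jcontM (j1 t x gt) (j2 t x gt)).
    have J2 := jN _ _ _ (jcontM (jv t x gt) (j3 t x gt)).
    exact (jcontD J1 J2).
- move=> t x /goodT gt; rewrite ut2E// derive1_vel// derive1n2_vel// derive1n3_vel//.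
  by rewrite -/(u1 t x) -/(u2 t x) -/(u3 t x) /utxx; ring.
Qed.

End horizon.

End existence.

(** * The lifetime of the explicit flow *)

Section maximal_time.
Context {R : realType}.
Implicit Types (x y z s t c d p q : R).
Notation mu := (@lebesgue_measure R).
Local Notation Integrable f := (mu.-integrable setT (EFin \o f)).
Local Notation Pb := (@bounded_continuous R).
Local Notation Pi := (@integrable_bounded R).
Variables (r : R) (w : R -> R).
Hypothesis r0 : r != 0.
Hypothesis sw : smooth Pi w.
Local Notation base := (stretch r w).
Local Notation good := (good r w).
Local Notation flow := (lflow r w).

Lemma stretch_cvgNy t : base t x @[x --> -oo] --> (1 : R).
Proof.
have [wNy _] := smooth_integrable_cvg sw.
suff : base t x @[x --> -oo] --> t * 0 / r + 1 by rewrite mulr0 mul0r add0r.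
by apply: cvgD; [apply: cvgM; [apply: cvgM; [exact: cvg_cst|]|exact: cvg_cst]|exact: cvg_cst].
Qed.

Lemma continuous_stretch t : continuous (base t).
Proof. by have [] := smooth_base (smooth_baset r sw t). Qed.

(* The rate of stretching is attained, because w vanishes at both ends. *)
Lemma max_attained y1 : 0 < - w y1 / r -> exists ym, forall y, - w y / r <= - w ym / r.
Proof.
move=> g1; have [wNy wy] := smooth_integrable_cvg sw.
pose g y := - w y / r.
have gcvg (F : set_system R) : Filter F -> w x @[x --> F] --> (0 : R) -> g x @[x --> F] --> (0 : R).
  move=> FF wF; suff : g x @[x --> F] --> - 0 / r by rewrite oppr0 mul0r.
  by apply: cvgM; [exact: cvgN|exact: cvg_cst].
have gNy : g x @[x --> -oo] --> (0 : R) by apply: gcvg wNy.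
have gy : g x @[x --> +oo] --> (0 : R) by apply: gcvg wy.
have /cvgrPdist_lt/(_ _ g1)[A [_ HA]] := gNy.
have /cvgrPdist_lt/(_ _ g1)[B [_ HB]] := gy.
pose a := Num.min A y1 - 1; pose b := Num.max B y1 + 1.
have ay1 : a <= y1 by rewrite /a; have : Num.min A y1 <= y1 by [rewrite ge_min lexx orbT]; lra.
have y1b : y1 <= b by rewrite /b; have : y1 <= Num.max B y1 by [rewrite le_max lexx orbT]; lra.
have [||ym yab ymax] := @EVT_max R g a b.
- exact: le_trans ay1 y1b.
- apply: continuous_subspaceT => y; apply: cvgM; last exact: cvg_cst.
  by apply: cvgN; have [[cw _] _] := smooth_base sw; exact: cw.
have gm1 : g y1 <= g ym by apply: ymax; rewrite in_itv/= ay1.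
exists ym => y; rewrite -/(g y) -/(g ym); have [ya|ay] := ltP y a.
  have /= := HA y; rewrite sub0r normrN => /(_ _)/(le_lt_trans (ler_norm _)) h.
  apply: le_trans gm1; apply/ltW; apply: h.
  by apply: lt_trans ya _; rewrite /a; have : Num.min A y1 <= A by [rewrite ge_min lexx]; lra.
have [yb|by'] := ltP b y; last by apply: ymax; rewrite in_itv/= ay.
have /= := HB y; rewrite sub0r normrN => /(_ _)/(le_lt_trans (ler_norm _)) h.
apply: le_trans gm1; apply/ltW; apply: h.
by apply: lt_trans _ yb; rewrite /b; have : B <= Num.max B y1 by [rewrite le_max lexx]; lra.
Qed.

(** The zeros are bounded below since [stretch] tends to 1 at -oo, and their infimum is a zero by
    continuity. Starting from the first zero leaves a half-line on which the power has a positive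
    base. *)
Lemma first_zero t ym : base t ym = 0 -> (forall y, 0 <= base t y) ->
  exists2 y0, base t y0 = 0 & forall y, y < y0 -> 0 < base t y.
Proof.
move=> bm b0; pose Z := [set y | base t y = 0].
have /cvgrPdist_lt/(_ 1 ltr01)[A [_ HA]] := @stretch_cvgNy t.
have ZA : lbound Z A.
  move=> y /= by0; rewrite leNgt; apply/negP => yA; have /= := HA y yA.
  by rewrite by0 subr0 normr1 ltxx.
have infZ : has_inf Z by split; [exists ym|exists A].
exists (inf Z); last first.
  move=> y yZ; rewrite lt_def b0 andbT; apply/eqP => by0.
  by have := ge_inf infZ.2 by0; rewrite leNgt yZ.
apply/eqP; apply: contrapT => /negP bN0.
have bp : 0 < base t (inf Z) by rewrite lt_def bN0 b0.
have /cvgrPdist_lt/(_ _ bp)/nbhs_ballP[d /= d0 Hd] := @continuous_stretch t (inf Z).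
have : lbound Z (inf Z + d).
  move=> y /= by0; rewrite leNgt; apply/negP => yd.
  have Zy := ge_inf infZ.2 by0.
  have /= := Hd y; rewrite /ball/= ler0_norm ?subr_le0// by0 subr0 gtr0_norm// ltxx.
  by move=> H; have : false by apply: H; lra.
by move/(lb_le_inf infZ.1); lra.
Qed.

(** The flow integrand need not be integrable on the whole line at this time. Up to a point [u]
    between [x] and [y0] it coincides with the integrand for max(base, c), which is integrable and
    continuous, so the derivative can be computed there. *)
Lemma flow_derive_before_zero t y0 x : (forall y, y < y0 -> 0 < base t y) -> x < y0 ->
  is_derive x (1 : R) (fun x => flow t x - x) (base t x `^ r - 1).
Proof.
move=> bpos xy0; pose u := (x + y0) / 2.
have xu : x < u by rewrite /u; lra.
have uy : u < y0 by rewrite /u; lra.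
have h2 : (0 : R) < 1 / 2 by lra.
have /cvgrPdist_lt/(_ _ h2)[A [_ HA]] := @stretch_cvgNy t.
pose a := Num.min (A - 1) u.
have au : a <= u by rewrite ge_min lexx orbT.
have aA : a < A by rewrite /a gt_min; apply/orP; left; lra.
have [|ym ymu ymin] := EVT_min au (f := base t).
  by apply: continuous_subspaceT; exact: continuous_stretch.
(* A lower bound of the base on ]-oo, u]: above 1/2 close to -oo, and at least the minimum on [a, u]
   in between. *)
pose c := Num.min (1 / 2) (base t ym).
have c0 : 0 < c.
  rewrite lt_min h2; apply: bpos; apply: le_lt_trans uy.
  by move: ymu; rewrite in_itv/= => /andP[].
have cb y : y <= u -> c <= base t y.
  move=> yu; rewrite /c ge_min; have [ya|ay] := ltP y a.
    by apply/orP; left; have /= := HA y (lt_trans ya aA); have := ler_norm (1 - base t y); lra.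
  by apply/orP; right; apply: ymin; rewrite in_itv/= ay.
pose f y := Num.max (base t y) c.
have cf : continuous f.
  by move=> y; apply: continuous_max; [exact: continuous_stretch|exact: cst_continuous].
have [_ [C HC]] := smooth_base (smooth_baset r sw t).
have [[_ _] iw] := smooth_base sw.
have f0 y : 0 < f y by rewrite lt_max c0 orbT.
have ch : continuous (fun y => f y `^ r - 1).
  move=> y; apply: cvgB; last exact: cvg_cst.
  apply: (@continuous_comp _ _ _ f (fun a => a `^ r)); first exact: cf.
  by apply: is_derive1_continuous; apply: is_derive1_powR.
have ih : Integrable (fun y => f y `^ r - 1).
  apply: (integrable_powR_sub1 (w := w) (K := `|t / r|) (c := c) (C := Num.max C c)) => // y.
    by rewrite /f le_max lexx orbT/= ge_max !le_max lexx orbT (le_trans (ler_norm _) (HC y)).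
  apply: (@le_trans _ _ `|base t y - 1|); last first.
    by rewrite (_ : base t y - 1 = (t / r) * w y) ?normrM// /stretch; ring.
  have c1 : c <= 1 / 2 by rewrite ge_min lexx.
  rewrite /f; have [bc|cb'] := leP (base t y) c; last by [].
  by rewrite !ler0_norm; lra.
have E y : y <= u -> flow t y - y = prim (fun y => f y `^ r - 1) y.
  move=> yu; rewrite /lflow addrC addKr; apply: eq_Rintegral => z.
  rewrite inE/= in_itv/= => zy; rewrite /f max_l// cb//; exact: le_trans yu.
have := is_derive_prim ih (ch x).
rewrite {2}/f max_l; last by apply: cb; exact: ltW.
apply: is_derive1_near; near=> y; rewrite E//.
by rewrite ltW//; near: y; exact: lt_nbhsl.
Unshelve. all: by end_near. Qed.

(** Membership makes the flow derivative continuous and positive at [y0]. For r > 0 it is then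
    bounded below near [y0], for r < 0 bounded above; either way base^|r| stays above a positive
    [kap] to the left of [y0], although the base tends to 0. *)
Lemma zero_not_Diff t ym : base t ym = 0 -> (forall y, 0 <= base t y) ->
  ~ Diff_minfty (flow t).
Proof.
move=> bm b0; have [y0 by0 bpos] := first_zero bm b0.
move=> [_ [cD _] D1 _]; pose D : R -> R := derive1 (fun x => flow t x - x).
have DE x : x < y0 -> D x = base t x `^ r - 1.
  move=> xy; rewrite /D derive1E.
  by have [_] := flow_derive_before_zero bpos xy.
have Dl : D x @[x --> y0^'-] --> D y0 by apply: cvg_at_left_filter; exact: cD.
have left_lt : \forall x \near y0^'-, x < y0 by exists 1 => /=.
have bl : base t x @[x --> y0^'-] --> (0 : R).
  by rewrite -by0; apply: cvg_at_left_filter; exact: continuous_stretch.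
have [kap kap0 Hk] : exists2 kap : R, 0 < kap &
    \forall x \near y0^'-, kap <= base t x `^ `|r|.
  have [rp|rn] := ltP 0 r.
    have Dp : 0 < (D y0 + 1) / 2 by have := D1 y0; rewrite -/D; lra.
    exists ((D y0 + 1) / 2) => //.
    near=> x; have xy : x < y0 by near: x; exact: left_lt.
    have : `|D y0 - D x| < (D y0 + 1) / 2 by near: x; move/cvgrPdist_lt : Dl; exact.
    rewrite (gtr0_norm rp) (DE x xy); have := ler_norm (D y0 - (base t x `^ r - 1)); lra.
  have rn' : r < 0 by rewrite lt_neqAle r0.
  pose B := D y0 + 2.
  have B0 : 0 < B by have := D1 y0; rewrite -/D /B; lra.
  exists B^-1; first by rewrite invr_gt0.
  near=> x; have xy : x < y0 by near: x; exact: left_lt.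
  have : `|D y0 - D x| < 1 by near: x; move/cvgrPdist_lt : Dl; exact.
  rewrite (ltr0_norm rn') (DE x xy) powRN => h.
  rewrite lef_pV2 ?posrE ?powR_gt0 ?bpos//.
  have := ler_norm (- (D y0 - (base t x `^ r - 1))); rewrite normrN /B; lra.
have r1 : 0 < `|r| by rewrite normr_gt0.
have kr : 0 < kap `^ `|r|^-1 by rewrite powR_gt0.
have /cvgrPdist_lt/(_ _ kr) Hb := bl.
have [x [[hk hb] xy]] := @filter_ex _ (y0^'-) _ _ (filterI (filterI Hk Hb) left_lt).
move: hb; rewrite sub0r normrN gtr0_norm ?bpos// => hb.
have := gt0_ltr_powR r1 _ _ hb; rewrite -powRrM mulVf ?gt_eqF// powRr1 ?(ltW kap0)//.
rewrite !nnegrE ?powR_ge0 ?b0// => /(_ isT isT).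
by rewrite ltNge hk.
Unshelve. all: by end_near. Qed.

(** T is the inverse of the maximum of -w / r, or +oo if -w / r is nowhere positive. The third
    property bounds the lifetime of an arbitrary solution, for which only pointwise positivity is
    known; the last one bounds that of the explicit flow. *)
Lemma maximal_time : exists T : \bar R, [/\ (0%:E < T)%E,
  forall t, 0 <= t -> (t%:E < T)%E -> good t,
  forall t, 0 <= t -> (forall y, 0 < base t y) -> (t%:E < T)%E &
  forall t, 0 <= t -> (forall s, 0 <= s <= t -> Diff_minfty (flow s)) -> (t%:E < T)%E].
Proof.
have [[y1 g1]|/forallNP ng] := pselect (exists y, 0 < - w y / r); last first.
  exists +oo%E; split=> [|t t0 _|t _ _|t _ _]; rewrite ?ltry//.
  exists 1 => // y; have /negP := ng y; rewrite -leNgt => wy.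
  by rewrite /stretch lerDr -mulrA mulr_ge0//; move: wy; rewrite mulNr; lra.
have [ym Hm] := max_attained g1; pose m := - w ym / r.
have m0 : 0 < m by apply: lt_le_trans (Hm y1).
have bE t y : base t y = 1 - t * (- w y / r) by rewrite /stretch; ring.
exists m^-1%:E; split.
- by rewrite lte_fin invr_gt0.
- move=> t t0; rewrite lte_fin => tm; have tm1 : t * m < 1 by rewrite -ltr_pdivlMr// div1r.
  exists (1 - t * m); first by rewrite subr_gt0.
  by move=> y; rewrite bE lerD2l lerN2 ler_wpM2l.
- move=> t t0 /(_ ym); rewrite bE subr_gt0 -ltr_pdivlMr// div1r.
  by rewrite lte_fin.
- move=> t t0 H; rewrite lte_fin ltNge; apply/negP => mt.
  have : Diff_minfty (flow m^-1) by apply: H; rewrite invr_ge0 (ltW m0).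
  apply: (@zero_not_Diff _ ym).
    by rewrite bE -/m mulVf ?subrr// gt_eqF.
  by move=> y; rewrite bE subr_ge0 -ler_pdivlMl ?invr_gt0// invrK mulr1; exact: Hm.
Qed.

End maximal_time.

(** * Uniqueness *)

Section Lagrangian_uniqueness.
Context {R : realType}.
Implicit Types (x y z s t c d q : R) (T : \bar R).
Local Notation Pi := (@integrable_bounded R).

Lemma Diff_minfty_facts (p : R -> R) : Diff_minfty p ->
  [/\ forall x, is_derive x (1 : R) p (derive1 p x), forall x, 0 < derive1 p x &
      (fun x => p x - x) @ -oo --> (0 : R)].
Proof.
move=> [dp _ p1 pNy].
have dpx x : is_derive x (1 : R) p (derive1 (fun x => p x - x) x + 1).
  have := is_derive1D (derivable_is_derive1 (dp x)) (is_derive1_id x).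
  by under [X in is_derive _ _ X _]funext do rewrite subrK.
split=> [x|x|//]; rewrite (derive1_of dpx)//.
by have := p1 x; lra.
Qed.

Variables (r : R) (u0 : R -> R).
Hypothesis r0 : r != 0.
Hypothesis hu0 : g_minfty u0.
Local Notation w := (derive1 u0).
Let sw : smooth Pi w. Proof. by have [] := g_minfty_smooth hu0. Qed.
Local Notation base := (stretch r w).
Local Notation good := (good r w).
Local Notation flow := (lflow r w).
Local Notation vel := (velocity r w).
Local Notation psi := (label r w).

Lemma tder_stretch T x : (0%:E < T)%E -> tder T (base^~ x) (fun=> w x / r).
Proof. by move=> T0; apply: tder_global => // t _ _; exact: is_derive_base_t. Qed.

(* The Riccati equation turns into the linear equation z' = - (q / r) z for
   z := (1 + t w / r) q - w. *)
Lemma riccati_explicit T (q : R -> R) x : (0%:E < T)%E ->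
  tder T q (fun t => - r^-1 * q t ^+ 2) -> q 0 = w x ->
  forall t, before T t -> base t x * q t = w x /\ 0 < base t x.
Proof.
move=> T0 dq q0.
have bq t : before T t -> base t x * q t = w x.
  move=> [t0 tT]; apply/eqP; rewrite -subr_eq0; apply/eqP.
  have dc c : tder T (fun=> c) (fun=> 0 : R) by apply: tder_global => // *; exact: is_derive1_cst.
  have dz := tderD (tderM (tder_stretch x T0) dq) (dc (- w x)).
  have dq' := tderM (dc (- r^-1)) dq.
  apply: (@tder_linear_eq0 _ T (fun t => base t x * q t - w x) (fun t => - r^-1 * q t) _ _ dq') => //.
    case: dz => dz1 dz2; split=> // s s0 sT.
    by apply: (is_derive_eq (dz1 s s0 sT)); rewrite /stretch; field.
  by rewrite q0 /stretch; ring.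
move=> t tT; split; first exact: bq.
rewrite ltNge; apply/negP => b0.
have t0 : 0 < t.
  rewrite lt_def tT.1 andbT; apply/eqP => tE; move: b0.
  by rewrite tE /stretch !mul0r add0r; lra.
have tw : t * (w x / r) <= - 1 by move: b0; rewrite /stretch mulrA; lra.
have wr0 : w x / r < 0 by rewrite -(pmulr_rlt0 _ t0); lra.
(* The zero of the base in time, reached no later than [t]; there the identity base * q = w reads 0
   = w, against w / r < 0. *)
pose s := - (w x / r)^-1.
have s0 : 0 < s by rewrite oppr_gt0 invr_lt0.
have st : s <= t.
  rewrite -(ler_nM2r wr0); apply: le_trans tw _.
  by rewrite /s mulNr mulVf ?lt_eqF.
have sT : before T s by apply: before_le tT; rewrite (ltW s0).
have bs0 : base s x = 0.
  by rewrite /stretch -mulrA /s mulNr mulVf ?lt_eqF// addNr.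
have := bq s sT; rewrite bs0 mul0r => w0.
by move: wr0; rewrite -w0 mul0r ltxx.
Qed.

(** Since q = w / base, the power base^(-r) is an integrating factor: P base^(-r) has zero time
    derivative. *)
Lemma stretch_exponential T (P : R -> R) (q : R -> R) x : (0%:E < T)%E ->
  tder T P (fun t => q t * P t) -> P 0 = 1 ->
  (forall t, before T t -> base t x * q t = w x /\ 0 < base t x) ->
  forall t, before T t -> P t = base t x `^ r.
Proof.
move=> T0 dP P0 bq t tT.
have db : tder T (fun s => base s x `^ (- r)) (fun s => w x / r * (- r * base s x `^ (- r - 1))).
  apply: tder_global => // s s0 sT; have [_ bp] := bq s (conj s0 sT).
  exact: (@is_derive1_powR_comp _ (base^~ x) (- r) s _ bp (is_derive_base_t r w s x)).
have [dm1 dm2] := tderM dP db.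
have dm : tder T (fun s => P s * base s x `^ (- r)) (fun=> 0).
  split=> // s s0 sT; apply: (is_derive_eq (dm1 s s0 sT)).
  have [be bp] := bq s (conj (ltW s0) sT).
  have -> : base s x `^ (- r) = base s x `^ (- r - 1) * base s x.
    rewrite -{3}(powRr1 (ltW bp)) -powRD ?subrK//.
    by rewrite (gt_eqF bp) implybT.
  by rewrite -{1}be; field.
have := tder_cst dm (_ : 0 <= 0 <= t) tT.2; rewrite lexx tT.1 => /(_ isT).
rewrite P0 {2}/stretch !mul0r add0r powR1 mulr1 powRN => E.
have [_ bp] := bq t tT.
by rewrite -[P t](divfK (x := base t x `^ r)) ?E ?mul1r// gt_eqF// powR_gt0.
Qed.

(** A flow is determined by its space derivative and the condition p - id --> 0 at -oo. Its time
    derivative then gives the velocity at every point, the explicit flow being onto. *)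
Lemma velocity_determined T (v p : R -> R -> R) : flow_in_Diff T v p ->
  (forall t, before T t -> good t) ->
  (forall t x, before T t -> derive1 (p t) x = base t x `^ r) ->
  forall t x, before T t -> v t x = vel t x.
Proof.
move=> [p0 pD dp] gT px t x tT.
have pE s : before T s -> p s = flow s.
  move=> sT; have gs := gT s sT.
  have [dps _ pNy] := Diff_minfty_facts (pD s sT).
  have [df _ fNy] := Diff_minfty_facts (flow_Diff_minfty r0 sw gs).
  have dpx y : is_derive y (1 : R) (fun y => p s y - y) (base s y `^ r - 1).
    by apply: is_derive1B (is_derive1_id y); rewrite -px.
  have dfx y : is_derive y (1 : R) (fun y => flow s y - y) (base s y `^ r - 1).
    by apply: is_derive1B (is_derive1_id y); exact: is_derive_flow.
  apply/funext => y; have := congr1 (@^~ y) (eq_of_is_derive_cvgNy dpx dfx pNy fNy).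
  by move/addIr.
have gt := gT t tT; rewrite -(psiKV r0 sw gt x); set y := psi t x.
have [d d0 Hd] := before_near tT.
have H : is_tderive (fun s => flow s y) t (v t (flow t y)).
  rewrite -(pE t tT); refine (is_tderive_near d0 _ tT.1 (dp t y tT)) => s s0 sd.
  by rewrite pE//; exact: Hd.
apply: (is_tderive_unique tT.1 H).
have /is_derive_tderive := (flow_family r0 sw gt).1 y.
by rewrite /velocity psiK.
Qed.

(** The second conclusion is conditional because [good] on the lifetime of [v] is deduced from the
    first one, by way of the maximal time. *)
Lemma Lagrangian_unique T (v : R -> R -> R) : (0%:E < T)%E ->
  PJ_Lagrangian_solution r^-1 u0 T v ->
  (forall t x, before T t -> 0 < base t x) /\
  ((forall t, before T t -> good t) -> forall t x, before T t -> v t x = vel t x).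
Proof.
move=> T0 [v0 vg [p [pxt [fl dpx cpxt ODE]]]]; have [p0 pD dp] := fl.
have T00 : before T 0 by split.
have dpt s x : before T s -> is_derive x (1 : R) (p s) (derive1 (p s) x).
  by move=> /pD/Diff_minfty_facts[].
have pxt0 x : pxt 0 x = w x.
  (* At time 0 the flow is the identity, so p_t is [u0], and exchanging derivatives identifies p_xt
     with its derivative. *)
  have := schwarz_tx (Fx := fun s x => derive1 (p s) x) x dpt dp dpx cpxt T00.
  have -> : (fun y => v 0 (p 0 y)) = u0 by apply/funext => y; rewrite p0 v0.
  have [_ du0 _] := g_minfty_smooth hu0.
  by move/is_derive1_unique; apply; exact: du0.
have px0 x : derive1 (p 0) x = 1.
  rewrite (_ : p 0 = id); last by apply/funext => y; exact: p0.
  by rewrite (derive1_of (f' := fun=> 1)) => // y; exact: is_derive1_id.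
pose q t x := pxt t x / derive1 (p t) x.
have dq x : tder T (q^~ x) (fun t => - r^-1 * q t x ^+ 2).
  apply: is_tderive_tder => // t tT; have [qt dqt E] := ODE t x tT.
  by have -> : - r^-1 * q t x ^+ 2 = qt by rewrite mulNr; apply/eqP; rewrite eq_sym -addr_eq0 E.
have q0 x : q 0 x = w x by rewrite /q px0 divr1 pxt0.
have bq x := riccati_explicit T0 (dq x) (q0 x).
split=> [t x tT|gT]; first by have [] := bq x t tT.
apply: (velocity_determined fl gT) => t x tT.
apply: (@stretch_exponential T (fun t => derive1 (p t) x) (q^~ x) x T0 _ (px0 x) (bq x) t tT).
have [d1 d2] := is_tderive_tder T0 (fun t => dpx t x); split=> // s s0 sT.
apply: (is_derive_eq (d1 s s0 sT)).
have [_ pos _] := Diff_minfty_facts (pD s (conj (ltW s0) sT)).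
by rewrite divfK// gt_eqF.
Qed.

End Lagrangian_uniqueness.

(** * A Riccati equation with spatially constant forcing and decaying solutions *)

Section forcing.
Context {R : realType}.
Implicit Types (x y z s t d q : R) (T : \bar R).

Lemma is_tderiveD (f g : R -> R) t l l' : is_tderive f t l -> is_tderive g t l' ->
  is_tderive (fun s => f s + g s) t (l + l').
Proof.
move=> /is_tderiveP H /is_tderiveP H'; apply/is_tderiveP => e e0.
have e20 : 0 < e / 2 by rewrite divr_gt0.
have [d d0 Hd] := H _ e20; have [d' d'0 Hd'] := H' _ e20.
exists (Num.min d d'); first by rewrite lt_min d0.
move=> s s0; rewrite lt_min => /andP[sd sd'].
rewrite (_ : _ - _ - _ = (f s - f t - l * (s - t)) + (g s - g t - l' * (s - t))); last by ring.
by rewrite (le_trans (ler_normD _ _))//; have := Hd s s0 sd; have := Hd' s s0 sd'; lra.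
Qed.

Lemma tder_inv_sqr T (q q' : R -> R) : tder T q q' ->
  tder T (fun s => (1 + q s * q s)^-1)
    (fun s => - (q' s * q s + q s * q' s) / (1 + q s * q s) ^+ 2).
Proof.
move=> [dq q0].
have n0 (a : R) : 1 + a * a != 0 by rewrite gt_eqF// ltr_pwDl// -expr2 sqr_ge0.
split.
  move=> s s0 sT; apply: is_derive1_inv => //.
  have := is_derive1D (is_derive1_cst 1 s) (is_derive1M (dq s s0 sT) (dq s s0 sT)).
  by move/is_derive_eq; apply; rewrite add0r.
by apply: cvgV => //; apply: cvgD; [exact: cvg_cst|exact: cvgM].
Qed.

(* As long as q is small, q' = c - lam q ^ 2 is bounded away from 0; that q
   stays small on a time interval independent of q is read off from
   1 / (1 + q ^ 2), whose derivative is bounded by |c| + |lam|. *)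
Lemma riccati_growth T (q c : R -> R) (lam c0 m : R) a b : tder T q (fun t => c t - lam * q t ^+ 2) ->
  0 <= a -> a < b -> (b%:E < T)%E -> 0 < c0 -> 0 < m -> `|lam| * m ^+ 2 <= c0 / 4 ->
  (forall t, a <= t <= b -> c0 / 2 <= c t <= 2 * c0) ->
  `|q a| <= m / 2 ->
  (2 * c0 + `|lam|) * (b - a) <= (1 + (m / 2) ^+ 2)^-1 - (1 + m ^+ 2)^-1 ->
  c0 / 4 * (b - a) <= q b - q a.
Proof.
move=> dq a0 ab bT c00 m0 lm cb qa small.
have dh := tder_inv_sqr dq.
set M := 2 * c0 + `|lam| in small.
have M0 : 0 <= M by rewrite addr_ge0// mulr_ge0// ltW.
have q1 (x : R) : 0 < 1 + x * x by rewrite ltr_pwDl// -expr2 sqr_ge0.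
have h' t : a < t < b ->
    `|- ((c t - lam * q t ^+ 2) * q t + q t * (c t - lam * q t ^+ 2)) / (1 + q t * q t) ^+ 2| <= M.
  move=> /andP[at' tb]; have /andP[c1 c2] : c0 / 2 <= c t <= 2 * c0 by apply: cb; rewrite !ltW.
  set x := q t; have xx := q1 x.
  rewrite normrM normfV [X in _ / X]ger0_norm ?sqr_ge0// normrN ler_pdivrMr ?exprn_gt0//.
  (* The factors are bounded by M (1 + x^2) and, since 2 |x| <= 1 + x^2, by 1 + x^2. *)
  have -> : (c t - lam * x ^+ 2) * x + x * (c t - lam * x ^+ 2) = (c t - lam * (x * x)) * (2 * x) by ring.
  rewrite normrM expr2 [leRHS]mulrA; apply: ler_pM => //.
    apply: le_trans (ler_normB _ _) _; rewrite (ger0_norm (_ : 0 <= c t)); last by lra.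
    rewrite normrM (ger0_norm (_ : 0 <= x * x)); last by rewrite -expr2 sqr_ge0.
    rewrite /M mulrDl !mulrDr !mulr1.
    have : 0 <= c0 * (x * x) by rewrite mulr_ge0 ?(ltW c00)// -expr2 sqr_ge0.
    have := normr_ge0 lam; lra.
  rewrite ler_norml; have := sqr_ge0 (x - 1); have := sqr_ge0 (x + 1).
  by rewrite !expr2; lra.
have qs s : a <= s <= b -> q s ^+ 2 <= m ^+ 2.
  move=> /andP[as' sb].
  have hs : (1 + m ^+ 2)^-1 <= (1 + q s * q s)^-1.
    have hab : (1 + (m / 2) ^+ 2)^-1 <= (1 + q a * q a)^-1.
      rewrite lef_pV2 ?posrE ?ltr_pwDl ?sqr_ge0 -?expr2 ?sqr_ge0// lerD2l.
      have m20 : 0 <= m / 2 by rewrite divr_ge0 // ltW.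
      by rewrite -(real_normK (num_real (q a))) lerXn2r ?nnegrE.
    move: as'; rewrite le_eqVlt => /predU1P[<-|as'].
      have : 0 <= M * (b - a) by rewrite mulr_ge0// subr_ge0 ltW.
      by lra.
    have sT : (s%:E < T)%E by apply: le_lt_trans bT; rewrite lee_fin.
    have [z /andP[az zs] E] := tder_MVT dh a0 as' sT.
    have := h' z; rewrite az (lt_le_trans zs sb) => /(_ isT) /ler_normlP[hz _].
    have : M * (s - a) <= M * (b - a) by rewrite ler_wpM2l// lerD2r.
    move: E; set D := - (_ + _) / _ in hz *; move=> E.
    have : - D * (s - a) <= M * (s - a) by rewrite ler_wpM2r// subr_ge0 ltW.
    by lra.
  move: hs; rewrite lef_pV2 ?posrE ?ltr_pwDl ?sqr_ge0 -?expr2 ?sqr_ge0//.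
  by rewrite lerD2l.
have [z /andP[az zb] ->] := tder_MVT dq a0 ab bT.
rewrite ler_wpM2r ?subr_ge0 ?(ltW ab)//.
have /andP[c1 c2] : c0 / 2 <= c z <= 2 * c0 by apply: cb; rewrite !ltW.
have := qs z; rewrite (ltW az) (ltW zb) => /(_ isT) qz.
have : lam * q z ^+ 2 <= `|lam| * m ^+ 2.
  apply: (@le_trans _ _ (`|lam| * q z ^+ 2)).
    by rewrite ler_wpM2r ?sqr_ge0 ?ler_norm.
  by rewrite ler_wpM2l.
lra.
Qed.

(** If c a > 0, every Q(., y) that is small at time [a] grows by at least (c a / 4) h over
    [a, a + h], with [h] chosen before [y]. For [y] close to -oo both Q(a, y) and Q(a + h, y) are
    too small for that. *)
Lemma riccati_forcing_le0 T (Q : R -> R -> R) (c : R -> R) (lam : R) a :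
  (forall y, tder T (Q^~ y) (fun t => c t - lam * Q t y ^+ 2)) ->
  (forall t, before T t -> Q t y @[y --> -oo] --> (0 : R)) ->
  (forall e : R, 0 < e -> exists2 d : R, 0 < d &
     forall s, before T s -> `|s - a| < d -> `|c s - c a| < e) ->
  before T a -> c a <= 0.
Proof.
move=> dQ Q0 cc aT; rewrite leNgt; apply/negP => c0; set c0' := c a in c0.
have c20 : 0 < c0' / 2 by rewrite divr_gt0.
have [d d0 Hd] := cc _ c20.
have [d1 d10 Hd1] := before_near aT.
pose m := Num.min 1 (c0' / (4 * (`|lam| + 1))).
have l1 : 0 < 4 * (`|lam| + 1) by rewrite mulr_gt0// ltr_wpDl.
have m0 : 0 < m by rewrite lt_min ltr01 divr_gt0.
have lm : `|lam| * m ^+ 2 <= c0' / 4.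
  apply: (@le_trans _ _ ((`|lam| + 1) * m)).
    rewrite ler_pM ?sqr_ge0// ?lerDl// expr2 ler_piMl ?(ltW m0)//.
    by rewrite ge_min lexx.
  have : m <= c0' / (4 * (`|lam| + 1)) by rewrite ge_min lexx orbT.
  by rewrite ler_pdivlMr//; lra.
pose kap := (1 + (m / 2) ^+ 2)^-1 - (1 + m ^+ 2)^-1.
have kap0 : 0 < kap.
  have p1 z : 0 < 1 + z ^+ 2 :> R by rewrite ltr_pwDl ?sqr_ge0.
  rewrite subr_gt0 ltf_pV2 ?posrE ?p1// ltrD2l.
  by rewrite ltrXn2r ?nnegrE ?divr_ge0 ?(ltW m0)//; lra.
pose M := 2 * c0' + `|lam|.
have M0 : 0 < M by rewrite ltr_pwDl// mulr_gt0.
pose h := Num.min (Num.min (d / 2) (d1 / 2)) (kap / M).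
have h0 : 0 < h by rewrite !lt_min !divr_gt0.
have hd : h < d by apply: (@le_lt_trans _ _ (d / 2)); [rewrite !ge_min lexx|lra].
have hd1 : h < d1 by apply: (@le_lt_trans _ _ (d1 / 2)); [rewrite !ge_min lexx orbT|lra].
have hk : M * h <= kap.
  by rewrite mulrC -ler_pdivlMr// ge_min lexx orbT.
have bT : before T (a + h).
  apply: Hd1; first by rewrite addr_ge0 ?aT.1 ?(ltW h0).
  by rewrite addrAC subrr add0r gtr0_norm.
(* m / 2 is the smallness required by [riccati_growth]; two values below c0' h / 16 differ by less
   than c0' h / 8, short of the growth c0' h / 4. *)
have e0 : 0 < Num.min (m / 2) (c0' / 16 * h) by rewrite lt_min !mulr_gt0.
have /cvgrPdist_lt/(_ _ e0)[A [_ HA]] := Q0 _ aT.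
have /cvgrPdist_lt/(_ _ e0)[B [_ HB]] := Q0 _ bT.
pose y := Num.min A B - 1.
have yA : y < A by have : Num.min A B <= A by [rewrite ge_min lexx]; rewrite /y; lra.
have yB : y < B by have : Num.min A B <= B by [rewrite ge_min lexx orbT]; rewrite /y; lra.
have := HA y yA; rewrite /= sub0r normrN lt_min => /andP[qa1 qa2].
have := HB y yB; rewrite /= sub0r normrN lt_min => /andP[qb1 qb2].
have := @riccati_growth T (Q^~ y) c lam c0' m a (a + h) (dQ y) aT.1.
rewrite ltrDl h0 => /(_ isT bT.2 c0 m0 lm) G.
have ch t : a <= t <= a + h -> c0' / 2 <= c t <= 2 * c0'.
  move=> /andP[at' th].
  have tT : before T t by apply: before_le bT; rewrite th (le_trans aT.1).
  have := Hd t tT; rewrite ger0_norm ?subr_ge0// => H.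
  have : `|c t - c a| < c0' / 2 by apply: H; lra.
  by rewrite -/c0' ltr_norml; lra.
have := G ch (ltW qa1); rewrite addrAC subrr add0r => /(_ hk).
have := ler_norm (Q (a + h) y); have := ler_norm (- Q a y); rewrite normrN.
have : 0 < c0' * h by rewrite mulr_gt0.
lra.
Qed.

(** Replacing (Q, c, lam) by its opposite preserves the equation, so the one-sided bound gives the
    other sign as well. *)
Lemma riccati_forcing_eq0 T (Q : R -> R -> R) (c : R -> R) (lam : R) a :
  (forall y, tder T (Q^~ y) (fun t => c t - lam * Q t y ^+ 2)) ->
  (forall t, before T t -> Q t y @[y --> -oo] --> (0 : R)) ->
  (forall e : R, 0 < e -> exists2 d : R, 0 < d &
     forall s, before T s -> `|s - a| < d -> `|c s - c a| < e) ->
  before T a -> c a = 0.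
Proof.
move=> dQ Q0 cc aT; apply/eqP; rewrite eq_le (riccati_forcing_le0 dQ Q0 cc aT)/=.
rewrite -oppr_le0.
apply: (@riccati_forcing_le0 T (fun t y => - Q t y) (fun t => - c t) (- lam)) => //.
- move=> y; have [d1 d2] := dQ y; split; last exact: cvgN.
  move=> t t0 tT; have := is_derive1N (d1 t t0 tT); move/is_derive_eq; apply.
  by rewrite sqrrN; ring.
- by move=> t tT; rewrite -oppr0; apply: cvgN; exact: Q0.
- move=> e e0; have [d d0 Hd] := cc e e0; exists d => // s sT sd.
  by rewrite -opprD normrN; exact: Hd.
Qed.

End forcing.

(** * The space derivative of an Eulerian flow *)

Section PJ_uniqueness.
Context {R : realType}.
Implicit Types (x y z s t c d e q : R) (T : \bar R).
Local Notation Pi := (@integrable_bounded R).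

Lemma tder_expR T (a : R) : (0%:E < T)%E ->
  tder T (fun s => expR (a * s)) (fun s => a * expR (a * s)).
Proof.
move=> T0; apply: tder_global => // s _ _.
have := is_derive1_chain (is_derive_expR _) (is_derive1Zl a (is_derive1_id s)).
by move/is_derive_eq; apply; rewrite mulr1.
Qed.

Lemma tderN T (f f' : R -> R) : tder T f f' -> tder T (fun s => - f s) (fun s => - f' s).
Proof.
move=> [df f0]; split; last exact: cvgN.
by move=> t t0 tT; apply: is_derive1N; exact: df.
Qed.

Lemma gronwall_le T (f f' : R -> R) e t : tder T f f' -> 0 <= t -> (t%:E < T)%E ->
  (forall s, 0 < s < t -> f' s <= e * f s) -> f t <= f 0 * expR (e * t).
Proof.
move=> df t0 tT H; have T0 : (0%:E < T)%E by apply: le_lt_trans tT; rewrite lee_fin.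
have := tder_nincr (tderM df (tder_expR (- e) T0)) (lexx 0) t0 tT.
rewrite mulr0 expR0 mulr1 => G.
have {}G : f t * expR (- e * t) <= f 0.
  apply: G => s st; rewrite [- e * expR _]mulrC mulrA -mulrA.
  rewrite [X in _ + X](_ : _ = - (e * f s) * expR (- e * s)); last by ring.
  by rewrite -mulrDl mulr_le0_ge0 ?expR_ge0// subr_le0 H.
by rewrite -ler_pdivrMr ?expR_gt0// -expRN -mulNr.
Qed.

Variables (r : R) (u0 : R -> R).
Hypothesis r0 : r != 0.
Hypothesis hu0 : g_minfty u0.
Local Notation w := (derive1 u0).
Let sw : smooth Pi w. Proof. by have [] := g_minfty_smooth hu0. Qed.
Local Notation base := (stretch r w).
Local Notation good := (good r w).
Local Notation vel := (velocity r w).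

(** Over a common denominator the terms in s cancel and w y - w x remains. The base is affine in s,
    equal to 1 at time 0 and at least [c] at time [t], hence at least min(1, c) in between: this
    makes [d] independent of s. *)
Lemma rate_continuous (t x e : R) : good t -> 0 <= t -> 0 < e -> exists2 d : R, 0 < d &
  forall s y, 0 <= s <= t -> `|y - x| < d -> `|w y / base s y - w x / base s x| <= e.
Proof.
move=> [c c0 Hc] t0 e0; pose c1 := Num.min 1 c.
have c10 : 0 < c1 by rewrite lt_min ltr01.
have bc s y : 0 <= s <= t -> c1 <= base s y.
  move=> /andP[s0 st]; rewrite ge_min; apply/orP.
  have [w0|w0] := leP 0 (w y / r).
    by left; rewrite /stretch -mulrA lerDr mulr_ge0.
  right; apply: le_trans (Hc y) _; rewrite /stretch lerD2r -!mulrA.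
  by rewrite ler_wnM2r// ltW.
have [[cw _] _] := smooth_base sw.
have e1 : 0 < e * c1 ^+ 2 by rewrite mulr_gt0// exprn_gt0.
have /cvgrPdist_lt/(_ _ e1)/nbhs_ballP[d /= d0 Hd] := cw x.
exists d => // s y st yx.
have b1 := bc s y st; have b2 := bc s x st.
have p1 := lt_le_trans c10 b1; have p2 := lt_le_trans c10 b2.
have -> : w y / base s y - w x / base s x = (w y - w x) / (base s y * base s x).
  apply: (mulIf (_ : base s y * base s x != 0)); first by rewrite gt_eqF// mulr_gt0.
  rewrite divfK ?gt_eqF ?mulr_gt0// mulrBl.
  rewrite mulrA divfK ?gt_eqF// [X in _ - X](_ : _ = w x * base s y); last by field; rewrite gt_eqF.
  by rewrite /stretch; ring.
rewrite normrM normfV [X in _ / X]gtr0_norm ?mulr_gt0// ler_pdivrMr ?mulr_gt0//.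
have : `|w y - w x| < e * c1 ^+ 2 by rewrite distrC; apply: Hd; rewrite /ball/= distrC.
move=> /ltW/le_trans; apply; rewrite ler_wpM2l ?(ltW e0)// expr2.
by apply: ler_pM => //; exact: ltW.
Qed.

(* Increments of the flow over [x, y] obey D' = (u_x at an intermediate point) D,
   so D (1 + t w / r) ^ (- r) stays within a factor exp (+- e t) of y - x. *)
Lemma flow_space_derivative T (v p : R -> R -> R) : (0%:E < T)%E -> flow_in_Diff T v p ->
  (forall t x, before T t -> is_derive x (1 : R) (v t) (derive1 (v t) x)) ->
  (forall t x, before T t -> base t x * derive1 (v t) (p t x) = w x /\ 0 < base t x) ->
  (forall t, before T t -> good t) ->
  forall t x, before T t -> derive1 (p t) x = base t x `^ r.
Proof.
move=> T0 [p0 pD dp] dv bq gT t x tT.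
have dpx s y : before T s -> is_derive y (1 : R) (p s) (derive1 (p s) y).
  by move=> /pD/Diff_minfty_facts[].
have p_pos s y : before T s -> 0 < derive1 (p s) y by move=> /pD/Diff_minfty_facts[].
have p_lt s y z : before T s -> y < z -> p s y < p s z.
  move=> sT yz; have [a _ E] := is_derive1_MVT yz (fun a _ => dpx s a sT).
  by rewrite -subr_gt0 E mulr_gt0 ?subr_gt0// p_pos.
have := tT.1; rewrite le_eqVlt => /predU1P[t0|t0].
  have -> : p t = id by apply/funext => y; rewrite -t0 p0.
  rewrite -t0 /stretch !mul0r add0r powR1.
  by rewrite (derive1_of (f' := fun=> 1)) => // y; exact: is_derive1_id.
set b := base t x `^ r; have b0 : 0 < b by rewrite powR_gt0//; have [] := bq t x tT.
apply/eqP; rewrite -subr_eq0 -normr_le0; apply/ler_addgt0Pl => B B0; rewrite addr0.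
(* Chosen so that the factor exp(e t) is 1 + B / b, which turns into an error [B] on a derivative
   close to [b]. *)
pose e := ln (1 + B / b) / t.
have Bb : 0 < B / b by rewrite divr_gt0.
have e0 : 0 < e by rewrite divr_gt0// ln_gt0// ltrDl.
have et : expR (e * t) = 1 + B / b.
  by rewrite divfK ?gt_eqF// lnK// posrE addr_gt0.
have [d d0 Hd] := rate_continuous x (gT t tT) (ltW t0) e0.
have key y : x < y < x + d ->
    b * (y - x) <= (p t y - p t x) * expR (e * t) /\
    p t y - p t x <= b * (y - x) * expR (e * t).
  move=> /andP[xy yd].
  pose D s := p s y - p s x.
  pose D' s := v s (p s y) - v s (p s x).
  have dD : tder T D D' by apply: is_tderive_tder => // s sT; apply: is_tderiveB; exact: dp.
  have db : tder T (fun s => base s x `^ (- r)) (fun s => w x / r * (- r * base s x `^ (- r - 1))).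
    apply: tder_global => // s s0 sT; have [_ bp] := bq s x (conj s0 sT).
    exact: (@is_derive1_powR_comp _ (base^~ x) (- r) s _ bp (is_derive_base_t r w s x)).
  have dG := tderM dD db.
  pose G s := D s * base s x `^ (- r).
  have G0 : G 0 = y - x by rewrite /G /D !p0 /stretch !mul0r add0r powR1 mulr1.
  have Gt : G t = D t / b by rewrite /G powRN.
  have Gbound s : 0 < s < t ->
      `|D' s * base s x `^ (- r) + D s * (w x / r * (- r * base s x `^ (- r - 1)))| <= e * G s.
    move=> /andP[s0 st].
    have sT : before T s by apply: before_le tT; rewrite !ltW.
    have pxy := p_lt s x y sT xy.
    have [a /andP[xa ay] Ea] := is_derive1_MVT pxy (fun a _ => dv s a sT).
    (* The intermediate point lies between the images of [x] and [y], hence is itself the image of a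
       label [z] in [x, y]. The logarithmic derivative of [G] is then the difference of the rates w
       / base at [z] and [x]. *)
    have [z zxy Ez] : exists2 z, x <= z <= y & p s z = a.
      have cps : {within `[x, y], continuous (p s)}.
        by apply: continuous_subspaceT => z; exact: is_derive1_continuous (dpx s z sT).
      have aI : Num.min (p s x) (p s y) <= a <= Num.max (p s x) (p s y).
        by rewrite (min_l (ltW pxy)) (max_r (ltW pxy)) !ltW.
      have [z zI <-] := IVT (ltW xy) cps aI.
      by exists z => //; move: zI; rewrite in_itv.
    have [bqz bz] := bq s z sT; have [bqx bx] := bq s x sT.
    have D'E : D' s = w z / base s z * D s.
      by rewrite /D' Ea -Ez -bqz [base s z * _]mulrC mulfK// gt_eqF.
    have bS : base s x `^ (- r) = base s x `^ (- r - 1) * base s x.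
      by rewrite -{3}(powRr1 (ltW bx)) -powRD ?subrK// (gt_eqF bx) implybT.
    have G0' : 0 <= G s.
      by rewrite mulr_ge0 ?powR_ge0// subr_ge0 ltW.
    have -> : D' s * base s x `^ (- r) + D s * (w x / r * (- r * base s x `^ (- r - 1))) =
        (w z / base s z - w x / base s x) * G s.
      rewrite D'E /G bS; field; by rewrite r0 !gt_eqF.
    rewrite normrM (ger0_norm G0') ler_wpM2r//.
    apply: Hd; first by rewrite !ltW.
    by move: zxy => /andP[z1 z2]; rewrite ger0_norm; lra.
  split.
    have H : - G t <= - G 0 * expR (- e * t).
      apply: (gronwall_le (tderN dG) tT.1 tT.2) => s st.
      rewrite mulrNN; apply: le_trans (Gbound s st).
      by rewrite -normrN ler_norm.
    have ee : expR (- e * t) * expR (e * t) = 1 by rewrite -expRD mulNr addNr expR0.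
    have : G 0 * expR (- e * t) * expR (e * t) <= G t * expR (e * t).
      by rewrite ler_wpM2r ?expR_ge0//; lra.
    rewrite -mulrA ee mulr1 G0 Gt mulrAC ler_pdivlMr//.
    by rewrite [b * _]mulrC.
  have := gronwall_le (e := e) dG tT.1 tT.2.
  rewrite -/(G t) -/(G 0) G0 Gt ler_pdivrMr// => H.
  rewrite [b * _]mulrC mulrAC; apply: H => s st.
  by apply: le_trans (Gbound s st); exact: ler_norm.
(* The derivative of p t is known to exist, so increments to the right determine it; this is why
   [key] only treats y > x. *)
apply: (@is_tderive_bound _ (fun k => p t (x + k)) 0 _ b B d) => //.
  apply: is_derive_tderive.
  have := @is_derive1_chain _ (p t) (fun k => x + k) 0 (derive1 (p t) x) 1.
  rewrite addr0 mul1r; apply; first exact: (dpx t x tT).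
  by have /is_derive_eq := is_derive1D (is_derive1_cst x 0) (is_derive1_id (0 : R)); apply; rewrite add0r.
move=> k k0; rewrite subr0 addr0 => kd; rewrite (ger0_norm k0) in kd *.
move: k0; rewrite le_eqVlt => /predU1P[<-|k0].
  by rewrite addr0 subrr !mulr0 subr0 normr0.
have := key (x + k); rewrite ltrDl ltrD2l k0 kd => /(_ isT).
rewrite addrAC subrr add0r et => -[h1 h2].
have bB : b * (B / b) = B by rewrite mulrC divfK// gt_eqF.
rewrite ler_norml; apply/andP; split.
  have h3 : b * k / (1 + B / b) <= p t (x + k) - p t x.
    by rewrite ler_pdivrMr// addr_gt0.
  have h4 : b * k - B * k <= b * k / (1 + B / b).
    rewrite ler_pdivlMr ?addr_gt0//.
    rewrite (_ : (b * k - B * k) * _ = b * k - k * (B * (B / b)) - B * k + k * (b * (B / b))); last by ring.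
    rewrite bB; have : 0 <= k * (B * (B / b)) by apply: mulr_ge0; [exact: ltW|apply: mulr_ge0; exact: ltW].
    by lra.
  lra.
have : b * k * (1 + B / b) = b * k + k * (b * (B / b)) by ring.
rewrite bB; lra.
Qed.

End PJ_uniqueness.

(** * Uniqueness for the Eulerian equation *)

Section PJ_unique_solution.
Context {R : realType}.
Implicit Types (x y z s t c d e q : R) (T : \bar R).
Local Notation Pi := (@integrable_bounded R).
Variables (r : R) (u0 : R -> R).
Hypothesis r0 : r != 0.
Hypothesis hu0 : g_minfty u0.
Local Notation w := (derive1 u0).
Let sw : smooth Pi w. Proof. by have [] := g_minfty_smooth hu0. Qed.
Local Notation base := (stretch r w).
Local Notation good := (good r w).
Local Notation vel := (velocity r w).

(* One integration in x gives u_tx + u_x ^ 2 / r + u u_xx = c t, and the decay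
   of u_x along the flow as x --> -oo forces c = 0. *)
Lemma PJ_unique T (v : R -> R -> R) : (0%:E < T)%E -> PJ_solution r^-1 u0 T v ->
  (forall t x, before T t -> 0 < base t x) /\
  ((forall t, before T t -> good t) -> forall t x, before T t -> v t x = vel t x).
Proof.
move=> T0 [v0 vg [p fl] cv [ut [dvt dut cut PJ]]]; have [p0 pD dp] := fl.
pose vx t x : R := derive1 (v t) x; pose vxx t x : R := derive1n 2 (v t) x.
pose vxxx t x : R := derive1n 3 (v t) x.
pose utx t x : R := derive1 (ut t) x; pose utxx t x : R := derive1n 2 (ut t) x.
have svx t : before T t -> smooth Pi (vx t) by move=> /vg/g_minfty_smooth[].
have dv t x : before T t -> is_derive x (1 : R) (v t) (vx t x).
  by move=> /vg/g_minfty_smooth[].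
have dvx t x : before T t -> is_derive x (1 : R) (vx t) (vxx t x).
  by move=> tT; exact: (smooth_is_derive x (svx t tT)).
have dvxx t x : before T t -> is_derive x (1 : R) (vxx t) (vxxx t x).
  by move=> tT; exact: (smooth_is_derive x (smooth_derive1 (svx t tT))).
have dutt t x : before T t -> is_derive x (1 : R) (ut t) (utx t x).
  by move=> tT; exact: (derivable_is_derive1 (dut 0%N t x isT tT)).
have dutx t x : before T t -> is_derive x (1 : R) (utx t) (utxx t x).
  by move=> tT; exact: (derivable_is_derive1 (dut 1%N t x isT tT)).
have cvx : continuous_before T vx := cv 1%N isT.
have cvxx : continuous_before T vxx := cv 2%N isT.
have cutx : continuous_before T utx := cut 1%N isT.
have dvxt t x : before T t -> is_tderive (fun s => vx s x) t (utx t x).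
  by move=> tT; exact: (@schwarz_xt _ T v vx ut utx t x dv dvt dutt cutx tT).
pose C t x : R := utx t x + r^-1 * (vx t x * vx t x) + v t x * vxx t x.
have C0 t x : before T t -> C t x = C t 0.
  move=> tT; apply: (@is_derive_0_is_cst _ (C t)) => y.
  have := is_derive1D (is_derive1D (dutx t y tT) (is_derive1Zl r^-1 (is_derive1M (dvx t y tT) (dvx t y tT))))
    (is_derive1M (dv t y tT) (dvxx t y tT)).
  move/is_derive_eq; apply; rewrite -[RHS](PJ t y tT) -/(vx t y) -/(vxx t y) -/(vxxx t y) -/(utxx t y).
  by ring.
pose c t := C t 0.
pose q t y := vx t (p t y).
have dq y t : before T t -> is_tderive (q^~ y) t (c t - r^-1 * q t y ^+ 2).
  (* The derivative along the flow is the contribution of the moving point plus u_tx at the fixed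
     point. *)
  move=> tT; have mov := tderive_moving dvx cvxx tT (dp t y tT).
  have := is_tderiveD mov (dvxt t (p t y) tT).
  have -> : vxx t (p t y) * v t (p t y) + utx t (p t y) = c t - r^-1 * q t y ^+ 2.
    by rewrite /c -(C0 t (p t y) tT) /C /q; ring.
  refine (is_tderive_near ltr01 _ tT.1) => s _ _.
  by rewrite subrK.
have dqT y : tder T (q^~ y) (fun t => c t - r^-1 * q t y ^+ 2).
  by apply: is_tderive_tder => // t; exact: dq.
have qNy t : before T t -> q t y @[y --> -oo] --> (0 : R).
  move=> tT; have [_ _ pNy] := Diff_minfty_facts (pD t tT).
  have [vNy _] := smooth_integrable_cvg (svx t tT).
  apply: (cvg_comp _ _ _ vNy).
  apply/cvgrNyPle => A; near=> y.
  have h1 : `|0 - (p t y - y)| < 1 by near: y; move/cvgrPdist_lt : pNy => /(_ _ ltr01).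
  have h2 : y <= A - 1 by near: y; exact: nbhs_ninfty_le (num_real _).
  by move: h1; rewrite sub0r normrN ltr_norml; lra.
have cc t : before T t -> forall e : R, 0 < e -> exists2 d : R, 0 < d &
    forall s, before T s -> `|s - t| < d -> `|c s - c t| < e.
  move=> tT e e0.
  have cC : continuous_before T C.
    have cv0 : continuous_before T v := cv 0%N isT.
    move=> z; apply: cvgD; last by apply: cvgM; [exact: cv0|exact: cvxx].
    apply: cvgD; first exact: cutx.
    by apply: cvgM; [exact: cvg_cst|apply: cvgM; exact: cvx].
  have [d d0 Hd] := (continuous_beforeP T C).1 cC t 0 tT e e0.
  by exists d => // s sT sd; apply: Hd => //; rewrite subrr normr0.
have c0 t : before T t -> c t = 0.
  by move=> tT; exact: (riccati_forcing_eq0 dqT qNy (cc t tT) tT).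
have dq0 y : tder T (q^~ y) (fun t => - r^-1 * q t y ^+ 2).
  apply: is_tderive_tder => // t tT; have := dq y t tT.
  by rewrite c0// sub0r mulNr.
have q0 y : q 0 y = w y.
  by rewrite /q p0 /vx; congr (derive1 _ y); apply/funext => z; exact: v0.
have bq y := riccati_explicit r0 T0 (dq0 y) (q0 y).
split=> [t x tT|gT]; first by have [] := bq x t tT.
apply: (velocity_determined r0 hu0 fl gT) => t x tT.
apply: (flow_space_derivative r0 hu0 T0 fl dv _ gT) tT => s y sT.
exact: bq.
Unshelve. all: by end_near. Qed.

End PJ_unique_solution.

(** * Invariance of the solution predicates under equality on the time interval *)

Section transfer.
Context {R : realType}.
Variables (lam : R) (u0 : R -> R) (T : \bar R) (u v : R -> R -> R).
Hypothesis T0 : (0%:E < T)%E.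
Hypothesis uv : forall t, before T t -> u t = v t.

Lemma flow_in_Diff_eq p : flow_in_Diff T u p -> flow_in_Diff T v p.
Proof.
by move=> [p0 pD dp]; split=> // t x tT; rewrite -uv//; exact: dp.
Qed.

Lemma PJ_Lagrangian_solution_eq :
  PJ_Lagrangian_solution lam u0 T u -> PJ_Lagrangian_solution lam u0 T v.
Proof.
move=> [u00 ug [p [pxt [fl H1 H2 H3]]]]; split.
- by move=> x; rewrite -uv//; split.
- by move=> t tT; rewrite -uv//; exact: ug.
- by exists p, pxt; split=> //; exact: flow_in_Diff_eq.
Qed.

Lemma PJ_solution_eq : PJ_solution lam u0 T u -> PJ_solution lam u0 T v.
Proof.
move=> [u00 ug [p fl] cu [ut [H1 H2 H3 H4]]]; split.
- by move=> x; rewrite -uv//; split.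
- by move=> t tT; rewrite -uv//; exact: ug.
- by exists p; exact: flow_in_Diff_eq.
- move=> k k3; apply/continuous_beforeP => t x tT e e0.
  have [d d0 Hd] := (continuous_beforeP T _).1 (cu k k3) t x tT e e0.
  by exists d => // s y sT; rewrite -!uv//; exact: Hd.
exists ut; split; [|exact: H2|exact: H3|].
- move=> t x tT; have [d d0 Hd] := before_near tT.
  refine (is_tderive_near d0 _ tT.1 (H1 t x tT)) => s s0 sd.
  by rewrite (uv (Hd s s0 sd)).
- by move=> t x tT; have := H4 t x tT; rewrite (uv tT).
Qed.

End transfer.

Theorem corollary2p10p1 (R : realType) (r : R) (hr : r != 0) (u0 : R -> R)
    (hu0 : g_minfty u0) :
  exists T : \bar R,
    [/\ (0%:E < T)%E,
        forall t : R, 0 <= t ->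
          ((t%:E < T)%E <->
           forall s : R, 0 <= s <= t -> Diff_minfty (explicit_flow r u0 s)),
        unique_maximal_solution (HS_solution r u0) T (explicit_solution r u0)
      & unique_maximal_solution (PJ_solution r^-1 u0) T
          (explicit_solution r u0)].
Proof.
have [sw _ _] := g_minfty_smooth hu0.
have [T [T0 Tgood Tpos TDiff]] := maximal_time hr sw.
have gT t : before T t -> good r (derive1 u0) t by move=> [t0 tT]; exact: Tgood.
have uE t : before T t -> velocity r (derive1 u0) t = explicit_solution r u0 t.
  by move=> /gT gt; apply/funext => x; rewrite explicit_solutionE.
(* Both uniqueness results have the same two-stage shape, so maximality is derived once: positivity
   before T' places these times before T, where [good] is available. *)
have maximal (sol : \bar R -> (R -> R -> R) -> Prop) :
    sol T (explicit_solution r u0) ->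
    (forall T' v, (0%:E < T')%E -> sol T' v ->
      (forall t x, before T' t -> 0 < stretch r (derive1 u0) t x) /\
      ((forall t, before T' t -> good r (derive1 u0) t) ->
        forall t x, before T' t -> v t x = velocity r (derive1 u0) t x)) ->
    unique_maximal_solution sol T (explicit_solution r u0).
  move=> solT uniq; split=> // T' v T'0 solv.
  have [pos eq] := uniq T' v T'0 solv.
  have beforeT t : before T' t -> before T t.
    by move=> tT'; split; [exact: tT'.1|apply: Tpos => [|y]; [exact: tT'.1|exact: pos]].
  split=> [|t x tT'].
    rewrite leNgt; apply/negP => TT'.
    (* If T < T', then T is a finite time before T', and [beforeT] would yield T < T. *)
    have Tfin : T \is a fin_num.
      by rewrite fin_numElt (lt_trans _ T0) ?ltNy0// (lt_le_trans TT') ?leey.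
    have [_] : before T (fine T).
      by apply: beforeT; split; [rewrite fine_ge0// ltW|rewrite fineK].
    by rewrite fineK// ltxx.
  rewrite -uE; last exact: beforeT.
  by apply: eq => // s /beforeT /gT.
exists T; split=> //.
- move=> t t0; split=> [tT s /andP[s0 st]|]; last exact: TDiff.
  apply: (flow_Diff_minfty hr sw); apply: Tgood => //.
  by apply: le_lt_trans tT; rewrite lee_fin.
- apply: maximal => [|T' v T'0]; last exact: Lagrangian_unique.
  exact: PJ_Lagrangian_solution_eq T0 uE (PJ_Lagrangian_explicit hr hu0 gT).
- apply: maximal => [|T' v T'0]; last exact: PJ_unique.
  exact: PJ_solution_eq T0 uE (PJ_explicit hr hu0 gT).
Qed.
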